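(* Let $\{i_1,\dots,i_s\}$ be a type with $i_1+\dots+i_s=n$ and $s\ne n$. Then $\mathrm{sh}_{\{i_1,\dots,i_s\}}$ is a singular variety.
   Context: Everything is over $\mathbb{C}$. Fusion product: for positive integers $A=(a_1,\dots,a_n)$ choose pairwise distinct $z_1,\dots,z_n\in\mathbb{C}$ and let $\mathbb{C}^{a_i}(z_i)$ be the evaluation module of $\mathfrak{sl}_2\otimes\mathbb{C}[t]$, i.e. the irreducible $a_i$-dimensional $\mathfrak{sl}_2$-module on which $x_k:=x\otimes t^k$ acts as $z_i^k x$. The tensor product $V=\bigotimes_i\mathbb{C}^{a_i}(z_i)$ is cyclic, generated by the tensor product $v$ of lowest weight vectors. Filter $V$ by the subspaces $V^{(m)}$ spanned by $x^{(1)}_{k_1}\cdots x^{(r)}_{k_r}v$ with $x^{(l)}\in\mathfrak{sl}_2$ and $k_1+\dots+k_r\le m$. The fusion product $M^A$ is the associated graded $\mathfrak{sl}_2\otimes\mathbb{C}[t]$-module; it is (known to be) independent of the $z_i$ and is an $\mathfrak{sl}_2\otimes(\mathbb{C}[t]/t^n)$-module. Let $v_A\in M^A$ be the image of $v$. $G=\mathrm{SL}_2(\mathbb{C}[t]/t^n)$ acts on $\mathbb{P}(M^A)$; for $2\le a_1\le\dots\le a_n$ put $\mathrm{sh}_A=\overline{G\cdot[v_A]}\subset\mathbb{P}(M^A)$, where $[v_A]=\mathbb{C}v_A$. A type is an ordered tuple $\{i_1,\dots,i_s\}$ of positive integers with sum $n$, and $\mathrm{sh}_{\{i_1,\dots,i_s\}}=\mathrm{sh}_A$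 for $A=(2^{i_1}3^{i_2}\cdots(s+1)^{i_s})$, i.e. $i_1$ entries equal to $2$, then $i_2$ entries equal to $3$, etc. (up to $G$-equivariant isomorphism any $A$ with entries $2\le a_1\le\dots\le a_n$ and the same blocks of equal entries can be used). *)

(* Defs.v *)
From HB Require Import structures.
From mathcomp Require Import all_boot all_order all_algebra.
From mathcomp Require Import boolp classical_sets reals complex.
From mathcomp Require Import mpoly ring.

Set Implicit Arguments.
Unset Strict Implicit.
Unset Printing Implicit Defensive.

Import GRing.Theory.
Local Open Scope classical_set_scope.
Local Open Scope ring_scope.

Section LinearAlgebra.
Context {F : fieldType}.

(* The linear span of an arbitrary, possibly infinite, set of vectors. *)
Definition vspan {V : vectType F} (P : set V) : {vspace V} :=
  xget 0%VS [set U : {vspace V} | P `<=` [set` U] /\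
    forall W : {vspace V}, P `<=` [set` W] -> (U <= W)%VS].

Lemma vspanP (V : vectType F) (P : set V) :
  P `<=` [set` vspan P] /\
  forall W : {vspace V}, P `<=` [set` W] -> (vspan P <= W)%VS.
Proof.
suff [U PU] : exists U : {vspace V}, P `<=` [set` U] /\
    forall W : {vspace V}, P `<=` [set` W] -> (U <= W)%VS.
  by apply: (@xgetPex _ 0%VS [set U : {vspace V} | P `<=` [set` U] /\
    forall W : {vspace V}, P `<=` [set` W] -> (U <= W)%VS]); exists U.
have step n : forall U : {vspace V}, (\dim {:V} - \dim U < n)%N ->
    (forall W : {vspace V}, P `<=` [set` W] -> (U <= W)%VS) ->
    exists U' : {vspace V}, P `<=` [set` U'] /\
      forall W : {vspace V}, P `<=` [set` W] -> (U' <= W)%VS.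
  elim: n => [//|n IHn] U ltUn minU.
  have [PU|/existsNP[u /not_implyP[Pu /negP uNU]]] := pselect (P `<=` [set` U]).
    by exists U.
  have ltU : (\dim U < \dim (U + <[u]>))%N.
    rewrite ltn_neqAle dimvS ?addvSl// andbT dimv_leqif_sup ?addvSl//.
    by rewrite subv_add subvv/= -memvE.
  apply: (IHn (U + <[u]>)%VS) => [|W PW].
    have leV := dimvS (subvf (U + <[u]>)%VS).
    rewrite -ltnS (leq_trans _ ltUn)// ltnS ltn_sub2l//.
    exact: leq_trans leV.
  by rewrite subv_add minU// -memvE; apply: PW.
by apply: (step _ 0%VS (ltnSn _)) => W _; exact: sub0v.
Qed.

Lemma vspan_lin (V W : vectType F) (f : {linear V -> W}) (P : set V)
    (U : {vspace W}) :
  (forall u, P u -> f u \in U) -> forall u, u \in vspan P -> f u \in U.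
Proof.
move=> PU u uP; rewrite -[f u](lfunE f) memv_preim.
apply: subvP u uP; apply: (vspanP P).2 => u Pu.
by rewrite /= -memv_preim lfunE PU.
Qed.

(* The vector space R / (R :&: S), carried by a complement of R :&: S in R.   *)
Definition subquot {W : vectType F} (R S : {vspace W}) : vectType F :=
  subvs_of (R :\: S).

Definition cls {W : vectType F} (R S : {vspace W}) (w : W) : subquot R S :=
  vsproj (R :\: S) (addv_pi1 R S w).

Lemma cls_eq0 (W : vectType F) (R S : {vspace W}) (w : W) :
  w \in R -> (cls R S w == 0) = (w \in S).
Proof.
move=> wR.
have wRS : w \in (R + S)%VS by apply: subvP wR; exact: addvSl.
have piE := addv_pi1_pi2 wRS.
have pi1 : addv_pi1 R S w \in (R :\: S)%VS by exact: memv_pi.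
apply/eqP/idP => [/(congr1 val)|wS].
  rewrite [LHS]vsprojK// => pi0.
  by rewrite -piE [addv_pi1 _ _ _]pi0 add0r memv_pi2.
apply: val_inj; rewrite [LHS]vsprojK//.
have pi1S : addv_pi1 R S w \in S.
  by rewrite -(addrK (addv_pi2 R S w) (addv_pi1 R S w)) piE rpredB// memv_pi2.
by apply/eqP; rewrite -memv0 -(capv_diff R S) memv_cap pi1S pi1.
Qed.

Lemma cls_linear (W : vectType F) (R S : {vspace W}) : linear (@cls W R S).
Proof. by move=> c u v; rewrite /cls !linearP. Qed.

HB.instance Definition _ (W : vectType F) (R S : {vspace W}) :=
  GRing.isLinear.Build F W (subquot R S) _ (@cls W R S) (@cls_linear W R S).

Lemma cls_vsval (W : vectType F) (R S : {vspace W}) (u : subquot R S) :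
  vsval u \in R /\ cls R S (vsval u) = u.
Proof.
split; first by apply: subvP (subvsP u); exact: diffvSl.
apply: val_inj; rewrite [LHS]vsprojK ?memv_pi//.
by rewrite [LHS]daddv_pi_id ?subvsP ?capv_diff.
Qed.

End LinearAlgebra.

(* Evaluation modules of sl2[t] and their fusion product.  An element of sl2
   is a traceless x : 'M[F]_2, and a word is a list of pairs (x, k) standing for
   the operators x_k = x t^k.                                                 *)
Section Fusion.
Context {F : fieldType}.

(* The d-dimensional irreducible module is Sym^(d-1)(F^2), with the basis
   v_j = X^j Y^(d-1-j), j < d, on which e = X d/dY, f = Y d/dX and
   h = X d/dX - Y d/dY.  The lowest weight vector is v_0.                     *)
Definition irrep_mx (d : nat) (x : 'M[F]_2) : 'M[F]_d :=
  \matrix_(i < d, j < d)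
    (x 0 1 * (d.-1 - j)%:R *+ (i == j.+1 :> nat)
     + x 1 0 * j%:R *+ (j == i.+1 :> nat)
     + x 0 0 * (j%:R - (d.-1 - j)%:R) *+ (i == j)).

Context {n : nat} (a : 'I_n -> nat) (z : 'I_n -> F).

(* Coordinates of the tensor product of the F^(a i) in the product basis.     *)
Definition tensor : vectType F :=
  {ffun {dffun forall i : 'I_n, 'I_(a i)} -> F^o}.

Definition factor_op (i : 'I_n) (x : 'M[F]_2) (u : tensor) : tensor :=
  [ffun b : {dffun forall i : 'I_n, 'I_(a i)} =>
    \sum_(c < a i) irrep_mx (a i) x (b i) c * u (finfun (dfwith b c))].

Definition eval_op (x : 'M[F]_2) (k : nat) (u : tensor) : tensor :=
  \sum_(i < n) z i ^+ k *: factor_op i x u.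

Definition lowest : tensor :=
  [ffun b : {dffun forall i : 'I_n, 'I_(a i)} =>
    [forall i, b i == 0%N :> nat]%:R].

Definition fil (m : nat) : {vspace tensor} :=
  vspan [set u : tensor | exists w : seq ('M[F]_2 * nat),
    [/\ all (fun xk => \tr xk.1 == 0) w, (\sum_(xk <- w) xk.2 <= m)%N
      & u = foldr (fun xk => eval_op xk.1 xk.2) lowest w]].

Definition fil_pred (m : nat) : {vspace tensor} :=
  if m is m'.+1 then fil m' else 0%VS.

(* A degree from which on the filtration is stationary, so that the associated
   graded space is concentrated in degrees at most top_degree.                *)
Definition top_degree : nat :=
  xget 0%N [set N | forall m, (fil m <= fil N)%VS].

Lemma top_degreeP k : (fil k <= fil top_degree)%VS.
Proof.
suff [N leN] : exists N, forall m, (fil m <= fil N)%VS.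
  by apply: (@xgetPex _ 0%N [set N | forall m, (fil m <= fil N)%VS]); exists N.
have homo_fil m1 m2 : (m1 <= m2)%N -> (fil m1 <= fil m2)%VS.
  move=> le12; apply: (vspanP _).2 => u [w [trw lew ->]].
  by apply: (vspanP _).1; exists w; split => //; exact: leq_trans lew le12.
have step d : forall N, (\dim {:tensor} - \dim (fil N) < d)%N ->
    exists N', forall m, (fil m <= fil N')%VS.
  elim: d => [//|d IHd] N ltN.
  have [leN|/existsNP[m /negP mN]] := pselect (forall m, (fil m <= fil N)%VS).
    by exists N.
  have lt_m : (N < m)%N by rewrite ltnNge; apply: contra mN => /homo_fil.
  have lt_dim : (\dim (fil N) < \dim (fil m))%N.
    have le_m := homo_fil _ _ (ltnW lt_m).
    by rewrite ltn_neqAle dimvS// andbT dimv_leqif_sup//; apply/negP.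
  apply: (IHd m); have leV := dimvS (subvf (fil m)).
  by rewrite -ltnS (leq_trans _ ltN)// ltnS ltn_sub2l// (leq_trans lt_dim).
exact: (step _ 0%N (ltnSn _)).
Qed.

(* Families (u_m) of vectors indexed by the degree m <= top_degree.           *)
Definition family : vectType F := {ffun 'I_top_degree.+1 -> tensor}.

(* \bigoplus_m V^(m) and \bigoplus_m V^(m-1), with V^(-1) = 0.                *)
Definition rees : {vspace family} :=
  vspan [set u : family | forall m : 'I_top_degree.+1, u m \in fil m].
Definition rees_pred : {vspace family} :=
  vspan [set u : family | forall m : 'I_top_degree.+1, u m \in fil_pred m].

(* \bigoplus_m V^(m) / V^(m-1)                                                *)
Definition fusion : vectType F := subquot rees rees_pred.

Definition shift_op (x : 'M[F]_2) (k : nat) (u : family) : family :=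
  [ffun m : 'I_top_degree.+1 =>
    \sum_(l < top_degree.+1 | (l + k)%N == m) eval_op x k (u l)].

(* x_k maps the class of u in degree m to the class of x_k u in degree m + k. *)
Definition fusion_op (x : 'M[F]_2) (k : nat) (u : fusion) : fusion :=
  cls rees rees_pred (shift_op x k (vsval u)).

Lemma factor_op_linear i x : linear (factor_op i x).
Proof.
move=> c u v; apply/ffunP => b; rewrite !ffunE /= scaler_sumr -big_split/=.
apply: eq_bigr => d _.
by rewrite !ffunE mulrDr; congr (_ + _); rewrite /= /GRing.scale/= mulrCA.
Qed.

HB.instance Definition _ i x :=
  GRing.isLinear.Build F tensor tensor _ (factor_op i x) (factor_op_linear i x).

Lemma eval_op_linear x k : linear (eval_op x k).
Proof.
move=> c u v; rewrite /eval_op scaler_sumr -big_split/=; apply: eq_bigr => i _.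
by rewrite linearP scalerDr !scalerA mulrC.
Qed.

HB.instance Definition _ x k :=
  GRing.isLinear.Build F tensor tensor _ (eval_op x k) (eval_op_linear x k).

Lemma shift_op_linear x k : linear (shift_op x k).
Proof.
move=> c u v; apply/ffunP => m; rewrite !ffunE scaler_sumr -big_split/=.
by apply: eq_bigr => l _; rewrite !ffunE linearP.
Qed.

HB.instance Definition _ x k :=
  GRing.isLinear.Build F family family _ (shift_op x k) (shift_op_linear x k).

Lemma eval_op_fil x k m u :
  \tr x = 0 -> u \in fil m -> eval_op x k u \in fil (m + k)%N.
Proof.
move=> trx; apply: vspan_lin => _ [w [trw lew ->]].
apply: (vspanP _).1; exists ((x, k) :: w); split => //=.
  by rewrite trx eqxx.
by rewrite big_cons/= addnC leq_add2r.
Qed.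

Lemma mem_familyP (G : nat -> {vspace tensor}) (u : family) :
  u \in vspan [set u : family | forall m : 'I_top_degree.+1, u m \in G m] <->
  forall m : 'I_top_degree.+1, u m \in G m.
Proof.
split=> [uG m|uG]; last exact: (vspanP _).1.
have lin : linear (fun v : family => v m) by move=> c v w; rewrite !ffunE.
pose f : {linear family -> tensor} := HB.pack (fun v : family => v m)
  (GRing.isLinear.Build F family tensor _ (fun v : family => v m) lin).
by apply: (vspan_lin (f := f)) uG => v; exact.
Qed.

(* The operators on the fusion product do not depend on representatives.      *)
Lemma fusion_opE x k u : \tr x = 0 -> u \in rees ->
  fusion_op x k (cls rees rees_pred u) = cls rees rees_pred (shift_op x k u).
Proof.
move=> trx uR; rewrite /fusion_op; set r := vsval _.
have [rR rE] := cls_vsval (cls rees rees_pred u); rewrite -/r in rR rE.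
have dR : r - u \in rees by rewrite rpredB.
have dS : r - u \in rees_pred by rewrite -(cls_eq0 _ dR) linearB/= rE subrr.
apply/eqP; rewrite -subr_eq0 -linearB -linearB cls_eq0.
  apply/mem_familyP => m; rewrite ffunE rpred_sum// => l /eqP <-.
  move/mem_familyP: dS => /(_ l); rewrite /fil_pred.
  case: (nat_of_ord l) => [|l'].
    by rewrite memv0 => /eqP ->; rewrite linear0 rpred0.
  by rewrite addSn => /eval_op_fil; exact.
apply/mem_familyP => m; rewrite ffunE rpred_sum// => l /eqP <-.
by apply: eval_op_fil => //; move/mem_familyP: dR; exact.
Qed.

(* The image v_A of the cyclic vector, in degree 0.                           *)
Definition fusion_vec : fusion :=
  cls rees rees_pred
    [ffun m : 'I_top_degree.+1 => if m == 0 then lowest else 0].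

End Fusion.

Lemma SL2_local_ind (B : comUnitRingType) (P : 'M[B]_2 -> Prop) :
  (forall p q : B, p \isn't a GRing.unit -> q \isn't a GRing.unit ->
     p + q \isn't a GRing.unit) ->
  P 1%:M ->
  (forall p h, P h -> P ((1%:M + p *: delta_mx 0 1) *m h)) ->
  (forall p h, P h -> P ((1%:M + p *: delta_mx 1 0) *m h)) ->
  forall g, \det g = 1 -> P g.
Proof.
move=> Bloc P1 PU PL g.
pose U (p : B) : 'M[B]_2 := 1%:M + p *: delta_mx 0 1.
pose L (p : B) : 'M[B]_2 := 1%:M + p *: delta_mx 1 0.
have mulU p (h : 'M[B]_2) i j : (U p *m h) i j = h i j + p * h 1 j *+ (i == 0).
  rewrite mulmxDl mul1mx -scalemxAl !mxE !big_ord_recl big_ord0 !mxE.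
  by case: i => [[|[|]]]//= ?; rewrite -?val_eqE/=
    ?(mulr0n, mulr1n, mul0r, mul1r, add0r, addr0, mulr0)//;
    do 3?congr (_ + _ * _); congr (h _ _); apply: val_inj.
have mulL p (h : 'M[B]_2) i j : (L p *m h) i j = h i j + p * h 0 j *+ (i == 1).
  rewrite mulmxDl mul1mx -scalemxAl !mxE !big_ord_recl big_ord0 !mxE.
  by case: i => [[|[|]]]//= ?; rewrite -?val_eqE/=
    ?(mulr0n, mulr1n, mul0r, mul1r, add0r, addr0, mulr0)//;
    do 3?congr (_ + _ * _); congr (h _ _); apply: val_inj.
have okU p h : P (U p *m h) -> P h.
  move=> /(PU (- p)); suff -> : U (- p) *m (U p *m h) = h by [].
  by apply/matrixP => i j; rewrite !mulU mulr0n addr0 mulNr mulNrn addrK.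
have okL p h : P (L p *m h) -> P h.
  move=> /(PL (- p)); suff -> : L (- p) *m (L p *m h) = h by [].
  by apply/matrixP => i j; rewrite !mulL mulr0n addr0 mulNr mulNrn addrK.
have det2 (h : 'M[B]_2) : \det h = h 0 0 * h 1 1 - h 0 1 * h 1 0.
  rewrite (expand_det_row _ 0) !big_ord_recl big_ord0 addr0 /cofactor !det_mx11.
  rewrite !mxE /= expr0 expr1 mul1r mulN1r mulrN.
  by congr (_ * _ - _ * _); congr (h _ _); apply: val_inj.
have detU p (h : 'M[B]_2) : \det (U p *m h) = \det h.
  by rewrite !det2 !mulU /= ?mulr0n ?mulr1n; ring.
have detL p (h : 'M[B]_2) : \det (L p *m h) = \det h.
  by rewrite !det2 !mulL /= ?mulr0n ?mulr1n; ring.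
have ok1 (h : 'M[B]_2) : \det h = 1 -> h 0 0 = 1 -> P h.
  move=> h1 h00; have := PL (h 1 0) _ (PU (h 0 1) _ P1); congr P.
  have h11 : h 1 1 = 1 + h 0 1 * h 1 0 by rewrite -h1 det2 h00; ring.
  have cases i : i = 0 :> 'I_2 \/ i = 1 :> 'I_2.
    by case: i => [[|[|]]]//= ?; [left|right]; apply: val_inj.
  apply/matrixP => i j; rewrite mulL !mulU !mxE.
  by case: (cases i) => ->; case: (cases j) => ->;
    rewrite ?h00 ?h11 ?eqxx -?val_eqE /= ?mulr0n ?mulr1n; ring.
have okc (h : 'M[B]_2) : \det h = 1 -> h 1 0 \is a GRing.unit -> P h.
  move=> h1 cU; apply: (okU ((1 - h 0 0) / h 1 0)); apply: ok1;
    rewrite ?detU// mulU.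
  by rewrite mulr1n divrK// addrC subrK.
move=> g1; have [cU|cNU] := boolP (g 1 0 \is a GRing.unit); first exact: okc.
have aU : g 0 0 \is a GRing.unit.
  apply/negPn/negP => aNU.
  have : g 0 0 * g 1 1 + - (g 0 1 * g 1 0) \isn't a GRing.unit.
    by apply: Bloc; rewrite ?unitrN unitrM negb_and ?aNU ?cNU ?orbT.
  by rewrite -det2 g1 unitr1.
apply: (okL ((1 - g 1 0) / g 0 0)); apply: okc; rewrite ?detL// mulL.
by rewrite mulr1n divrK// addrC subrK unitr1.
Qed.

Lemma qpolyXn_local (F : fieldType) (n : nat)
    (p q : {poly %/ ('X^n : {poly F})}) :
  p \isn't a GRing.unit -> q \isn't a GRing.unit ->
  p + q \isn't a GRing.unit.
Proof.
have [k hE k_gt0] : exists2 k, mk_monic ('X^n : {poly F}) = 'X^k & (0 < k)%N.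
  rewrite /mk_monic monicXn size_polyXn ltnS andbT.
  by case: ifP => ?; [exists n|exists 1%N].
have unitE (r : {poly %/ ('X^n : {poly F})}) :
    (r \is a GRing.unit) = ~~ root (val r) 0.
  rewrite [LHS](_ : _ = coprimep (mk_monic 'X^n) (val r))//.
  move: (val r) => r'; rewrite hE.
  by rewrite coprimep_pexpl// coprimep_sym coprimepX.
by rewrite !unitE !negbK /root !hornerD => /eqP -> /eqP ->; rewrite addr0.
Qed.

(* The action of SL_2(F[t]/t^n) on a finite-dimensional module M over
   sl2 tensor F[t]/t^n, where act x k : M -> M is the action of x t^k.        *)
Section GroupAction.
Context {F : fieldType} (n : nat) {M : vectType F}.
Context (act : 'M[F]_2 -> nat -> M -> M).

Local Notation A := {poly %/ 'X^n : {poly F}}.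

Definition current_op (x : 'M[F]_2) (p : A) (u : M) : M :=
  \sum_(k < n) (val p)`_k *: act x k u.

(* Exponential of a nilpotent endomorphism: T^k = 0 for k > dim M.            *)
Definition nilp_exp (T : M -> M) (u : M) : M :=
  \sum_(k < (\dim {:M}).+1) (k`!%:R)^-1 *: iter k T u.

(* integrates g T: the group element g acts on M as T.  It is the subgroup of
   SL_2(A) x GL(M) generated by the pairs (exp(p e), exp(p e)) and
   (exp(p f), exp(p f)), p in A, i.e., the graph of the representation of
   SL_2(A) obtained by integrating act.  As A is local, SL_2(A) is generated by
   its elementary matrices, so that every g has an image (integrates_total).  *)
Inductive integrates : 'M[A]_2 -> (M -> M) -> Prop :=
| integrates_id : integrates 1%:M id
| integrates_e p g T : integrates g T ->
    integrates ((1%:M + p *: delta_mx 0 1) *m g)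
      (nilp_exp (current_op (delta_mx 0 1) p) \o T)
| integrates_f p g T : integrates g T ->
    integrates ((1%:M + p *: delta_mx 1 0) *m g)
      (nilp_exp (current_op (delta_mx 1 0) p) \o T).

Lemma integrates_total (g : 'M[A]_2) : \det g = 1 ->
  exists T, integrates g T.
Proof.
move: g; apply: SL2_local_ind => [p q||p h [T HT]|p h [T HT]].
- exact: qpolyXn_local.
- by exists id; constructor.
- by eexists; apply: integrates_e HT.
- by eexists; apply: integrates_f HT.
Qed.

End GroupAction.

Section ProjectiveVarieties.
Context {F : fieldType} {M : vectType F}.

Definition projspace : Type := {L : {vspace M} | \dim L == 1%N}.

Definition coords (u : M) : 'I_(\dim {:M}) -> F :=
  fun i => coord (vbasis {:M}) i u.

Definition vanishes (P : {mpoly F[\dim {:M}]}) (L : projspace) : Prop :=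
  forall u, u \in sval L -> P.@[coords u] = 0.

Definition homogeneous (P : {mpoly F[\dim {:M}]}) : Prop :=
  exists d, P \is d.-homog.

Definition zero_locus (S : set {mpoly F[\dim {:M}]}) : set projspace :=
  [set L | forall P, S P -> vanishes P L].

(* The homogeneous elements of the homogeneous ideal of X.                    *)
Definition hideal (X : set projspace) : set {mpoly F[\dim {:M}]} :=
  [set P | homogeneous P /\ forall L, X L -> vanishes P L].

Definition zclosed (X : set projspace) : Prop :=
  exists S, S `<=` homogeneous /\ X = zero_locus S.

Definition zclosure (X : set projspace) : set projspace :=
  \bigcap_(Z in [set Z | zclosed Z /\ X `<=` Z]) Z.

Definition irreducible_set (X : set projspace) : Prop :=
  X !=set0 /\ forall Y Z, zclosed Y -> zclosed Z -> X `<=` Y `|` Z ->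
    X `<=` Y \/ X `<=` Z.

(* Chains Z_0 < ... < Z_d of irreducible closed subsets of X containing L.    *)
Definition chain_at (X : set projspace) (L : projspace) (d : nat) : Prop :=
  exists Z : nat -> set projspace,
    (forall i, (i <= d)%N ->
       [/\ zclosed (Z i), irreducible_set (Z i), Z i `<=` X & Z i L]) /\
    (forall i, (i < d)%N -> Z i `<` Z i.+1).

(* dim_L X = d, i.e., the local ring of X at L has Krull dimension d.         *)
Definition local_dim (X : set projspace) (L : projspace) (d : nat) : Prop :=
  chain_at X L d /\ forall d', chain_at X L d' -> (d' <= d)%N.

(* The tangent space of the affine cone over X along the line L.              *)
Definition cone_tangent (X : set projspace) (L : projspace) : {vspace M} :=
  vspan [set w : M | forall P, hideal X P -> forall u, u \in sval L ->
    \sum_(j < \dim {:M}) (P^`M(j)).@[coords u] * coords w j = 0].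

(* T_L X is the quotient of cone_tangent X L by L, up to a twist.             *)
Definition tangent_dim (X : set projspace) (L : projspace) : nat :=
  (\dim (cone_tangent X L)).-1.

Definition singular_at (X : set projspace) (L : projspace) : Prop :=
  exists d, local_dim X L d /\ (d < tangent_dim X L)%N.

Definition singular (X : set projspace) : Prop :=
  exists L, X L /\ singular_at X L.

End ProjectiveVarieties.

(* (2^(i_1) 3^(i_2) ... (s+1)^(i_s)) *)
Definition type_seq (t : seq nat) : seq nat :=
  flatten [seq nseq (nth 0%N t j) j.+2 | j <- iota 0 (size t)].

Section FusionSchubert.
Context {F : fieldType} {n : nat} (a : 'I_n -> nat) (z : 'I_n -> F).

(* The orbit of [v_A] under SL_2(F[t]/t^n).                                   *)
Definition fusion_orbit : set (projspace (M := fusion a z)) :=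
  [set L | exists g T, [/\ \det g = 1,
     integrates (n := n) (@fusion_op F n a z) g T
     & sval L = <[T (fusion_vec a z)]>%VS]].

Definition sh : set (projspace (M := fusion a z)) := zclosure fusion_orbit.

End FusionSchubert.

Arguments fusion_orbit {F n} a z.
Arguments sh {F n} a z.

(* Main.v *)
From HB Require Import structures.
Require Import Defs.
From mathcomp Require Import all_boot all_order all_algebra.
From mathcomp Require Import boolp classical_sets reals complex.
From mathcomp Require Import mpoly ring zify.

Set Implicit Arguments.
Unset Strict Implicit.
Unset Printing Implicit Defensive.

Import GRing.Theory.
Local Open Scope classical_set_scope.
Local Open Scope ring_scope.


(* The vectors c exp(\sum_k p_k e_k) v, with v the cyclic vector, form a cell that
   is dense in the affine cone over sh, because its ideal is stable under the
   derivations induced by e_k and f_k.  As the cell has n parameters besides the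
   scalar, comparing Hilbert functions bounds the length of chains in sh by n.
   Let m be the number of blocks of length 1 before the first block, of length
   b > 1, and let nt = m + b.  Letting t -> 0 along the curves
   exp(c t^mu \sum_(q < nt) t^-(q+1) e_(n-nt+q)) v, 0 < mu < b, gives a limit
   point u in sh.  The derivatives of these curves at t = 0 for various c and mu
   separate into three vectors tangent at u, which together with u and
   e_0 u, ..., e_(n-3) u are linearly independent, so that the tangent space at
   [u] has dimension at least n + 1.  Independence is tested on the top terms of
   V^(D) by linear functionals whose values on words in the e_k are permanents
   of moments of divided differences at the points z_i.                        *)

(** * Polynomials along curves *)

(** Everything hinges on the bound [sigma]. Up to terms of lower filtration degree, the s-th power
    of the truncated current is a polynomial in x whose coordinates in the tensor basis are
    divisible by (x - z_p)^(s - (a_p - 1)) for p < nt, because a factor of dimension a_p absorbs at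
    most a_p - 1 raising operators. Divisibility expresses low coefficients through terms that die
    in the graded module, and [sigma s] is the resulting bound. It grows by at least b per step up
    to s = m + 1, by exactly b at the last step, and is constant from there on. Hence, for 0 < mu <
    b, sigma s - mu s has a strict maximum at s = m + 1: all the curves share one limit, and s = m +
    2 and s = m enter to first order exactly for mu = 1 and mu = b - 1. A block of length 1 would
    leave no such mu. No basis of the graded module is used: vanishing comes from divisibility,
    nonvanishing from functionals. The functionals may only involve monomials within the bounds b_i
    < a_i, and the first factor has just a_0 = 2; this is the obstacle for words with m + 2 large
    exponents. *)

Section Curves.
Context {F : fieldType} (char0 : forall k, (k.+1%:R : F) != 0).

Lemma natrS_inj : injective (fun k => k.+1%:R : F).
Proof.
have lt_neq k l : (k < l)%N -> k.+1%:R != l.+1%:R :> F.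
  move=> ltkl; rewrite eq_sym -subr_eq0 -natrB ?ltnS 1?ltnW//.
  by rewrite subSS; case: (l - k)%N (subn_gt0 k l) => [|d _]; rewrite ?ltkl.
move=> k l /eqP; case: (ltngtP k l) => // ltkl /eqP e.
  by have := lt_neq _ _ ltkl; rewrite e eqxx.
by have := lt_neq _ _ ltkl; rewrite e eqxx.
Qed.

(** Characteristic 0 supplies the infinitely many roots 1, 2, 3, ... The value at 0 stays free, as
    the curves below are only defined for nonzero parameters. *)
Lemma poly_eq0_units (p : {poly F}) : (forall c, c != 0 -> p.[c] = 0) -> p = 0.
Proof.
move=> p0; apply/eqP/negPn/negP => pN0.
pose rs : seq F := [seq k.+1%:R | k <- iota 0 (size p)].
have := max_poly_roots (rs := rs) pN0.
rewrite size_map size_iota ltnn => E; suff: false by []; apply: E.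
  by apply/allP => x /mapP[k _ ->]; apply/eqP; apply: p0.
by rewrite map_inj_uniq ?iota_uniq//; exact: natrS_inj.
Qed.

Lemma poly_eq0_deriv0 (p : {poly F}) :
  (forall k, (p^`(k)).[0] = 0) -> p = 0.
Proof.
move=> p0; apply/polyP => k; rewrite coef0; have := p0 k.
rewrite horner_coef0 coef_derivn addn0 ffactnn => /eqP.
rewrite -mulr_natr mulf_eq0 => /orP[/eqP//|].
by case: (k`!) (fact_gt0 k) => // d _; rewrite (negPf (char0 d)).
Qed.

Context {N : nat}.
Implicit Types (P Q : {mpoly F[N]}) (g : 'I_N -> {poly F}).

Definition subst_curve g P : {poly F} := mmap (@polyC F) g P.

HB.instance Definition _ g := GRing.RMorphism.copy (subst_curve g)
  (mmap (@polyC F) g).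

(** The differential of P at u in the direction w. *)
Definition dmp P (u w : 'I_N -> F) : F :=
  \sum_(j < N) (P^`M(j)).@[u] * w j.

Lemma horner_subst_curve g P c :
  (subst_curve g P).[c] = P.@[fun i => (g i).[c]].
Proof.
elim/mpolyind: P => [|a m P _ _ IH]; first by rewrite !raddf0 horner0.
rewrite !raddfD hornerD /= IH; congr (_ + _).
rewrite /subst_curve mmapZ mevalZ hornerM hornerC; congr (_ * _).
rewrite mmapX mevalX /mmap1 horner_prod; apply: eq_bigr => i _.
by rewrite horner_exp.
Qed.

(** The chain rule, by induction on the degree of a monomial, splitting off one variable at a
    time. *)
Lemma deriv_subst_curve g P :
  (subst_curve g P)^`() = \sum_(j < N) subst_curve g (P^`M(j)) * (g j)^`().
Proof.
elim/mpolyind: P => [|a m P _ _ IH].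
  by rewrite raddf0 linear0 big1// => j _; rewrite linear0 raddf0 mul0r.
rewrite raddfD linearD/= IH.
under [RHS]eq_bigr do rewrite linearD/= raddfD mulrDl.
rewrite big_split/=; congr (_ + _).
rewrite /subst_curve mmapZ derivM derivC mul0r add0r.
under [RHS]eq_bigr do rewrite linearZ/= mmapZ -mulrA.
rewrite -big_distrr/=; congr (_ * _).
move km: (mdeg m) => k.
elim: k m km => [|k IHk] m.
  move/eqP; rewrite mdeg_eq0 => /eqP ->; rewrite mpolyX0 -mpolyC1 mmapC/=.
  by rewrite derivC big1// => j _; rewrite mderivC mmap0 mul0r.
move=> km; have [i mi] : exists i, (m i != 0)%N.
  apply/existsP; rewrite -negb_forall; apply/negP => /forallP m0.
  suff m00 : m = 0%MM by rewrite m00 mdeg0 in km.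
  by apply/mnmP => i; rewrite mnm0E; apply/eqP.
have -> : m = ((m - U_(i)) + U_(i))%MM.
  by rewrite submK// lep1mP.
rewrite mpolyXD rmorphM/= derivM.
have km' : mdeg (m - U_(i))%MM = k.
  have : mdeg ((m - U_(i)) + U_(i))%MM = k.+1 by rewrite submK ?lep1mP.
  by rewrite mdegD mdeg1 addn1 => -[].
rewrite IHk// mmapX mmap1U.
under [RHS]eq_bigr do rewrite mderivM raddfD/= mulrDl !rmorphM/=.
rewrite big_split/=; congr (_ + _).
  rewrite mulr_suml; apply: eq_bigr => j _.
  by rewrite !mmapX mmap1U mulrAC.
rewrite (bigD1 i)//= big1 ?addr0.
  have e0 : (U_(i) - U_(i))%MM = 0%MM :> 'X_{1..N}.
    by apply/mnmP => l; rewrite mnmBE subnn mnm0E.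
  by rewrite mderivX mnm1E eqxx e0 mpolyX0 scale1r rmorph1 mulr1.
move=> j ji; rewrite mderivX mnm1E eq_sym (negPf ji) scale0r raddf0.
by rewrite mulr0 mul0r.
Qed.

Lemma coef01_subst_curve g P :
  ((subst_curve g P)`_0 = P.@[fun i => (g i)`_0]) *
  ((subst_curve g P)`_1 = dmp P (fun i => (g i)`_0) (fun i => (g i)`_1)).
Proof.
split; first by rewrite -horner_coef0 horner_subst_curve;
  apply: meval_eq => i; rewrite horner_coef0.
transitivity ((subst_curve g P)^`()`_0); first by rewrite coef_deriv.
rewrite deriv_subst_curve -horner_coef0 horner_sum; apply: eq_bigr => j _.
rewrite hornerM horner_subst_curve horner_coef0 coef_deriv mulr1n.
by congr (_ * _); apply: meval_eq => i; rewrite horner_coef0.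
Qed.

End Curves.

(** * Closed cones and one-parameter groups *)

Section NilpotentDim.
Context {F : fieldType} {M : vectType F}.

Lemma iter_linear (A : {linear M -> M}) k : linear (iter k A).
Proof.
by elim: k => [|k IHk] c u v //=; rewrite IHk linearP.
Qed.

(** The last d nonzero iterates of u are independent, since A^d kills them but not the iterate
    before them; so there are at most dim M of them. This makes the truncation in [nilp_exp]
    harmless. *)
Lemma nilpotent_iter_dim (A : {linear M -> M}) m u :
  iter m A u = 0 -> iter (\dim {:M}) A u = 0.
Proof.
move=> mu; have ex0 : exists k, iter k A u == 0 by exists m; apply/eqP.
case: (ex_minnP ex0) => {mu}m /eqP mu min_m.
have [le_m|lt_m] := leqP m (\dim {:M}).
  by rewrite -(subnK le_m) iterD mu; elim: (_ - _)%N => //= k ->; rewrite linear0.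
pose X d := [seq iter j A u | j <- iota (m - d) d].
suff Xfree d : (d <= m)%N -> free (X d).
  have := Xfree m (leqnn m); rewrite /free size_map size_iota => /eqP dimX.
  by have := dimvS (subvf <<X m>>%VS); rewrite dimX leqNgt lt_m.
elim: d => [|d IHd] ltdm; first by rewrite /X /= nil_free.
have -> : X d.+1 = iter (m - d.+1) A u :: X d.
  by rewrite /X /= subnSK.
rewrite free_cons IHd ?(ltnW ltdm)// andbT; apply/negP => inX.
pose B : {linear M -> M} := HB.pack (iter d A)
  (GRing.isLinear.Build F M M _ (iter d A) (iter_linear A d)).
have : (<<X d>> <= lker (linfun B))%VS.
  apply/span_subvP => y /mapP[j]; rewrite mem_iota => /andP[lej _] ->.
  have led : (m <= d + j)%N by lia.
  rewrite memv_ker lfunE /= -iterD -(subnK led) iterD mu.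
  by apply/eqP; elim: (_ - _)%N => //= k ->; rewrite linear0.
move/subvP => /(_ _ inX); rewrite memv_ker lfunE /= -iterD => /min_m.
by rewrite leqNgt; case/negP; lia.
Qed.

End NilpotentDim.

Section ClosedCones.
Context {F : fieldType} (char0 : forall k, (k.+1%:R : F) != 0).
Context {M : vectType F}.
Local Notation N := (\dim {:M}).
Local Notation coords := (@coords F M).
Implicit Types (P Q : {mpoly F[N]}) (u w : M).

Lemma coordsZ c u i : coords (c *: u) i = c * coords u i.
Proof. by rewrite /coords linearZ. Qed.

Lemma coords_sum (I : Type) (r : seq I) (p : pred I) (f : I -> M) i :
  coords (\sum_(k <- r | p k) f k) i = \sum_(k <- r | p k) coords (f k) i.
Proof. by rewrite /coords linear_sum. Qed.

Lemma coords0 i : coords 0 i = 0.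
Proof. by rewrite /coords linear0. Qed.

Lemma coordsE u : u = \sum_(i < N) coords u i *: (vbasis {:M})`_i.
Proof. exact: coord_vbasis (memvf u). Qed.

(** Along the curve P becomes a polynomial in c that vanishes at all nonzero c, hence identically;
    its two lowest coefficients are the two claims. Limits as t tends to 0 are taken in this way. *)
Lemma curve_tangent P (w : nat -> M) K : (1 < K)%N ->
  (forall c, c != 0 -> P.@[coords (\sum_(k < K) c ^+ k *: w k)] = 0) ->
  P.@[coords (w 0)] = 0 /\ dmp P (coords (w 0)) (coords (w 1)) = 0.
Proof.
move=> K1 P0; pose g i := \poly_(k < K) coords (w k) i.
have g0 : subst_curve g P = 0.
  apply: (poly_eq0_units char0) => c c0; rewrite horner_subst_curve -(P0 c c0).
  apply: meval_eq => i; rewrite horner_poly coords_sum; apply: eq_bigr => k _.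
  by rewrite coordsZ mulrC.
have := coef01_subst_curve g P; rewrite g0 !coef0 => -[e0 e1].
split.
  by rewrite [RHS]e0; apply: meval_eq => i; rewrite coef_poly (ltn_trans _ K1).
rewrite [RHS]e1; apply: eq_bigr => j _; rewrite !coef_poly K1; congr (_ * _).
by apply: meval_eq => i; rewrite coef_poly (ltn_trans _ K1).
Qed.

Definition linear_form (A : {linear M -> M}) j : {mpoly F[N]} :=
  \sum_(i < N) coords (A (vbasis {:M})`_i) j *: 'X_i.

(** The derivation of the coordinate ring along the linear vector field u -> A u. *)
Definition lie_deriv (A : {linear M -> M}) P : {mpoly F[N]} :=
  \sum_(j < N) P^`M(j) * linear_form A j.

Lemma meval_linear_form A j u : (linear_form A j).@[coords u] = coords (A u) j.
Proof.
have -> : A u = \sum_(i < N) coords u i *: A (vbasis {:M})`_i.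
  by rewrite {1}[u]coordsE linear_sum; apply: eq_bigr => i _; rewrite linearZ.
rewrite coords_sum raddf_sum /=.
by apply: eq_bigr => i _; rewrite mevalZ mevalXU coordsZ mulrC.
Qed.

Lemma meval_lie_deriv A P u :
  (lie_deriv A P).@[coords u] = dmp P (coords u) (coords (A u)).
Proof.
rewrite raddf_sum; apply: eq_bigr => j _.
by rewrite /= mevalM meval_linear_form.
Qed.

Definition vanishing_on (S : set M) : set {mpoly F[N]} :=
  [set P | forall u, S u -> P.@[coords u] = 0].

Definition closed_hull (S : set M) : set M :=
  [set w | forall P, vanishing_on S P -> P.@[coords w] = 0].

(** The k-th derivative of P(exp(t A) w) at t = 0 is the k-fold Lie derivative of P at w, which
    vanishes by stability of the ideal. By Taylor the polynomial in t is zero, and t = 1 gives the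
    claim. *)
Lemma closed_hull_nilp_exp (S : set M) (A : {linear M -> M}) :
    (forall u, exists m, iter m A u = 0) ->
    (forall P, vanishing_on S P -> vanishing_on S (lie_deriv A P)) ->
  forall w, closed_hull S w -> closed_hull S (nilp_exp A w).
Proof.
move=> nilA stA w Sw P SP.
pose cf k i := (k`!%:R)^-1 * coords (iter k A w) i.
pose g i := \poly_(k < N.+1) cf k i.
have w0 : iter N A w = 0.
  by have [m /nilpotent_iter_dim] := nilA w.
(* The curve solves g' = A g exactly, since the iterates of A on w vanish from N on. *)
have g' j : subst_curve g (linear_form A j) = (g j)^`().
  rewrite /linear_form raddf_sum /=; apply/polyP => k.
  rewrite coef_deriv coef_sum.
  transitivity (cf k.+1 j *+ k.+1).
    have -> : cf k.+1 j *+ k.+1 = (k`!%:R)^-1 * coords (A (iter k A w)) j.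
      rewrite /cf iterS -mulr_natr mulrAC; congr (_ * _).
      rewrite factS natrM invfM mulrAC mulVf ?mul1r//.
    rewrite -meval_linear_form /linear_form raddf_sum mulr_sumr /=.
    apply: eq_bigr => i _; rewrite mevalZ mevalXU.
    rewrite /subst_curve mmapZ mmapX mmap1U coefCM coef_poly mulrCA.
    case: ltnP => // leNk; congr (_ * _); rewrite -/(cf k i) /cf.
    rewrite -(subnK leNk) -addSnnS iterD w0.
    have -> : iter (k - N.+1).+1 A 0 = 0 :> M.
      by elim: (_.+1) => //= d ->; rewrite linear0.
    by rewrite coords0 mulr0.
  rewrite coef_poly; case: ltnP => // leNk; rewrite /cf.
  rewrite -(subnK (leNk : N <= k)%N) -addSn iterD w0.
  have -> : iter (k - N).+1 A 0 = 0 :> M.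
    by elim: (_.+1) => //= d ->; rewrite linear0.
  by rewrite coords0 mulr0 mul0rn.
have gD Q : (subst_curve g Q)^`() = subst_curve g (lie_deriv A Q).
  rewrite deriv_subst_curve [RHS]raddf_sum /=; apply: eq_bigr => j _.
  by rewrite rmorphM /= g'.
have gDn k : (subst_curve g P)^`(k) = subst_curve g (iter k (lie_deriv A) P).
  elim: k => [|k IHk]; first by rewrite derivn0.
  by rewrite derivnS IHk gD.
have gP0 : subst_curve g P = 0.
  apply: (poly_eq0_deriv0 char0) => k; rewrite gDn horner_subst_curve.
  have SQ : vanishing_on S (iter k (lie_deriv A) P).
    by elim: k => //= k IHk; exact: stA.
  apply: etrans (Sw _ SQ); apply: meval_eq => i.
  by rewrite horner_coef0 coef_poly /cf fact0 invr1 mul1r.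
have := horner_subst_curve g P 1; rewrite gP0 horner0 => /esym eP.
rewrite -[RHS]eP; apply: meval_eq => i; rewrite /nilp_exp coords_sum.
rewrite horner_poly; apply: eq_bigr => k _.
by rewrite expr1n mulr1 coordsZ.
Qed.

End ClosedCones.

(** * Dimension of projective varieties with a dense cell *)

Section ProjectiveSets.
Context {F : fieldType} {M : vectType F}.
Local Notation N := (\dim {:M}).
Local Notation coords := (@coords F M).
Local Notation projspace := (@projspace F M).
Implicit Types (P Q : {mpoly F[N]}) (u w : M) (L : projspace) (X Y Z : set projspace).

Lemma projspace_line L : exists2 u, u != 0 & sval L = <[u]>%VS.
Proof.
case: L => L /= /eqP dimL; exists (vpick L).
  by rewrite vpick0 -dimv_eq0 dimL.
apply/eqP; rewrite eq_sym eqEdim -memvE memv_pick dimL dim_vline.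
by rewrite vpick0 -dimv_eq0 dimL.
Qed.

Lemma meval_homogZ P d c u :
  P \is d.-homog -> P.@[coords (c *: u)] = c ^+ d * P.@[coords u].
Proof.
move=> /dhomogP homP; rewrite !mevalE mulr_sumr; apply: eq_big_seq => m mP.
rewrite mulrCA; congr (_ * _); rewrite -(homP _ mP).
under eq_bigr do rewrite coordsZ exprMn.
by rewrite big_split /= mdegE -prodrXr.
Qed.

Lemma homogeneous_meval0 P c u :
  homogeneous P -> P.@[coords u] = 0 -> P.@[coords (c *: u)] = 0.
Proof. by move=> [d homP] Pu; rewrite (meval_homogZ _ _ homP) Pu mulr0. Qed.

Lemma vanishes_line P L u : homogeneous P -> sval L = <[u]>%VS ->
  vanishes P L <-> P.@[coords u] = 0.
Proof.
move=> homP Lu; split=> [|Pu w]; first by apply; rewrite Lu memv_line.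
by rewrite Lu => /vlineP[c ->]; exact: homogeneous_meval0.
Qed.

Lemma homogeneousM P Q : homogeneous P -> homogeneous Q -> homogeneous (P * Q).
Proof. by move=> [d Pd] [e Qe]; exists (d + e)%N; exact: dhomogM. Qed.

Definition vanishes_on P X := forall L, X L -> vanishes P L.

Lemma zero_locus1 P L : zero_locus [set P] L <-> vanishes P L.
Proof. by split=> [|PL Q ->//]; apply. Qed.

Lemma zclosed_zero_locus1 P : homogeneous P -> zclosed (zero_locus [set P]).
Proof. by move=> homP; exists [set P]; split=> // Q ->. Qed.

Lemma irreducible_vanishesM Z P Q : irreducible_set Z ->
    homogeneous P -> homogeneous Q ->
  vanishes_on (P * Q) Z -> vanishes_on P Z \/ vanishes_on Q Z.
Proof.
move=> [_ irrZ] homP homQ PQZ.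
have [||L ZL|ZP|ZQ] := irrZ (zero_locus [set P]) (zero_locus [set Q]).
- exact: zclosed_zero_locus1.
- exact: zclosed_zero_locus1.
- have [u _ Lu] := projspace_line L.
  have /(vanishes_line (homogeneousM homP homQ) Lu) := PQZ _ ZL.
  rewrite mevalM => /eqP; rewrite mulf_eq0 => /orP[]/eqP e; [left|right].
    exact/zero_locus1/(vanishes_line homP Lu).
  exact/zero_locus1/(vanishes_line homQ Lu).
- by left=> L /ZP /zero_locus1.
- by right=> L /ZQ /zero_locus1.
Qed.

Lemma zclosed_separate Y Z : zclosed Y -> Y `<` Z ->
  exists P, [/\ homogeneous P, vanishes_on P Y & ~ vanishes_on P Z].
Proof.
move=> [S [homS ->]] [_ /existsNP[L /not_implyP[ZL /existsNP[P]]]].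
move=> /not_implyP[SP nPL]; exists P; split; first exact: homS.
  by move=> L' /(_ _ SP).
by move=> /(_ _ ZL).
Qed.

Lemma subset_zclosure X : X `<=` zclosure X.
Proof. by move=> L XL Z [_ /(_ _ XL)]. Qed.

Lemma zclosed_zclosure X : zclosed (zclosure X).
Proof.
exists [set P | homogeneous P /\ vanishes_on P X]; split; first by move=> P [].
apply/seteqP; split=> L XL.
  by move=> P [homP PX]; apply/zero_locus1; apply: XL; split;
    [exact: zclosed_zero_locus1|move=> L' /PX /zero_locus1].
move=> Z [[S [homS ->]] XZ] P SP; apply: XL; split; first exact: homS.
by move=> L' /XZ /(_ _ SP).
Qed.

Lemma zclosure_min X Z : zclosed Z -> X `<=` Z -> zclosure X `<=` Z.
Proof. by move=> clZ XZ L; apply. Qed.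

Lemma vanishes_on_zclosure P X : homogeneous P -> vanishes_on P X ->
  vanishes_on P (zclosure X).
Proof.
move=> homP PX L /(_ (zero_locus [set P])) XL; apply/zero_locus1; apply: XL.
by split; [exact: zclosed_zero_locus1|move=> L' /PX /zero_locus1].
Qed.

Lemma irreducible_zclosure1 L : irreducible_set (zclosure [set L]).
Proof.
split; first by exists L; exact: subset_zclosure.
move=> Y Z clY clZ YZ.
have [YL|ZL] : (Y `|` Z) L by apply: YZ; exact: subset_zclosure.
  by left; apply: zclosure_min => // L' ->.
by right; apply: zclosure_min => // L' ->.
Qed.

(** The closure of the point is a chain of length 0, so that the bounded set of lengths is not
    empty. *)
Lemma local_dim_exists X L n : zclosed X -> X L ->
    (forall d, chain_at X L d -> (d <= n)%N) ->
  exists2 d, local_dim X L d & (d <= n)%N.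
Proof.
move=> clX XL bound; have ch0 : chain_at X L 0.
  exists (fun=> zclosure [set L]); split=> // i _; split.
  - exact: zclosed_zclosure.
  - exact: irreducible_zclosure1.
  - by apply: zclosure_min => // L' ->.
  - exact: subset_zclosure.
have ex : exists d, `[< chain_at X L d >] by exists 0%N; apply/asboolP.
have bd d : `[< chain_at X L d >] -> (d <= n)%N by move/asboolP/bound.
case: (ex_maxnP ex bd) => d /asboolP chd maxd.
exists d; last exact: bound.
by split=> // d' /asboolP/maxd.
Qed.

End ProjectiveSets.

(** * Independence of monomials in functions that separate a chain *)

Section ChainMonomials.
Context {F : fieldType} {M : vectType F}.
Local Notation N := (\dim {:M}).
Local Notation coords := (@coords F M).
Local Notation projspace := (@projspace F M).
Context (Z : nat -> set projspace) (f : nat -> {mpoly F[N]}) (l : {mpoly F[N]}).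
Context (dg : nat -> nat) (K : nat).

(* \prod_i f_i^(k_i), k_i being the i-th entry of al from the right, padded by a
   power of the linear form l to degree T. *)
Fixpoint chain_mon (al : seq nat) (T : nat) : {mpoly F[N]} :=
  if al is k :: al' then
    f (size al') ^+ k * chain_mon al' (T - k * dg (size al'))
  else l ^+ T.

Fixpoint boxes (i : nat) : seq (seq nat) :=
  if i is i'.+1 then [seq k :: al | k <- iota 0 K, al <- boxes i'] else [:: [::]].

Lemma size_boxes i : size (boxes i) = (K ^ i)%N.
Proof. by elim: i => //= i IH; rewrite size_allpairs size_iota IH expnS. Qed.

Lemma uniq_boxes i : uniq (boxes i).
Proof.
elim: i => //= i IH; apply: allpairs_uniq => //; first exact: iota_uniq.
by move=> [k al] [k' al'] _ _ /= [-> ->].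
Qed.

Lemma boxesP i al : al \in boxes i -> size al = i.
Proof.
elim: i al => [|i IH] al /=; first by rewrite inE => /eqP ->.
by move=> /allpairsP[[k al'] /= [_ /IH <- ->]].
Qed.

(** From this degree T on, the truncated subtractions in [chain_mon] are exact for all exponents
    below K. *)
Definition box_degree i := (\sum_(j < i) K * dg j)%N.

Lemma box_degree_step i k T : (k < K)%N -> (box_degree i.+1 <= T)%N ->
  (k * dg i <= T)%N /\ (box_degree i <= T - k * dg i)%N.
Proof.
move=> ltk; have : (k * dg i <= K * dg i)%N by rewrite leq_mul2r ltnW ?orbT.
by rewrite /box_degree big_ord_recr /=; lia.
Qed.

Lemma chain_mon_homog al i T : (forall j, (j < i)%N -> f j \is (dg j).-homog) ->
    l \is 1.-homog -> al \in boxes i -> (box_degree i <= T)%N ->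
  chain_mon al T \is T.-homog.
Proof.
move=> homf homl; elim: i al T homf => [|i IH] al T homf /=.
  by rewrite inE => /eqP -> _ /=; rewrite -{2}[T]mul1n; exact: dhomogMn.
move=> /allpairsP[[k al'] /= [+ al'i ->]] /=; rewrite mem_iota add0n => /andP[_ ltk].
rewrite (boxesP al'i) => leT; have [leT1 leT2] := box_degree_step ltk leT.
have homf' j : (j < i)%N -> f j \is (dg j).-homog by move=> /ltnW; exact: homf.
have := dhomogM (dhomogMn k (homf i (leqnn _))) (IH _ _ homf' al'i leT2).
by rewrite (mulnC (dg i)) subnKC.
Qed.

(** Order a relation by powers of the last function, which vanishes on the last but one member of
    the chain. Restricted there, only the coefficient of the lowest power remains, and it is trivial
    by induction. The rest is divisible by that function, which can be cancelled because the last
    member is irreducible and the function does not vanish on it. *)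
Lemma chain_mon_indep d (cf : seq nat -> F) T :
    (forall i, (i <= d)%N -> irreducible_set (Z i)) ->
    (forall i, (i < d)%N -> Z i `<=` Z i.+1) ->
    (forall i, (i < d)%N -> f i \is (dg i).-homog) -> l \is 1.-homog ->
    (forall i, (i < d)%N -> vanishes_on (f i) (Z i)) ->
    (forall i, (i < d)%N -> ~ vanishes_on (f i) (Z i.+1)) ->
    ~ vanishes_on l (Z 0) -> (box_degree d <= T)%N ->
    vanishes_on (\sum_(al <- boxes d) cf al *: chain_mon al T) (Z d) ->
  forall al, al \in boxes d -> cf al = 0.
Proof.
elim: d cf T => [|d IH] cf T irrZ subZ homf homl vf nvf nvl leT /=.
  rewrite big_seq1 /= => van al; rewrite inE => /eqP ->.
  apply: contra_notP nvl => /eqP cf0 L ZL.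
  have [u _ Lu] := projspace_line L; have homl' : homogeneous l by exists 1%N.
  apply/(vanishes_line homl' Lu).
  have := van L ZL u; rewrite Lu memv_line mevalZ => /(_ isT)/eqP.
  by rewrite mulf_eq0 (negPf cf0) rmorphXn /= expf_eq0 => /andP[_ /eqP].
pose g k := \sum_(al <- boxes d) cf (k :: al) *: chain_mon al (T - k * dg d).
(* The part with exponents at least [k0], divided by [f d ^+ k0]. *)
pose h k0 := \sum_(k0 <= k < K) f d ^+ (k - k0) * g k.
have leTk k : (k < K)%N -> (box_degree d <= T - k * dg d)%N.
  by move=> ltk; have [] := box_degree_step ltk leT.
have leTk' k : (k < K)%N -> (k * dg d <= T)%N.
  by move=> ltk; have [] := box_degree_step ltk leT.
have homg k : (k < K)%N -> g k \is (T - k * dg d).-homog.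
  move=> ltk; rewrite /g big_seq; apply: rpred_sum => al ald; apply: rpredZ.
  apply: (chain_mon_homog (i := d)) => //; last exact: leTk.
  by move=> j jd; apply: homf; exact: ltnW.
have homh k0 : (k0 < K)%N -> h k0 \is (T - k0 * dg d).-homog.
  move=> ltk0; rewrite /h big_seq_cond; apply: rpred_sum => k.
  rewrite andbT mem_index_iota => /andP[lek0 ltk].
  have -> : (T - k0 * dg d = dg d * (k - k0) + (T - k * dg d))%N.
    by rewrite mulnBr mulnC; have := leTk' k ltk; nia.
  by apply: dhomogM; [exact/dhomogMn/homf|exact: homg].
have hS k0 : (k0 < K)%N -> h k0 = g k0 + f d * h k0.+1.
  move=> lt0; rewrite /h big_ltn// subnn expr0 mul1r mulr_sumr; congr (_ + _).
  apply: eq_big_nat => k /andP[ltk _]; rewrite mulrA -exprS; congr (_ ^+ _ * _).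
  by rewrite subnSK.
have key e k0 : (K <= k0 + e)%N -> vanishes_on (h k0) (Z d.+1) ->
    forall k, (k0 <= k < K)%N -> forall al, al \in boxes d -> cf (k :: al) = 0.
  elim: e k0 => [|e IHe] k0; first by rewrite addn0 => leK _ k; lia.
  move=> leK vh k /andP[le0 ltk]; have lt0 := leq_ltn_trans le0 ltk.
  have g0 al : al \in boxes d -> cf (k0 :: al) = 0.
    apply: (IH (fun al => cf (k0 :: al)) (T - k0 * dg d)%N) => //.
    - by move=> i id; apply: irrZ; exact: leqW.
    - by move=> i id; apply: subZ; exact: leqW.
    - by move=> i id; apply: homf; exact: leqW.
    - by move=> i id; apply: vf; exact: leqW.
    - by move=> i id; apply: nvf; exact: leqW.
    - exact: leTk.
    move=> L ZL u uL; have := vh L (subZ d (leqnn _) L ZL) u uL.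
    by rewrite hS// mevalD mevalM (vf d (leqnn _) L ZL u uL) mul0r addr0.
  have [-> //|ltk0] : k = k0 \/ (k0 < k)%N by lia.
  have gz : g k0 = 0.
    by rewrite /g big_seq big1// => al ald; rewrite g0// scale0r.
  rewrite hS// gz add0r in vh.
  apply: (IHe k0.+1); rewrite ?addSnnS ?ltk0//.
  have [|||//] := irreducible_vanishesM (irrZ _ (leqnn _)) _ _ vh.
  - by exists (dg d); exact: homf.
  - by exists (T - k0.+1 * dg d)%N; apply: homh; exact: leq_ltn_trans ltk.
  - by move=> /(nvf d (leqnn _)).
move=> van al /allpairsP[[k al'] /= [kK al'd ->]].
apply: (key K 0%N) => //; last by rewrite mem_iota in kK; lia.
move: van; rewrite big_allpairs_dep /h /= {1}/index_iota subn0.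
congr (vanishes_on _ _); apply: eq_bigr => k' _; rewrite subn0 mulr_sumr.
rewrite !big_seq; apply: eq_bigr => al'' al''d.
by rewrite /= (boxesP al''d) scalerAr.
Qed.

End ChainMonomials.

(** * Comparison of Hilbert functions *)

Section DimensionBound.
Context {F : fieldType} {M : vectType F}.
Local Notation N := (\dim {:M}).
Local Notation coords := (@coords F M).
Local Notation projspace := (@projspace F M).

Lemma linear_dependence (m k : nat) (A : 'M[F]_(m, k)) : (k < m)%N ->
  exists2 v : 'rV[F]_m, v != 0 & v *m A = 0.
Proof.
move=> ltkm; have : kermx A != 0.
  rewrite -mxrank_eq0 mxrank_ker subn_eq0 -ltnNge.
  exact: leq_ltn_trans (rank_leq_col A) ltkm.
move=> /rowV0Pn[v /sub_kermxP vA v0]; by exists v.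
Qed.

Lemma card_bmultinom n b : (#|{: 'X_{1..n < b}}| <= b ^ n)%N.
Proof.
have le_deg (m : 'X_{1..n < b}) i : (m i < b)%N.
  apply: leq_ltn_trans (bmdeg m); rewrite mdegE (bigD1 i)//=; exact: leq_addr.
pose h (m : 'X_{1..n < b}) : {ffun 'I_n -> 'I_b} :=
  [ffun i => Ordinal (le_deg m i)].
have h_inj : injective h.
  move=> m m' /ffunP mm'; apply/val_inj/mnmP => i.
  by have := mm' i; rewrite !ffunE => -[].
by have := leq_card h h_inj; rewrite card_ffun !card_ord.
Qed.

Lemma msize_comp_homog n (lq : N.-tuple {mpoly F[n]}) b (P : {mpoly F[N]}) d :
    (forall i, msize (tnth lq i) <= b.+1)%N -> P \is d.-homog ->
  (msize (P \mPo lq) <= (d * b).+1)%N.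
Proof.
move=> leb /dhomogP homP; have msM (p q : {mpoly F[n]}) k l :
    (msize p <= k.+1)%N -> (msize q <= l.+1)%N -> (msize (p * q) <= (k + l).+1)%N.
  move=> lep leq_; have [->|p0] := eqVneq p 0; first by rewrite mul0r msize0.
  have [->|q0] := eqVneq q 0; first by rewrite mulr0 msize0.
  have -> : msize (p * q) = (msize p + msize q).-1 := msizeM p0 q0.
  by lia.
rewrite comp_mpolyEX big_seq; elim/big_rec: _ => [|m p mP lep].
  by rewrite msize0.
apply: leq_trans (msizeD_le _ _) _; rewrite geq_max lep andbT.
apply: leq_trans (msizeZ_le _ _) _; rewrite -(homP _ mP) /= mdegE big_distrl /=.
rewrite comp_mpolyX; elim/big_rec2: _ => [|i k q _ leq]; first by rewrite msize1.
apply: (msM) leq; elim: (m i) => [|e IHe]; first by rewrite expr0 msize1.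
by rewrite exprS mulSn; exact: msM.
Qed.

(* For n + 1 strict inclusions, the K^(n+1) padded monomials in polynomials
   separating the members of the chain are linearly independent on X, while
   their pullbacks along lq lie in a space of dimension O(K^n). *)
Lemma chain_length_le n (lq : N.-tuple {mpoly F[n]}) (X : set projspace) L d :
    (forall P, homogeneous P -> P \mPo lq = 0 -> vanishes_on P X) ->
  chain_at X L d -> (d <= n)%N.
Proof.
move=> vX [Z [clZ ltZ]]; rewrite leqNgt; apply/negP => ltnd.
have /choice[fd fdP] : forall i, exists pe : {mpoly F[N]} * nat, (i < n.+1)%N ->
    [/\ pe.1 \is pe.2.-homog, vanishes_on pe.1 (Z i)
      & ~ vanishes_on pe.1 (Z i.+1)].
  move=> i; case: (ltnP i n.+1) => [lti|//]; last by exists (0, 0%N).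
  have ltid : (i < d)%N by exact: leq_trans ltnd.
  have [clZi _ _ _] := clZ i (ltnW ltid).
  have [P [[e homP] vP nvP]] := zclosed_separate clZi (ltZ i ltid).
  by exists (P, e).
pose f i := (fd i).1; pose dg i := (fd i).2.
(* The padding form must not vanish on the smallest member; some coordinate is nonzero at L. *)
have [j lj] : exists j : 'I_N, ~ vanishes_on 'X_j (Z 0).
  have [u u0 Lu] := projspace_line L.
  have [_ _ _ Z0L] := clZ 0%N (leq0n _).
  apply: contrapT => /forallNP noj; move/eqP: u0; apply.
  rewrite (coordsE u) big1// => j _; have /contrapT/(_ L Z0L u) := noj j.
  by rewrite Lu memv_line mevalXU => /(_ isT) ->; rewrite scale0r.
pose b := (\sum_(i < N) msize (tnth lq i))%N.
(* As T = K D, the pullbacks have degree at most T b < K W, hence at most (K W)^n coefficients; W^n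
   < K makes this smaller than the number K^(n+1) of monomials. *)
pose D := (\sum_(i < n.+1) dg i)%N; pose W := (D * b).+1; pose K := (W ^ n).+1.
pose T := box_degree dg K n.+1.
pose bs := boxes K n.+1; pose mon (a : nat) := chain_mon f 'X_j dg (nth [::] bs a) T.
have TE : T = (K * D)%N by rewrite /T /box_degree -big_distrr.
have homX : ('X_j : {mpoly F[N]}) \is 1.-homog by rewrite dhomogX /= mdeg1.
have homf i : (i < n.+1)%N -> f i \is (dg i).-homog by move=> /fdP[].
have monh a : (a < K ^ n.+1)%N -> mon a \is T.-homog.
  move=> lta; rewrite /mon; apply: (chain_mon_homog homf homX _ (leqnn T)).
  by apply: mem_nth; rewrite size_boxes.
have leb i : (msize (tnth lq i) <= b.+1)%N.
  by apply: leqW; rewrite /b (bigD1 i)//=; exact: leq_addr.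
pose B := (T * b).+1.
have ltB : (#|{: 'X_{1..n < B}}| < K ^ n.+1)%N.
  apply: leq_ltn_trans (card_bmultinom _ _) _.
  apply: (@leq_ltn_trans ((K * W) ^ n)).
    by case: (n) => // n'; rewrite leq_exp2r// /B /W TE; nia.
  by rewrite expnMn expnSr ltn_pmul2l ?expn_gt0// /K.
pose A := \matrix_(a < K ^ n.+1, m < #|{: 'X_{1..n < B}}|)
  (mon a \mPo lq)@_(enum_val m).
have [v v0 vA] := linear_dependence A ltB.
pose cf al := \sum_(a < K ^ n.+1) v 0 a *+ (nth [::] bs a == al).
have cfE (a : 'I_(K ^ n.+1)) : cf (nth [::] bs a) = v 0 a.
  rewrite /cf (bigD1 a)//= eqxx mulr1n big1 ?addr0// => a' a'a.
  by rewrite nth_uniq ?size_boxes ?uniq_boxes// val_eqE (negPf a'a).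
pose P := \sum_(al <- bs) cf al *: chain_mon f 'X_j dg al T.
have PE : P = \sum_(a < K ^ n.+1) v 0 a *: mon a.
  rewrite /P (big_nth [::]) big_mkord size_boxes.
  by apply: eq_bigr => a _; rewrite cfE.
have homP : homogeneous P.
  by exists T; rewrite PE; apply: rpred_sum => a _; apply: rpredZ; exact: monh.
have P0 : P \mPo lq = 0.
  rewrite PE raddf_sum /=; apply/mpolyP => m; rewrite mcoeff0 raddf_sum /=.
  have [ltm|lem] := ltnP (mdeg m) B.
    have /rowP/(_ (enum_rank (BMultinom ltm))) := vA.
    rewrite !mxE => e; rewrite -[RHS]e; apply: eq_bigr => a _.
    by rewrite !mxE enum_rankK comp_mpolyZ mcoeffZ.
  rewrite big1// => a _; rewrite comp_mpolyZ mcoeffZ memN_msupp_eq0 ?mulr0//.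
  apply: msize_mdeg_ge; apply: leq_trans lem.
  exact: msize_comp_homog leb (monh _ (ltn_ord a)).
have cf0 : forall al, al \in bs -> cf al = 0.
  apply: (chain_mon_indep (Z := Z)) homf homX _ _ lj (leqnn T) _.
  - by move=> i lei; have [] := clZ i (leq_trans lei ltnd).
  - by move=> i lti; have [] := ltZ i (leq_trans lti ltnd).
  - by move=> i /fdP[].
  - by move=> i /fdP[].
  - have [_ _ subX _] := clZ _ ltnd.
    by move=> L' /subX; exact: vX.
by case/eqP: v0; apply/rowP => a; rewrite mxE -cfE cf0// mem_nth// size_boxes.
Qed.

End DimensionBound.

(** * Evaluation modules and their fusion product *)

Section TensorCoefficients.
Context {F : fieldType} {n : nat} (a : 'I_n -> nat) (z : 'I_n -> F).
Local Notation V := (tensor (F := F) a).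
Local Notation index := {dffun forall i : 'I_n, 'I_(a i)}.
Implicit Types (u w : V) (b : 'X_{1..n}) (i j : 'I_n) (k : nat).

(* The coefficient of the basis vector with exponents b, with value 0 when b is
   out of bounds. *)
Definition tcoef u b : F :=
  \sum_(c : index | [forall i, c i == b i :> nat]) u c.

Lemma tcoef_val u b (c : index) : (forall i, c i = b i :> nat) -> tcoef u b = u c.
Proof.
move=> cb; rewrite /tcoef (big_pred1 c)// => c' /=.
apply/forallP/eqP => [c'b|-> i]; last by rewrite cb.
by apply/ffunP => i; apply/val_inj; rewrite /= cb; apply/eqP.
Qed.

Lemma tcoef_out u b i : (a i <= b i)%N -> tcoef u b = 0.
Proof.
move=> lei; rewrite /tcoef big1// => c /forallP/(_ i)/eqP ci.
by have := ltn_ord (c i); rewrite ci ltnNge lei.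
Qed.

Lemma tcoefP u w : (forall b, tcoef u b = tcoef w b) -> u = w.
Proof.
move=> e; apply/ffunP => c; have := e [multinom (c i : nat) | i < n].
by rewrite !(@tcoef_val _ _ c)// => i; rewrite mnmE.
Qed.

Lemma tcoefD u w b : tcoef (u + w) b = tcoef u b + tcoef w b.
Proof. by rewrite /tcoef -big_split; apply: eq_bigr => d _; rewrite !ffunE. Qed.

Lemma tcoefZ c u b : tcoef (c *: u) b = c * tcoef u b.
Proof. by rewrite /tcoef mulr_sumr; apply: eq_bigr => d _; rewrite !ffunE. Qed.

Lemma tcoef0 b : tcoef 0 b = 0.
Proof. by rewrite -(scale0r 0) tcoefZ mul0r. Qed.

Lemma tcoef_sum (I : Type) (r : seq I) (p : pred I) (f : I -> V) b :
  tcoef (\sum_(k <- r | p k) f k) b = \sum_(k <- r | p k) tcoef (f k) b.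
Proof.
by apply: (big_morph (tcoef^~ b)) => [u w|]; [exact: tcoefD|exact: tcoef0].
Qed.

Lemma tcoef_lowest b : (forall i, (0 < a i)%N) ->
  tcoef (lowest a) b = (b == 0%MM)%:R.
Proof.
move=> a_gt0; have [->|b0] := eqVneq b 0%MM.
  rewrite (@tcoef_val _ _ (finfun (fun i => Ordinal (a_gt0 i)))).
    by rewrite ffunE; case: forallP => // -[] i; rewrite ffunE.
  by move=> i; rewrite ffunE mnm0E.
rewrite /tcoef big1// => c /forallP cb; rewrite ffunE.
case: forallP => // c0; case/eqP: b0; apply/mnmP => i.
by rewrite mnm0E -(eqP (cb i)); apply/eqP.
Qed.

(** The factor [0 < b i] compensates the truncation of [b - U_(i)], which is b when b i = 0. At b i
    = a i the factor a i - b i vanishes, so the formula holds for exponents out of bounds too. *)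
Lemma tcoef_factor_op i (x : 'M[F]_2) u b :
  tcoef (factor_op i x u) b =
    x 0 1 * ((0 < b i)%N * (a i - b i))%:R * tcoef u (b - U_(i))%MM
  + x 1 0 * (b i).+1%:R * tcoef u (b + U_(i))%MM
  + x 0 0 * ((b i)%:R - ((a i).-1 - b i)%:R) * tcoef u b.
Proof.
have [/forallP valid|] := boolP [forall j, (b j < a j)%N]; last first.
  rewrite negb_forall => /existsP[j]; rewrite -leqNgt => lej.
  rewrite !(tcoef_out _ lej) (@tcoef_out u (b + U_(i))%MM j) ?mnmDE; last first.
    exact: leq_trans lej (leq_addr _ _).
  have [ji|ji] := eqVneq j i.
    by rewrite -ji (eqP lej) muln0 !mulr0 !mul0r !addr0.
  rewrite (@tcoef_out u (b - U_(i))%MM j) ?mulr0 ?addr0//.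
  by rewrite mnmBE mnm1E eq_sym (negPf ji) subn0.
pose c : index := finfun (fun j => Ordinal (valid j)).
have cE j : c j = b j :> nat by rewrite ffunE.
rewrite (tcoef_val _ cE) ffunE.
have withE j (d : 'I_(a i)) :
    ((finfun (dfwith c d) : index) j : nat) = if j == i then d : nat else b j.
  rewrite ffunE; case: eqVneq => [->|ji]; first by rewrite dfwith_in.
  by rewrite dfwith_out 1?eq_sym.
under eq_bigr do rewrite mxE mulrDl mulrDl !mulrnAl.
rewrite !big_split /=; congr (_ + _ + _).
- case bi: (b i) => [|m].
    by rewrite mul0n mulr0 mul0r big1// => d _; rewrite cE bi mulr0n.
  have ltm : (m < a i)%N by have := valid i; rewrite bi; exact: ltnW.
  rewrite (bigD1 (Ordinal ltm))//= big1 ?addr0 => [|d dm]; last first.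
    rewrite cE bi eqSS; case: eqP => [e|]; last by rewrite mulr0n.
    by case/eqP: dm; apply: val_inj.
  rewrite cE bi eqxx mulr1n /= mul1n.
  have -> : ((a i).-1 - m = a i - m.+1)%N by lia.
  rewrite (@tcoef_val u (b - U_(i))%MM (finfun (dfwith c (Ordinal ltm))))//.
  move=> j; rewrite withE mnmBE mnm1E eq_sym; case: eqVneq => [<-|_].
    by rewrite bi subn1.
  by rewrite subn0.
- have [lti|lei] := ltnP (b i).+1 (a i); last first.
    rewrite (@tcoef_out u _ i) ?mulr0; last by rewrite mnmDE mnm1E eqxx addn1.
    rewrite big1// => d _; rewrite cE; case: eqP => [e|]; last by rewrite mulr0n.
    by have := ltn_ord d; rewrite e ltnNge lei.
  rewrite (bigD1 (Ordinal lti))//= big1 ?addr0 => [|d dm]; last first.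
    rewrite cE; case: eqP => [e|]; last by rewrite mulr0n.
    by case/eqP: dm; apply: val_inj.
  rewrite cE eqxx mulr1n.
  rewrite (@tcoef_val u (b + U_(i))%MM (finfun (dfwith c (Ordinal lti))))//.
  move=> j; rewrite withE mnmDE mnm1E eq_sym; case: eqVneq => [<-|_].
    by rewrite addn1.
  by rewrite addn0.
- rewrite (bigD1 (c i))//= big1 ?addr0 => [|d dm]; last first.
    case: eqP => [e|]; last by rewrite mulr0n.
    by case/eqP: dm; rewrite e.
  rewrite eqxx mulr1n cE (@tcoef_val u b (finfun (dfwith c (c i))))//.
  by move=> j; rewrite withE; case: eqVneq => [->|].
Qed.

Definition tcoef_e i u b : F :=
  ((0 < b i)%N * (a i - b i))%:R * tcoef u (b - U_(i))%MM.
Definition tcoef_f i u b : F := (b i).+1%:R * tcoef u (b + U_(i))%MM.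
Definition tcoef_h i u b : F := ((b i)%:R - ((a i).-1 - b i)%:R) * tcoef u b.

Definition emx : 'M[F]_2 := delta_mx 0 1.
Definition fmx : 'M[F]_2 := delta_mx 1 0.
Definition hmx : 'M[F]_2 := delta_mx 0 0 - delta_mx 1 1.

Lemma tr_emx : \tr emx = 0.
Proof. by rewrite /mxtrace !big_ord_recl big_ord0 !mxE/= !addr0. Qed.

Lemma tr_fmx : \tr fmx = 0.
Proof. by rewrite /mxtrace !big_ord_recl big_ord0 !mxE/= !addr0. Qed.

Lemma tr_hmx : \tr hmx = 0.
Proof.
by rewrite /mxtrace !big_ord_recl big_ord0 !mxE/= !mulr0n mulr1n subr0 add0r addr0 subrr.
Qed.

Lemma tcoef_eval_op x k u b :
  tcoef (eval_op z x k u) b =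
    \sum_i z i ^+ k * (x 0 1 * tcoef_e i u b + x 1 0 * tcoef_f i u b
                       + x 0 0 * tcoef_h i u b).
Proof.
rewrite tcoef_sum; apply: eq_bigr => i _.
by rewrite tcoefZ tcoef_factor_op !mulrA.
Qed.

Lemma tcoef_eval_e k u b :
  tcoef (eval_op z emx k u) b = \sum_i z i ^+ k * tcoef_e i u b.
Proof.
rewrite tcoef_eval_op; apply: eq_bigr => i _.
by rewrite !mxE/= mul1r !mul0r !addr0.
Qed.

Lemma tcoef_eval_f k u b :
  tcoef (eval_op z fmx k u) b = \sum_i z i ^+ k * tcoef_f i u b.
Proof.
rewrite tcoef_eval_op; apply: eq_bigr => i _.
by rewrite !mxE/= mul1r !mul0r addr0 add0r.
Qed.

Lemma tcoef_eval_h k u b :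
  tcoef (eval_op z hmx k u) b = \sum_i z i ^+ k * tcoef_h i u b.
Proof.
rewrite tcoef_eval_op; apply: eq_bigr => i _.
by rewrite !mxE/= !subr0 mul1r !mul0r !add0r.
Qed.

Lemma eval_op_efh x k u : eval_op z x k u =
  x 0 1 *: eval_op z emx k u + x 1 0 *: eval_op z fmx k u
  + x 0 0 *: eval_op z hmx k u.
Proof.
apply: tcoefP => b; rewrite !tcoefD !tcoefZ tcoef_eval_op.
rewrite tcoef_eval_e tcoef_eval_f tcoef_eval_h !mulr_sumr -!big_split /=.
by apply: eq_bigr => i _; ring.
Qed.

Lemma eval_ee k l u :
  eval_op z emx k (eval_op z emx l u) = eval_op z emx l (eval_op z emx k u).
Proof.
apply: tcoefP => b; rewrite !tcoef_eval_e /tcoef_e.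
under eq_bigr do rewrite tcoef_eval_e mulrA mulr_sumr.
under [RHS]eq_bigr do rewrite tcoef_eval_e mulrA mulr_sumr.
rewrite [RHS]exchange_big /=; apply: eq_bigr => i _; apply: eq_bigr => j _.
rewrite /tcoef_e; have [->|ij] := eqVneq i j; first by ring.
rewrite !mnmBE !mnm1E (negPf ij) eq_sym (negPf ij) !subn0.
rewrite (_ : (b - U_(i) - U_(j))%MM = (b - U_(j) - U_(i))%MM); last first.
  by rewrite !submDA addmC.
by ring.
Qed.

(** Operators on different tensor factors commute, so only the diagonal terms survive; there it is
    the relation in sl2. *)
Lemma eval_ef k l u :
  eval_op z emx k (eval_op z fmx l u) - eval_op z fmx l (eval_op z emx k u)
    = eval_op z hmx (k + l) u.
Proof.
apply: tcoefP => b; rewrite tcoefD -scaleN1r tcoefZ mulN1r.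
rewrite tcoef_eval_e tcoef_eval_f tcoef_eval_h /tcoef_e /tcoef_f /tcoef_h.
under eq_bigr do rewrite tcoef_eval_f mulrA mulr_sumr.
under [X in _ - X = _]eq_bigr do rewrite tcoef_eval_e mulrA mulr_sumr.
rewrite [X in _ - X = _]exchange_big /= -sumrB; apply: eq_bigr => i _.
rewrite -sumrB (bigD1 i)//= big1 ?addr0 => [|j ji].
  rewrite /tcoef_e /tcoef_f !mnmDE !mnmBE mnm1E eqxx addn1 addmK exprD.
  have [lei|lti] := leqP (a i) (b i).
    rewrite (tcoef_out _ lei) (@tcoef_out u (b - U_(i) + U_(i))%MM i).
      by rewrite !mulr0 subrr.
    by rewrite mnmDE mnmBE mnm1E eqxx; lia.
  case bi: (b i) => [|m].
    by rewrite /= !mul0n mul1n subn0 !subn1; ring.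
  rewrite /= !mul1n.
  rewrite submK ?lep1mP ?bi// subn1 /=.
  rewrite bi in lti; have -> : ((a i).-1 - m.+1 = a i - m.+2)%N by lia.
  have -> : (a i - m.+1 = (a i - m.+2).+1)%N by lia.
  by ring.
rewrite /tcoef_e /tcoef_f !mnmDE !mnmBE !mnm1E (negPf ji) eq_sym (negPf ji).
rewrite subn0 addn0; case bi: (b i) => [|m].
  by rewrite !mul0n !mulr0 !mul0r !mulr0 subrr.
rewrite (_ : (b - U_(i) + U_(j))%MM = (b + U_(j) - U_(i))%MM).
  by ring.
apply/mnmP => j'; rewrite !(mnmDE, mnmBE) !mnm1E.
by have [<-|] := eqVneq i j'; rewrite ?bi; lia.
Qed.

Lemma eval_he k l u :
  eval_op z hmx k (eval_op z emx l u) - eval_op z emx l (eval_op z hmx k u)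
    = 2%:R *: eval_op z emx (k + l) u.
Proof.
apply: tcoefP => b; rewrite tcoefD -scaleN1r !tcoefZ mulN1r.
rewrite !tcoef_eval_e tcoef_eval_h /tcoef_e /tcoef_h.
under eq_bigr do rewrite tcoef_eval_e mulrA mulr_sumr.
under [X in _ - X = _]eq_bigr do rewrite tcoef_eval_h mulrA mulr_sumr.
rewrite exchange_big /= -sumrB mulr_sumr; apply: eq_bigr => i _.
rewrite -sumrB (bigD1 i)//= big1 ?addr0 => [|j ji].
  rewrite /tcoef_e /tcoef_h !mnmBE mnm1E eqxx subn1 exprD.
  case bi: (b i) => [|m]; first by rewrite mul0n; ring.
  have [lei|lti] := leqP (a i) m.+1.
    by rewrite (eqP lei) muln0; ring.
  rewrite mul1n /=; have -> : ((a i).-1 - m.+1 = a i - m.+2)%N by lia.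
  have -> : ((a i).-1 - m = (a i - m.+2).+1)%N by lia.
  have -> : (a i - m.+1 = (a i - m.+2).+1)%N by lia.
  by ring.
rewrite /tcoef_e /tcoef_h !mnmBE !mnm1E eq_sym (negPf ji) subn0.
by ring.
Qed.

End TensorCoefficients.

(** * Words in the raising operators and the graded module *)

Section CyclicModule.
Context {F : fieldType} {n : nat} (a : 'I_n -> nat) (z : 'I_n -> F).
Context (a_gt0 : forall i, (0 < a i)%N).
Local Notation V := (tensor (F := F) a).
Local Notation E := (eval_op (a := a) z (emx (F := F))).
Local Notation Fo := (eval_op (a := a) z (fmx (F := F))).
Local Notation H := (eval_op (a := a) z (hmx (F := F))).
Local Notation fil := (fil a z).
Local Notation fil_pred := (fil_pred a z).
Local Notation top := (top_degree a z).
Local Notation M := (fusion a z).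
Implicit Types (u w : V) (k l m : nat) (ks : seq nat).

Lemma fil_le m1 m2 u : (m1 <= m2)%N -> u \in fil m1 -> u \in fil m2.
Proof.
move=> le12; apply: subvP; apply: (vspanP _).2 => w [x [trx lex ->]].
by apply: (vspanP _).1; exists x; split => //; exact: leq_trans lex le12.
Qed.

Lemma fil_predW m u : u \in fil_pred m -> u \in fil m.
Proof.
by case: m => [|m] /=; [rewrite memv0 => /eqP ->; exact: rpred0|exact: fil_le].
Qed.

Lemma fil_pred_lt m1 m2 u : (m1 < m2)%N -> u \in fil m1 -> u \in fil_pred m2.
Proof. by case: m2 => //= m2; rewrite ltnS; exact: fil_le. Qed.

Lemma lowest_fil0 : lowest a \in fil 0.
Proof. by apply: (vspanP _).1; exists [::]; split=> //; rewrite big_nil. Qed.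

Definition eword ks : V := foldr E (lowest a) ks.

Lemma eword_fil ks : eword ks \in fil (sumn ks).
Proof.
elim: ks => [|k ks IH] /=; first exact: lowest_fil0.
by rewrite addnC; apply: eval_op_fil IH; exact: tr_emx.
Qed.

Definition weight0 k : F := - \sum_i z i ^+ k * (a i).-1%:R.

Lemma eval_h_lowest k : H k (lowest a) = weight0 k *: lowest a.
Proof.
apply: tcoefP => b; rewrite tcoef_eval_h tcoefZ /tcoef_h !tcoef_lowest//.
have [->|b0] := eqVneq b 0%MM; last by rewrite mulr0 big1// => i _; rewrite !mulr0.
rewrite mulr1 /weight0 -sumrN; apply: eq_bigr => i _.
by rewrite mnm0E subn0 mulr1 sub0r mulrN.
Qed.

Lemma eval_f_lowest k : Fo k (lowest a) = 0.
Proof.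
apply: tcoefP => b; rewrite tcoef_eval_f tcoef0 /tcoef_f big1// => i _.
rewrite tcoef_lowest// (_ : (_ == _) = false) ?mulr0 ?mulr0//.
by apply/negbTE; rewrite mnmD_eq0 mnm1_eq0 andbF.
Qed.

Definition efil m : {vspace V} :=
  vspan [set u : V | exists ks, (sumn ks <= m)%N /\ u = eword ks].

Lemma eword_efil ks m : (sumn ks <= m)%N -> eword ks \in efil m.
Proof. by move=> lem; apply: (vspanP _).1; exists ks. Qed.

Lemma efil_ind (W : {vspace V}) (f : {linear V -> V}) m :
    (forall ks, (sumn ks <= m)%N -> f (eword ks) \in W) ->
  forall u, u \in efil m -> f u \in W.
Proof. by move=> fW; apply: vspan_lin => u [ks [lem ->]]; exact: fW. Qed.

Lemma eval_e_efil k m u : u \in efil m -> E k u \in efil (m + k).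
Proof.
apply: efil_ind => ks lem; apply: (eword_efil (ks := k :: ks)).
by rewrite /= addnC leq_add2r.
Qed.

Lemma eval_h_eword k ks : H k (eword ks) \in efil (sumn ks + k).
Proof.
elim: ks k => [|l ks IH] k /=.
  by rewrite eval_h_lowest rpredZ// (eword_efil (ks := [::])).
rewrite -[H k _](subrK (E l (H k (eword ks)))) eval_he rpredD//.
  rewrite rpredZ//; apply: (eword_efil (ks := (k + l)%N :: ks)) => /=.
  by lia.
by have := eval_e_efil l (IH k); congr (_ \in efil _); lia.
Qed.

(** Move f to the right until it kills the lowest vector; each commutator is some h of the same
    total degree. *)
Lemma eval_f_eword k ks : Fo k (eword ks) \in efil (sumn ks + k).
Proof.
elim: ks k => [|l ks IH] k /=; first by rewrite eval_f_lowest rpred0.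
rewrite -[Fo k _](subKr (E l (Fo k (eword ks)))) eval_ef rpredB//.
  by have := eval_e_efil l (IH k); congr (_ \in efil _); lia.
by have := eval_h_eword (l + k) ks; congr (_ \in efil _); lia.
Qed.

Lemma eval_op_efil (x : 'M[F]_2) k m u :
  u \in efil m -> eval_op z x k u \in efil (m + k).
Proof.
move=> um; rewrite eval_op_efh.
have le ks : (sumn ks <= m)%N -> (efil (sumn ks + k) <= efil (m + k))%VS.
  move=> lem; apply: (vspanP _).2 => w [ls [lel ->]].
  by apply: eword_efil; apply: leq_trans lel _; rewrite leq_add2r.
rewrite !rpredD// rpredZ//; move: u um; apply: efil_ind => ks lem.
- by apply: eval_e_efil; exact: eword_efil.
- exact: (subvP (le _ lem)) (eval_f_eword k ks).
- exact: (subvP (le _ lem)) (eval_h_eword k ks).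
Qed.

(** Words in the e_k alone span the filtration, so that linear conditions on [fil] need only be
    tested on them. *)
Lemma fil_efil m u : u \in fil m -> u \in efil m.
Proof.
move=> um; apply: (vspan_lin (f := idfun)) um => {}u [w [_ + ->]].
elim: w m => [|[x k] w IH] m /=; first by move=> _; apply: (eword_efil (ks := [::])).
rewrite big_cons /= => lem; have -> : m = (m - k + k)%N by lia.
by apply: eval_op_efil; apply: IH; lia.
Qed.

Lemma fil_lin0 (f : {linear V -> F^o}) m :
    (forall ks, (sumn ks <= m)%N -> f (eword ks) = 0) ->
  forall u, u \in fil m -> f u = 0.
Proof.
move=> f0 u /fil_efil um; apply/eqP; rewrite -memv0.
by apply: vspan_lin um => w [ks [lem ->]]; rewrite f0// rpred0.
Qed.

(** For m above [top] this is 0, in agreement with the vanishing of the graded pieces there. *)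
Definition at_degree m u : Defs.family a z :=
  [ffun m' : 'I_top.+1 => if m' == m :> nat then u else 0].

Definition gr m u : M := cls (rees a z) (rees_pred a z) (at_degree m u).

Lemma at_degree_linear m : linear (at_degree m).
Proof.
by move=> c u w; apply/ffunP => l; rewrite !ffunE; case: eqP => //;
  rewrite scaler0 addr0.
Qed.

Lemma gr_linear m : linear (gr m).
Proof. by move=> c u w; rewrite /gr at_degree_linear linearP. Qed.

HB.instance Definition _ m := GRing.isLinear.Build F V M _ (gr m) (gr_linear m).

Lemma at_degree_rees m u : u \in fil m -> at_degree m u \in rees a z.
Proof.
move=> um; apply/mem_familyP => l; rewrite ffunE; case: eqP => [->//|_].
exact: rpred0.
Qed.

Lemma gr_eq0 m u : u \in fil_pred m -> gr m u = 0.
Proof.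
move=> um; apply/eqP; rewrite cls_eq0; last exact/at_degree_rees/fil_predW.
apply/mem_familyP => l; rewrite ffunE; case: eqP => [->//|_]; exact: rpred0.
Qed.

Lemma gr_eq0_lt m m' u : (m' < m)%N -> u \in fil m' -> gr m u = 0.
Proof. by move=> ltm um; apply: gr_eq0; exact: fil_pred_lt um. Qed.

Lemma cls_gr (U : Defs.family a z) :
  cls (rees a z) (rees_pred a z) U = \sum_(m < top.+1) gr m (U m).
Proof.
rewrite /gr -linear_sum; congr cls; apply/ffunP => l.
rewrite sum_ffunE (bigD1 l)//= ffunE eqxx big1 ?addr0// => m ml.
by rewrite ffunE; case: eqP => // /val_inj e; rewrite e eqxx in ml.
Qed.

Lemma fusion_ind (P : M -> Prop) : P 0 -> (forall x y : M, P x -> P y -> P (x + y)) ->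
  (forall m (u : V), u \in fil m -> P (gr m u)) -> forall w : M, P w.
Proof.
move=> P0 PD Pgr w; have [wR <-] := cls_vsval w; rewrite cls_gr.
elim/big_ind: _ => // m _; apply: Pgr.
by move/mem_familyP: wR; exact.
Qed.

Lemma fusion_op_gr x k m u : \tr x = 0 -> u \in fil m ->
  fusion_op x k (gr m u) = gr (m + k) (eval_op z x k u).
Proof.
move=> trx um; rewrite /gr fusion_opE//; last exact: at_degree_rees.
congr cls; apply/ffunP => l; rewrite !ffunE.
have [e|ne] := eqVneq (nat_of_ord l) (m + k)%N.
  have ltm : (m < top.+1)%N by have := ltn_ord l; lia.
  rewrite (bigD1 (Ordinal ltm)) ?e ?eqxx//= ffunE eqxx big1 ?addr0//.
  move=> j /andP[_ jm]; rewrite ffunE; case: eqP => [e'|_]; last by rewrite linear0.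
  by case/eqP: jm; apply: val_inj.
rewrite big1// => j /eqP ej; rewrite ffunE; case: eqP => [e'|_]; last by rewrite linear0.
by rewrite -ej e' eqxx in ne.
Qed.

Lemma fusion_op_is_linear x k : linear (@fusion_op F n a z x k).
Proof. by move=> c u w; rewrite /fusion_op !linearP. Qed.

HB.instance Definition _ x k :=
  GRing.isLinear.Build F M M _ (@fusion_op F n a z x k) (fusion_op_is_linear x k).

Local Notation e_ := (@fusion_op F n a z (emx (F := F))).
Local Notation f_ := (@fusion_op F n a z (fmx (F := F))).
Local Notation h_ := (@fusion_op F n a z (hmx (F := F))).
Local Notation vA := (fusion_vec a z).

Lemma fusion_vecE : vA = gr 0 (lowest a).
Proof. by congr cls; apply/ffunP => l; rewrite !ffunE. Qed.

Lemma fusion_e_gr k m u : u \in fil m -> e_ k (gr m u) = gr (m + k) (E k u).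
Proof. by move=> um; rewrite (fusion_op_gr k tr_emx um). Qed.

Lemma fusion_f_gr k m u : u \in fil m -> f_ k (gr m u) = gr (m + k) (Fo k u).
Proof. by move=> um; rewrite (fusion_op_gr k tr_fmx um). Qed.

Lemma fusion_h_gr k m u : u \in fil m -> h_ k (gr m u) = gr (m + k) (H k u).
Proof. by move=> um; rewrite (fusion_op_gr k tr_hmx um). Qed.

Let e_fil k m u : u \in fil m -> E k u \in fil (m + k).
Proof. exact: eval_op_fil tr_emx. Qed.

Let f_fil k m u : u \in fil m -> Fo k u \in fil (m + k).
Proof. exact: eval_op_fil tr_fmx. Qed.

Let h_fil k m u : u \in fil m -> H k u \in fil (m + k).
Proof. exact: eval_op_fil tr_hmx. Qed.

Lemma fusion_ee k l (w : M) : e_ k (e_ l w) = e_ l (e_ k w).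
Proof.
elim/fusion_ind: w => [|x y ex ey|m u um]; first by rewrite !linear0.
  by rewrite !linearD /= ex ey.
rewrite (fusion_e_gr l um) (fusion_e_gr k um).
rewrite (fusion_e_gr k (e_fil l um)) (fusion_e_gr l (e_fil k um)).
by rewrite eval_ee addnAC.
Qed.

Lemma fusion_ef k l (w : M) : f_ l (e_ k w) = e_ k (f_ l w) - h_ (k + l) w.
Proof.
elim/fusion_ind: w => [|x y ex ey|m u um]; first by rewrite !linear0 ?oppr0 ?addr0.
  by rewrite !linearD /= ex ey addrACA.
rewrite (fusion_e_gr k um) (fusion_f_gr l um) (fusion_h_gr (k + l) um).
rewrite (fusion_f_gr l (e_fil k um)) (fusion_e_gr k (f_fil l um)).
rewrite -eval_ef linearB /= addnA [(m + l + k)%N]addnAC.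
by rewrite opprB addrC subrK.
Qed.

Lemma fusion_he k l (w : M) : h_ k (e_ l w) = e_ l (h_ k w) + 2%:R *: e_ (k + l) w.
Proof.
elim/fusion_ind: w => [|x y ex ey|m u um]; first by rewrite !linear0 ?scaler0 ?addr0.
  by rewrite !linearD /= ex ey addrACA.
rewrite (fusion_h_gr k um) (fusion_e_gr l um) (fusion_e_gr (k + l) um).
rewrite (fusion_h_gr k (e_fil l um)) (fusion_e_gr l (h_fil k um)).
rewrite -linearZ /= -eval_he linearB /= addnA [(m + l + k)%N]addnAC.
by rewrite addrC subrK.
Qed.

Lemma fusion_f_vec k : f_ k vA = 0.
Proof.
by rewrite fusion_vecE (fusion_f_gr k lowest_fil0) eval_f_lowest linear0.
Qed.

(** For k > 0 the operator maps the lowest vector to a multiple of itself, which has filtration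
    degree 0 and thus class 0 in degree k. *)
Lemma fusion_h_vec k : h_ k vA = (if k == 0%N then weight0 0 else 0) *: vA.
Proof.
rewrite fusion_vecE (fusion_h_gr k lowest_fil0) eval_h_lowest linearZ /= add0n.
case: k => [//|k]; rewrite (gr_eq0_lt _ lowest_fil0)// scaler0.
by rewrite scale0r.
Qed.

(** The monic polynomial t^(k-n) \prod_i (t - z_i) vanishes at every evaluation point, so [E k] is a
    combination of [E l] with l < k, and these drop in degree. *)
Lemma fusion_e_big k (w : M) : (n <= k)%N -> e_ k w = 0.
Proof.
move=> lek; elim/fusion_ind: w => [|x y ex ey|m u um]; first by rewrite linear0.
  by rewrite linearD /= ex ey addr0.
rewrite (fusion_e_gr k um).
pose p : {poly F} := 'X^(k - n) * \prod_(i < n) ('X - (z i)%:P).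
have sp : size p = k.+1.
  rewrite size_monicM ?monicXn//; last first.
    by rewrite monic_neq0// monic_prod_XsubC.
  by rewrite size_polyXn size_prod_XsubC [index_enum _]unlock -enumT size_enum_ord; lia.
have lp : p`_k = 1.
  have : p \is monic by rewrite monicMl ?monicXn// monic_prod_XsubC.
  by move/monicP; rewrite lead_coefE sp.
have eu : \sum_(l < k.+1) p`_l *: E l u = 0.
  apply: tcoefP => b; rewrite tcoef_sum tcoef0.
  under eq_bigr do rewrite tcoefZ tcoef_eval_e mulr_sumr.
  rewrite exchange_big big1// => i _ /=.
  under eq_bigr do rewrite mulrA.
  rewrite -mulr_suml -sp -horner_coef /p hornerM horner_prod (bigD1 i)//=.
  by rewrite hornerXsubC subrr mul0r mulr0 mul0r.
move: eu; rewrite big_ord_recr /= lp scale1r => /eqP.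
rewrite addr_eq0 => /eqP eu; rewrite -[E k u]opprK -eu linearN linear_sum /=.
rewrite big1 ?oppr0// => l _; rewrite linearZ /=.
by rewrite (gr_eq0_lt _ (e_fil l um)) ?scaler0// ltn_add2l.
Qed.

End CyclicModule.

(** * The open cell *)

Section Cell.
Context {F : fieldType} (char0 : forall k, (k.+1%:R : F) != 0).
Context {n : nat} (a : 'I_n -> nat) (z : 'I_n -> F).
Context (a_gt0 : forall i, (0 < a i)%N).
Local Notation V := (tensor (F := F) a).
Local Notation M := (fusion a z).
Local Notation N := (\dim {:M}).
Local Notation coords := (@coords F M).
Local Notation e_ := (@fusion_op F n a z (emx (F := F))).
Local Notation f_ := (@fusion_op F n a z (fmx (F := F))).
Local Notation h_ := (@fusion_op F n a z (hmx (F := F))).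
Local Notation vA := (fusion_vec a z).
Implicit Types (p q : 'I_n -> F) (w : M).

Lemma invfact_S r : (r.+1`!%:R : F)^-1 * r.+1%:R = (r`!%:R)^-1.
Proof. by rewrite factS natrM invfM mulrAC mulVf ?mul1r. Qed.

Definition comb_op (x : 'M[F]_2) p w : M :=
  \sum_(k < n) p k *: fusion_op x k w.

Lemma comb_op_is_linear x p : linear (comb_op x p).
Proof.
move=> c u w; rewrite /comb_op scaler_sumr -big_split; apply: eq_bigr => k _.
by rewrite linearP scalerDr !scalerA mulrC.
Qed.

HB.instance Definition _ x p :=
  GRing.isLinear.Build F M M _ (comb_op x p) (comb_op_is_linear x p).

(** [S r] holds exponents at which representatives vanish after r applications; each application
    enlarges this set until it contains every exponent. *)
Lemma comb_op_nilpotent x (S : nat -> pred 'X_{1..n}) B p : \tr x = 0 ->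
    (forall k r u, (forall b, S r b -> tcoef u b = 0) ->
       forall b, S r.+1 b -> tcoef (eval_op (a := a) z x k u) b = 0) ->
    (forall (u : V) b, S 0%N b -> tcoef u b = 0) -> (forall b, S B b) ->
  forall w, iter B (comb_op x p) w = 0.
Proof.
move=> trx Sx S0 SB w.
pose W r : {vspace M} := vspan [set y | exists m (u : V), [/\ u \in fil a z m,
  (forall b, S r b -> tcoef u b = 0) & y = gr z m u]].
have Wgr r m u : u \in fil a z m -> (forall b, S r b -> tcoef u b = 0) ->
    gr z m u \in W r.
  by move=> um Su; apply: (vspanP _).1; exists m, u.
have WS r y : y \in W r -> comb_op x p y \in W r.+1.
  apply: vspan_lin => _ [m [u [um Su ->]]]; apply: rpred_sum => k _.
  rewrite rpredZ// (fusion_op_gr k trx um); apply: Wgr.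
    exact: eval_op_fil.
  exact: Sx.
have : iter B (comb_op x p) w \in W B.
  elim: B {SB} => [|r IH]; last exact: WS.
  elim/(@fusion_ind F n a z): w => [|y y' Wy Wy'|m u um]; [exact: rpred0|exact: rpredD|].
  by apply: Wgr => // b; exact: S0.
move=> wB; apply/eqP; rewrite -memv0; move: wB.
apply: (vspan_lin (f := idfun)) => _ [m [u [_ Su ->]]] /=.
suff -> : u = 0 by rewrite linear0 rpred0.
by apply: tcoefP => b; rewrite Su ?tcoef0.
Qed.

Lemma comb_e_nilpotent p : exists B, forall w, iter B (comb_op (emx (F := F)) p) w = 0.
Proof.
pose S r (b : 'X_{1..n}) := (mdeg b < r)%N || ~~ [forall i, (b i < a i)%N].
exists (\sum_(i < n) a i).+1.
apply: (comb_op_nilpotent (S := S)); first exact: tr_emx.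
- move=> k r u Su b Sb; rewrite tcoef_eval_e big1// => i _; rewrite /tcoef_e.
  move: Sb; rewrite /S => /orP[ltr|]; last first.
    rewrite negb_forall => /existsP[j]; rewrite -leqNgt => lej.
    have := tcoef_out (eval_op z emx k u) lej.
    have [ji|ji] := eqVneq j i.
      by rewrite -ji (eqP lej) muln0 mul0r mulr0.
    move=> _; rewrite (@tcoef_out _ _ _ u _ j) ?mulr0//.
    by rewrite mnmBE mnm1E eq_sym (negPf ji) subn0.
  case bi: (b i) => [|m]; first by rewrite mul0n mul0r mulr0.
  rewrite Su ?mulr0//; apply/orP; left.
  have : mdeg (b - U_(i) + U_(i))%MM = mdeg b by rewrite submK// lep1mP bi.
  by rewrite mdegD mdeg1; move: ltr; rewrite ltnS; lia.
- move=> u b; rewrite /S /= negb_forall => /existsP[j]; rewrite -leqNgt.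
  exact: tcoef_out.
- move=> b; rewrite /S; case: forallP => [lt|]; last by rewrite orbT.
  by rewrite orbF ltnS mdegE; apply: leq_sum => i _; exact: ltnW.
Qed.

Lemma comb_f_nilpotent p : exists B, forall w, iter B (comb_op (fmx (F := F)) p) w = 0.
Proof.
pose A := (\sum_(i < n) a i)%N.
pose S r (b : 'X_{1..n}) := (A < mdeg b + r)%N.
exists A.+1.
apply: (comb_op_nilpotent (S := S)); first exact: tr_fmx.
- move=> k r u Su b Sb; rewrite tcoef_eval_f big1// => i _; rewrite /tcoef_f.
  by rewrite Su ?mulr0//; move: Sb; rewrite /S mdegD mdeg1; lia.
- move=> u b; rewrite /S addn0 => ltA.
  have /existsP[j] : [exists j, (a j <= b j)%N].
    apply: contraTT ltA => /existsPn le; rewrite -leqNgt mdegE.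
    by apply: leq_sum => i _; have := le i; rewrite -ltnNge; exact: ltnW.
  exact: tcoef_out.
- by move=> b; rewrite /S; lia.
Qed.

Local Notation comb_e := (comb_op (emx (F := F))).

Definition cexp p : M := nilp_exp (comb_e p) vA.

Lemma comb_e_dim p r w : (N <= r)%N -> iter r (comb_e p) w = 0.
Proof.
move=> le; have [B /(_ w)/nilpotent_iter_dim e0] := comb_e_nilpotent p.
by rewrite -(subnK le) iterD e0; elim: (r - N)%N => //= k ->; rewrite linear0.
Qed.

Lemma cexpE p R : (N <= R)%N ->
  cexp p = \sum_(r < R) (r`!%:R)^-1 *: iter r (comb_e p) vA.
Proof.
move=> le; have aux R' : (N <= R')%N ->
    \sum_(r < R') (r`!%:R)^-1 *: iter r (comb_e p) vA =
    \sum_(r < N) (r`!%:R)^-1 *: iter r (comb_e p) vA :> M.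
  move=> le'; rewrite -!(big_mkord xpredT (fun r => (r`!%:R)^-1 *: iter r (comb_e p) vA)).
  rewrite (big_cat_nat (leq0n N) le')//= [X in _ + X = _]big1_seq ?addr0// => r /andP[_].
  by rewrite mem_index_iota => /andP[ler _]; rewrite comb_e_dim ?scaler0.
by rewrite aux// -(aux N.+1).
Qed.

Lemma comb_e_comm p k w : e_ k (comb_e p w) = comb_e p (e_ k w).
Proof.
rewrite linear_sum; apply: eq_bigr => l _.
by rewrite linearZ /= fusion_ee.
Qed.

Section Direction.
Context (p : 'I_n -> F) (m : 'I_n).

(* The coefficient of t^k in (comb_e p + t e_m)^r vA. *)
Fixpoint dir_coef r k : M :=
  if r is r'.+1 then
    comb_e p (dir_coef r' k) + (if k is k'.+1 then e_ m (dir_coef r' k') else 0)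
  else if k is 0%N then vA else 0.

Lemma dir_coef0 r : dir_coef r 0 = iter r (comb_e p) vA.
Proof. by elim: r => //= r ->; rewrite addr0. Qed.

Lemma dir_coef1 r : dir_coef r 1 = r%:R *: e_ m (iter r.-1 (comb_e p) vA).
Proof.
elim: r => [|r IH] /=; first by rewrite scale0r.
rewrite dir_coef0 IH linearZ /= -comb_e_comm.
case: r {IH} => [|r] /=; first by rewrite scale0r add0r scale1r.
by rewrite -{2}[e_ m _]scale1r -scalerDl natr1.
Qed.

Lemma dir_coefE (c : F) r K : (r < K)%N ->
  iter r (comb_e (fun k => p k + c * (k == m)%:R)) vA =
  \sum_(k < K) c ^+ k *: dir_coef r k.
Proof.
have comb_dir w : comb_e (fun k => p k + c * (k == m)%:R) w =
    comb_e p w + c *: e_ m w.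
  rewrite /comb_op; under eq_bigr do rewrite scalerDl.
  rewrite big_split /=; congr (_ + _).
  rewrite (bigD1 m)//= eqxx mulr1 big1 ?addr0//.
  by move=> k /negPf ->; rewrite mulr0 scale0r.
elim: r K => [|r IH] [|K] //= lt.
  by rewrite big_ord_recl /= expr0 scale1r big1 ?addr0// => k _; rewrite scaler0.
rewrite (IH K.+1 (ltnW lt)) comb_dir.
under [RHS]eq_bigr do rewrite scalerDr.
rewrite big_split /=; congr (_ + _).
  by rewrite linear_sum; apply: eq_bigr => k _; rewrite linearZ.
rewrite -(IH K.+1 (ltnW lt)) (IH K lt) linear_sum scaler_sumr big_ord_recl scaler0 add0r.
by apply: eq_bigr => k _; rewrite linearZ scalerA -exprS.
Qed.

End Direction.

Definition cell : set M := [set w | exists c p, w = c *: cexp p].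

Lemma dmpD P (u w w' : M) :
  dmp P (coords u) (coords (w + w')) =
  dmp P (coords u) (coords w) + dmp P (coords u) (coords w').
Proof.
rewrite /dmp -big_split; apply: eq_bigr => j _.
have -> : coords (w + w') j = coords w j + coords w' j by rewrite /coords linearD.
by rewrite mulrDr.
Qed.

Lemma dmpZ P (u w : M) c :
  dmp P (coords u) (coords (c *: w)) = c * dmp P (coords u) (coords w).
Proof.
by rewrite /dmp mulr_sumr; apply: eq_bigr => j _; rewrite coordsZ mulrCA.
Qed.

Lemma dmp0 P (u : M) : dmp P (coords u) (coords 0) = 0.
Proof. by rewrite -(scale0r (0 : M)) dmpZ mul0r. Qed.

Lemma dmp_sum (I : Type) (r : seq I) P (u : M) (f : I -> M) :
  dmp P (coords u) (coords (\sum_(k <- r) f k)) =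
  \sum_(k <- r) dmp P (coords u) (coords (f k)).
Proof.
by elim/big_rec2: _ => [|k y w _ <-]; [exact: dmp0|exact: dmpD].
Qed.

(** The cell is a cone: differentiate along (1 + t) u. *)
Lemma cell_tangent_self P u : vanishing_on cell P -> cell u ->
  dmp P (coords u) (coords u) = 0.
Proof.
move=> IP [c [p ->]].
have [||] := curve_tangent char0 (P := P) (w := fun=> c *: cexp p) (K := 2) => // t _.
apply: IP; exists ((1 + t) * c), p.
by rewrite !big_ord_recl big_ord0 expr0 expr1 scale1r addr0 -scalerA scalerDl scale1r.
Qed.

(** As the e_k commute, the curve c exp(\sum_k p_k e_k + t e_m) v in the cell has velocity e_m u at
    t = 0. *)
Lemma cell_tangent_e P u m : vanishing_on cell P -> cell u ->
  dmp P (coords u) (coords (e_ m u)) = 0.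
Proof.
move=> IP [c [p ->]]; have [lem|ltm] := leqP n m.
  by rewrite fusion_e_big// dmp0.
pose mo := Ordinal ltm; rewrite linearZ dmpZ.
pose w k : M := c *: \sum_(r < N.+2) (r`!%:R)^-1 *: dir_coef p mo r k.
have w0 : w 0%N = c *: cexp p.
  rewrite /w (@cexpE p N.+2); last by lia.
  by congr (_ *: _); apply: eq_bigr => r _; rewrite dir_coef0.
have w1 : w 1%N = c *: e_ m (cexp p).
  rewrite /w; congr (_ *: _); rewrite big_ord_recl dir_coef1 !scale0r scaler0 add0r.
  rewrite (@cexpE p N.+1); last by lia.
  rewrite linear_sum; apply: eq_bigr => r _.
  by rewrite lift0 dir_coef1 [RHS]linearZ /= scalerA invfact_S.
have Pt t : t != 0 -> P.@[coords (\sum_(k < N.+2) t ^+ k *: w k)] = 0.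
  move=> _; apply: IP; exists c, (fun k => p k + t * (k == mo)%:R).
  rewrite (@cexpE _ N.+2); last by lia.
  rewrite /w; under eq_bigr do rewrite scalerA mulrC -scalerA.
  rewrite -scaler_sumr; congr (_ *: _).
  under eq_bigr do rewrite scaler_sumr.
  rewrite exchange_big; apply: eq_bigr => r _ /=.
  rewrite (dir_coefE _ _ _ (ltn_ord r)) scaler_sumr; apply: eq_bigr => k _.
  by rewrite !scalerA mulrC.
by have [_] := curve_tangent char0 (isT : (1 < N.+2)%N) Pt; rewrite w0 w1 dmpZ.
Qed.

(** With E = \sum_k p_k e_k, [comb_h p l] is [E, f_l], twice [comb_ee p l] is [[comb_h p l], E], and
    [comb_weight p l] is the eigenvalue of [comb_h p l] on v. *)
Definition comb_h p l w : M := \sum_(k < n) p k *: h_ (k + l) w.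
Definition comb_ee p l w : M :=
  \sum_(k < n) \sum_(k' < n) (p k * p k') *: e_ (k + l + k') w.
Definition comb_weight p l : F :=
  \sum_(k < n) p k * (if (k + l)%N == 0%N then weight0 a z 0 else 0).

Lemma h_comb_e p j w : h_ j (comb_e p w) =
  comb_e p (h_ j w) + 2%:R *: \sum_(k < n) p k *: e_ (j + k) w.
Proof.
rewrite /comb_op linear_sum scaler_sumr -big_split; apply: eq_bigr => k _ /=.
by rewrite linearZ /= fusion_he scalerDr !scalerA mulrC.
Qed.

Lemma comb_ee_comm p q l w : comb_ee p l (comb_e q w) = comb_e q (comb_ee p l w).
Proof.
rewrite /comb_ee linear_sum; apply: eq_bigr => k _.
by rewrite linear_sum; apply: eq_bigr => k' _; rewrite linearZ /= comb_e_comm.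
Qed.

Lemma comb_h_iter p l r : comb_h p l (iter r (comb_e p) vA) =
  comb_weight p l *: iter r (comb_e p) vA
  + (2%:R * r%:R) *: comb_ee p l (iter r.-1 (comb_e p) vA).
Proof.
elim: r => [|r IH] /=.
  rewrite mulr0 scale0r addr0 /comb_h /comb_weight scaler_suml.
  by apply: eq_bigr => k _; rewrite fusion_h_vec// scalerA.
have -> : comb_h p l (comb_e p (iter r (comb_e p) vA)) =
    comb_e p (comb_h p l (iter r (comb_e p) vA))
    + 2%:R *: comb_ee p l (iter r (comb_e p) vA).
  rewrite /comb_h /comb_ee linear_sum scaler_sumr -big_split; apply: eq_bigr => k _.
  rewrite h_comb_e scalerDr; congr (_ + _); first by rewrite [RHS]linearZ.
  rewrite !scaler_sumr; apply: eq_bigr => k' _; rewrite !scalerA.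
  by congr (_ *: _); rewrite mulrCA mulrA.
rewrite IH [comb_e p (_ + _)]linearD /= ![comb_e p (_ *: _)]linearZ /= -comb_ee_comm.
rewrite -addrA; congr (_ + _).
case: r {IH} => [|r] /=; first by rewrite mulr0 scale0r add0r mulr1.
rewrite -scalerDl; congr (_ *: _); ring.
Qed.

Lemma f_iter p l r : f_ l (iter r (comb_e p) vA) =
  - (r%:R * comb_weight p l) *: iter r.-1 (comb_e p) vA
  - (r%:R * r.-1%:R) *: comb_ee p l (iter r.-2 (comb_e p) vA).
Proof.
elim: r => [|r IH] /=.
  by rewrite fusion_f_vec// !mul0r oppr0 !scale0r subr0.
have -> : f_ l (comb_e p (iter r (comb_e p) vA)) =
    comb_e p (f_ l (iter r (comb_e p) vA)) - comb_h p l (iter r (comb_e p) vA).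
  rewrite /comb_op /comb_h linear_sum -sumrB; apply: eq_bigr => k _.
  by rewrite linearZ /= fusion_ef scalerBr.
rewrite IH comb_h_iter [comb_e p (_ - _)]linearB /= ![comb_e p (_ *: _)]linearZ /= -comb_ee_comm.
case: r {IH} => [|[|r]] /=.
- rewrite !mul0r !scale0r !mulr0 !scale0r; rewrite !mul1r oppr0.
  by rewrite !scale0r !subr0 add0r scaleNr addr0.
- rewrite !mulr0 !scale0r !subr0 opprD addrA -scalerBl.
  have e : - (1 * comb_weight p l) - comb_weight p l = - (2%:R * comb_weight p l).
    by move: (comb_weight p l) => cw; ring.
  by rewrite e.
have lc (A B : M) c1 c2 c3 c4 : c1 *: A - c2 *: B - (c3 *: A + c4 *: B) =
    (c1 - c3) *: A - (c2 + c4) *: B.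
  by rewrite scalerBl scalerDl !opprD addrACA.
rewrite lc; move: (comb_weight p l) => cw.
have -> : - (r.+2%:R * cw) - cw = - (r.+3%:R * cw) by ring.
by have -> : r.+2%:R * r.+1%:R + 2%:R * r.+2%:R = r.+3%:R * r.+2%:R :> F by ring.
Qed.

(** In the exponential series the terms in E^(r-1) and E^(r-2) from [f_iter] resum to exponentials.
    So f_l maps a point u of the cell into the span of u and the e_k u, and its vector field is
    tangent to the cell. *)
Lemma f_cexp p l : f_ l (cexp p) = - comb_weight p l *: cexp p - comb_ee p l (cexp p).
Proof.
rewrite [in LHS](@cexpE p N.+2); last by lia.
rewrite [X in _ *: X](@cexpE p N.+1); last by lia.
rewrite [X in _ - comb_ee _ _ X](@cexpE p N)//.
rewrite linear_sum; under eq_bigr do rewrite linearZ /= f_iter scalerBr.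
rewrite sumrB; congr (_ - _).
  rewrite big_ord_recl mul0r oppr0 scale0r scaler0 add0r scaler_sumr.
  apply: eq_bigr => r _; rewrite lift0 /= !scalerA.
  by rewrite mulrN mulrA invfact_S mulNr (mulrC (comb_weight p l)).
rewrite big_ord_recl big_ord_recl /= mul0r mulr0 !scale0r !scaler0 !add0r.
have -> : comb_ee p l (\sum_(r < N) (r`!%:R)^-1 *: iter r (comb_e p) vA) =
    \sum_(r < N) (r`!%:R)^-1 *: comb_ee p l (iter r (comb_e p) vA).
  rewrite /comb_ee; under [RHS]eq_bigr do rewrite scaler_sumr.
  rewrite [RHS]exchange_big; apply: eq_bigr => k _ /=.
  under [RHS]eq_bigr do rewrite scaler_sumr.
  rewrite [RHS]exchange_big; apply: eq_bigr => k' _ /=.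
  rewrite linear_sum scaler_sumr; apply: eq_bigr => r _.
  by rewrite linearZ !scalerA mulrC.
apply: eq_bigr => r _; rewrite /bump !leq0n !add1n /= scalerA mulrA invfact_S.
by rewrite invfact_S.
Qed.

Lemma cell_tangent_f P u l : vanishing_on cell P -> cell u ->
  dmp P (coords u) (coords (f_ l u)) = 0.
Proof.
move=> IP Su; have [c [p eu]] := Su.
have -> : f_ l u = - comb_weight p l *: u +
    \sum_(k < n) \sum_(k' < n) - (p k * p k') *: e_ (k + l + k') u.
  rewrite eu linearZ /= f_cexp scalerBr !scalerA mulrC; congr (_ + _).
  rewrite /comb_ee -scalerN -sumrN scaler_sumr; apply: eq_bigr => k _.
  rewrite -sumrN scaler_sumr; apply: eq_bigr => k' _.
  by rewrite [fusion_op _ _ (_ *: _)]linearZ /= -scaleNr !scalerA mulrC.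
rewrite dmpD dmpZ (cell_tangent_self IP Su) mulr0 add0r dmp_sum big1// => k _.
by rewrite dmp_sum big1// => k' _; rewrite dmpZ (cell_tangent_e _ IP Su) mulr0.
Qed.

Lemma cell_lie_stable (x : 'M[F]_2) q P : x = emx (F := F) \/ x = fmx (F := F) ->
  vanishing_on cell P -> vanishing_on cell (lie_deriv (comb_op x q) P).
Proof.
move=> xE IP u Su; rewrite meval_lie_deriv dmp_sum big1// => k _; rewrite dmpZ.
by case: xE => ->; rewrite (cell_tangent_e, cell_tangent_f) ?mulr0.
Qed.

Lemma cell_lie_e m P :
  vanishing_on cell P -> vanishing_on cell (lie_deriv (e_ m) P).
Proof. by move=> IP u Su; rewrite meval_lie_deriv cell_tangent_e. Qed.

Lemma cell_lie_self P :
  vanishing_on cell P -> vanishing_on cell (lie_deriv (idfun : {linear M -> M}) P).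
Proof. by move=> IP u Su; rewrite meval_lie_deriv cell_tangent_self. Qed.

Lemma cexp0 : cexp (fun=> 0) = vA.
Proof.
rewrite /cexp /nilp_exp big_ord_recl /= invr1 scale1r big1 ?addr0// => k _.
rewrite /= /comb_op big1 ?scaler0// => l _; exact: scale0r.
Qed.

(** Every generator acts as the exponential of a nilpotent operator whose derivation preserves the
    ideal of the cell; hence the orbit stays in the closure of the cell. *)
Lemma integrates_closed_hull g T :
  integrates (n := n) (@fusion_op F n a z) g T -> closed_hull cell (T vA).
Proof.
elim=> [|p {}g {}T _ IH|p {}g {}T _ IH].
- by move=> P; apply; exists 1, (fun=> 0); rewrite cexp0 scale1r.
- apply: (closed_hull_nilp_exp char0 (A := comb_op emx (fun k => (val p)`_k))) IH.
    by move=> u; have [B] := comb_e_nilpotent (fun k => (val p)`_k); exists B.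
  by move=> P; apply: cell_lie_stable; left.
- apply: (closed_hull_nilp_exp char0 (A := comb_op fmx (fun k => (val p)`_k))) IH.
    by move=> u; have [B] := comb_f_nilpotent (fun k => (val p)`_k); exists B.
  by move=> P; apply: cell_lie_stable; right.
Qed.

End Cell.

(** * The cell inside [sh], and a criterion for singularity *)

Section FusionVariety.
Context {F : fieldType} (char0 : forall k, (k.+1%:R : F) != 0).
Context {n : nat} (n_gt0 : (0 < n)%N) (a : 'I_n -> nat) (z : 'I_n -> F).
Context (a_gt0 : forall i, (0 < a i)%N).
Local Notation V := (tensor (F := F) a).
Local Notation M := (fusion a z).
Local Notation N := (\dim {:M}).
Local Notation coords := (@coords F M).
Local Notation e_ := (@fusion_op F n a z (emx (F := F))).
Local Notation vA := (fusion_vec a z).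
Local Notation comb_e := (@comb_op F n a z (emx (F := F))).
Local Notation cexp := (@cexp F n a z).
Local Notation cell := (@cell F n a z).

Lemma gr_inj0 m (u : V) : u \in fil a z m -> (m <= top_degree a z)%N ->
  gr z m u = 0 -> u \in fil_pred a z m.
Proof.
move=> um lem /eqP; rewrite cls_eq0; last exact: at_degree_rees.
have ltm : (m < (top_degree a z).+1)%N by [].
by move/mem_familyP => /(_ (Ordinal ltm)); rewrite ffunE /= eqxx.
Qed.

Lemma fusion_vec_neq0 : vA != 0.
Proof.
apply/eqP; rewrite fusion_vecE => /(gr_inj0 (lowest_fil0 a z) (leq0n _)).
rewrite /= memv0 => /eqP e.
have := tcoef_lowest (F := F) 0%MM a_gt0; rewrite e tcoef0 eqxx => /eqP.
by rewrite eq_sym oner_eq0.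
Qed.

(** Apply E^r, with r maximal such that E^r v != 0: only the constant term of the exponential
    survives. *)
Lemma cexp_neq0 p : cexp p != 0.
Proof.
apply/eqP => e0; have ex0 : exists r, iter r (comb_e p) vA == 0.
  by exists N; rewrite comb_e_dim.
case: (ex_minnP ex0) => [[|r]] /eqP r0 min_r.
  by have := fusion_vec_neq0; rewrite -[vA]/(iter 0 (comb_e p) vA) r0 eqxx.
suff : iter r (comb_e p) vA == 0 by move/min_r; rewrite ltnn.
apply/eqP; transitivity (iter r (comb_e p) (cexp p)); last first.
  by rewrite e0; elim: (r) => //= k ->; rewrite linear0.
rewrite (@cexpE F n a z p N.+1)//.
pose B : {linear M -> M} := HB.pack (iter r (comb_e p))
  (GRing.isLinear.Build F M M _ (iter r (comb_e p)) (iter_linear (comb_e p) r)).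
rewrite -[iter r _ (\sum_(_ < _) _)]/(B _) linear_sum big_ord_recl /= invr1 scale1r.
rewrite big1 ?addr0// => k _; rewrite -[iter r _ _]/(B _) linearZ /=.
rewrite /bump leq0n add1n /= -iterSr -iterD addnC iterD r0.
by rewrite (_ : iter k _ 0 = 0) ?scaler0//; elim: (val k) => //= l ->; rewrite linear0.
Qed.

Lemma line_projspace (u : M) : u != 0 ->
  exists L : projspace (M := M), sval L = <[u]>%VS.
Proof.
move=> u0; have dimu : \dim <[u]> == 1%N by rewrite dim_vline u0.
by exists (exist (fun L : {vspace M} => \dim L == 1%N) <[u]>%VS dimu).
Qed.

Lemma det_elementary_e (B : comNzRingType) (p : B) :
  \det ((1%:M + p *: delta_mx 0 1) *m 1%:M : 'M[B]_2) = 1.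
Proof.
rewrite mulmx1 (expand_det_row _ 0) !big_ord_recl big_ord0 addr0 /cofactor.
rewrite !det_mx11 !mxE /= !mulr0n !mulr1n !mulr0 !addr0 expr0 !mul1r add0r.
by rewrite !mulr0 addr0.
Qed.

(** The group element is the upper unipotent matrix with entry \sum_k p_k t^k. *)
Lemma cexp_orbit p : exists2 L, fusion_orbit a z L & sval L = <[cexp p]>%VS.
Proof.
have [L LE] := line_projspace (cexp_neq0 p); exists L => //.
pose P : {poly F} := \poly_(k < n) (oapp p 0 (insub k)).
pose q : {poly %/ 'X^n : {poly F}} := in_qpoly 'X^n P.
have hE : mk_monic ('X^n : {poly F}) = 'X^n.
  by rewrite /mk_monic monicXn size_polyXn ltnS n_gt0.
have qE (k : 'I_n) : (val q)`_k = p k.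
  rewrite /= hE Pdiv.CommonRing.rmodp_small; last first.
    by rewrite size_polyXn ltnS size_poly.
  by rewrite coef_poly ltn_ord valK.
exists ((1%:M + q *: delta_mx 0 1) *m 1%:M).
eexists; split; [exact: det_elementary_e|exact/integrates_e/integrates_id|].
rewrite LE; congr (<[ _ ]>%VS); rewrite /cexp /nilp_exp; apply: eq_bigr => k _.
congr (_ *: _); apply: eq_iter => w; apply: eq_bigr => l _.
by rewrite qE.
Qed.

Lemma hideal_cell P : hideal (sh a z) P -> vanishing_on cell P.
Proof.
move=> [homP PX] _ [c [p ->]]; apply: homogeneous_meval0 => //.
have [L orbL LE] := cexp_orbit p.
apply/(vanishes_line homP LE)/PX.
exact: (subset_zclosure (X := fusion_orbit a z)) orbL.
Qed.

(** With [hideal_cell], the homogeneous polynomials vanishing on [sh] are exactly those vanishing on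
    the cell. *)
Lemma cell_vanishes_sh P : homogeneous P -> vanishing_on cell P ->
  vanishes_on P (sh a z).
Proof.
move=> homP IP; apply: vanishes_on_zclosure => // L [g [T [_ gT LE]]].
apply/(vanishes_line homP LE).
exact: (integrates_closed_hull char0 a_gt0 gT).
Qed.

Fixpoint iter_mpoly r (j : 'I_N) : {mpoly F[n]} :=
  if r is r'.+1 then
    \sum_(k < n) 'X_k * \sum_(i < N) coords (e_ k (vbasis {:M})`_i) j *: iter_mpoly r' i
  else (coords vA j)%:MP.

Lemma meval_iter_mpoly r j p :
  (iter_mpoly r j).@[p] = coords (iter r (comb_e p) vA) j.
Proof.
elim: r j => [|r IH] j /=; first by rewrite mevalC.
rewrite raddf_sum /= coords_sum; apply: eq_bigr => k _.
rewrite mevalM mevalXU coordsZ raddf_sum /=; congr (_ * _).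
rewrite -(meval_linear_form (fusion_op (emx (F := F)) k)) raddf_sum /=.
by apply: eq_bigr => i _; rewrite !mevalZ mevalXU IH.
Qed.

Lemma sh_chain_le L d : chain_at (sh a z) L d -> (d <= n)%N.
Proof.
pose lq : N.-tuple {mpoly F[n]} :=
  [tuple \sum_(r < N.+1) (r`!%:R)^-1 *: iter_mpoly r j | j < N].
apply: (chain_length_le (lq := lq)) => P homP P0; apply: cell_vanishes_sh => //.
move=> _ [c [p ->]]; apply: homogeneous_meval0 => //.
transitivity (P \mPo lq).@[p]; last by rewrite P0 raddf0.
rewrite comp_mpoly_meval; apply: meval_eq => j; rewrite tnth_mktuple raddf_sum /=.
rewrite (@cexpE F n a z p N.+1)// coords_sum; apply: eq_bigr => r _.
by rewrite coordsZ mevalZ meval_iter_mpoly.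
Qed.

Lemma mderiv_homog (P : {mpoly F[N]}) d j : P \is d.-homog -> P^`M(j) \is d.-1.-homog.
Proof.
move=> /dhomogP homP; apply/dhomogP => m; rewrite mcoeff_msupp mcoeff_mderiv => mP.
have /homP /= : (m + U_(j))%MM \in msupp P.
  by rewrite mcoeff_msupp; apply: contraNneq mP => ->; rewrite mul0rn.
by rewrite mdegD mdeg1 addn1 => <-.
Qed.

(** Passing from the cone to projective space costs one dimension, so n + 2 independent vectors give
    tangent dimension at least n + 1, against chains of length at most n. Homogeneity of the partial
    derivatives carries the condition from u to its whole line. *)
Lemma sh_singular (u : M) (W : seq M) : closed_hull cell u -> u != 0 ->
    free W -> size W = n.+2 ->
    (forall w P, w \in W -> vanishing_on cell P -> dmp P (coords u) (coords w) = 0) ->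
  singular (sh a z).
Proof.
move=> Cu u0 freeW sizeW tanW; have [L LE] := line_projspace u0.
have XL : sh a z L.
  move=> Z [[S [homS ->]] orbS] P SP; have homP := homS _ SP.
  apply/(vanishes_line homP LE); apply: Cu; apply: hideal_cell; split=> //.
  by apply: vanishes_on_zclosure => // L' /orbS /(_ _ SP).
exists L; split=> //.
have [d dimd led] := local_dim_exists (zclosed_zclosure _) XL (@sh_chain_le L).
exists d; split=> //; apply: leq_ltn_trans led _; rewrite /tangent_dim.
suff : (n.+2 <= \dim (cone_tangent (sh a z) L))%N by lia.
rewrite -sizeW -(eqP freeW); apply: dimvS; apply/span_subvP => w wW.
apply: (vspanP _).1 => P hP u'; rewrite LE => /vlineP[c ->].
have [[e homP] _] := hP.
have := tanW w P wW (hideal_cell hP); rewrite /dmp => e0.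
under eq_bigr do rewrite (meval_homogZ _ _ (mderiv_homog _ homP)) -mulrA.
by rewrite -mulr_sumr e0 mulr0.
Qed.

End FusionVariety.

(** * Powers of a truncated current *)

Section CurrentPowers.
Context {F : fieldType} {n : nat} (a : 'I_n -> nat) (z : 'I_n -> F).
Context (a_gt0 : forall i, (0 < a i)%N).
Context (nt : nat) (le_nt : (nt <= n)%N).
Local Notation off := (n - nt)%N.
Local Notation V := (tensor (F := F) a).
Local Notation E := (eval_op (a := a) z (emx (F := F))).
Local Notation M := (fusion a z).
Local Notation e_ := (@fusion_op F n a z (emx (F := F))).
Local Notation eword := (@eword F n a z).
Implicit Types (u w : V) (b : 'X_{1..n}) (s D q : nat) (i : 'I_n).

(** The words with s letters off + q_i, where q_i < nt and the q_i add up to D, each listed once. *)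
Fixpoint power_words s D : seq (seq nat) :=
  if s is s'.+1 then
    flatten [seq [seq (off + q)%N :: ks | ks <- power_words s' (D - q)]
            | q <- [seq q <- iota 0 nt | (q <= D)%N]]
  else if D is 0%N then [:: [::]] else [::].

Definition power_raw s D : V := \sum_(ks <- power_words s D) eword ks.

(* The coefficient of x^(s(nt-1)-D) in the s-th power of the current
   \sum_(q < nt) x^(nt-1-q) e_(off+q), applied to the cyclic vector. *)
Definition power_vec s D : M := gr z (off * s + D) (power_raw s D).

Lemma power_words0 D : power_words 0 D = if D == 0%N then [:: [::]] else [::].
Proof. by case: D. Qed.

Lemma power_raw0 D : power_raw 0 D = (D == 0%N)%:R *: lowest a.
Proof.
rewrite /power_raw power_words0; case: eqP => _.
  by rewrite big_seq1 scale1r.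
by rewrite big_nil scale0r.
Qed.

Lemma power_rawS s D : power_raw s.+1 D =
  \sum_(q < nt | (q <= D)%N) E (off + q) (power_raw s (D - q)).
Proof.
rewrite /power_raw /= big_flatten /= big_map big_filter.
rewrite -(big_mkord (fun q => (q <= D)%N)
  (fun q => E (off + q) (\sum_(ks <- power_words s (D - q)) eword ks))).
rewrite /index_iota subn0; apply: eq_bigr => q _.
by rewrite big_map linear_sum.
Qed.

Lemma power_raw_fil s D : power_raw s D \in fil a z (off * s + D).
Proof.
elim: s D => [|s IH] D.
  rewrite power_raw0 muln0; case: eqP => [->|_]; last by rewrite scale0r rpred0.
  by rewrite scale1r lowest_fil0.
rewrite power_rawS; apply: rpred_sum => q leq.
have := eval_op_fil (off + q) (tr_emx (F := F)) (IH (D - q)%N).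
by congr (_ \in fil _ _ _); rewrite mulnS; lia.
Qed.

Lemma power_vecS s D : power_vec s.+1 D =
  \sum_(q < nt | (q <= D)%N) e_ (off + q) (power_vec s (D - q)).
Proof.
rewrite /power_vec power_rawS linear_sum; apply: eq_bigr => q leq.
rewrite (fusion_e_gr _ (power_raw_fil _ _)) /=; congr (gr z _ _).
by rewrite mulnS; lia.
Qed.

Lemma power_vec0 D : power_vec 0 D = (D == 0%N)%:R *: fusion_vec a z.
Proof.
rewrite /power_vec power_raw0 muln0 add0n linearZ fusion_vecE /=.
by case: eqP => [->//|_]; rewrite !scale0r.
Qed.

(** The action of e tensor phi(t). *)
Definition epoly (phi : {poly F}) u : V := \sum_(k < size phi) phi`_k *: E k u.

Lemma tcoef_epoly phi u b :
  tcoef (epoly phi u) b = \sum_i phi.[z i] * tcoef_e i u b.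
Proof.
rewrite tcoef_sum; under eq_bigr do rewrite tcoefZ tcoef_eval_e mulr_sumr.
rewrite exchange_big; apply: eq_bigr => i _ /=.
rewrite horner_coef mulr_suml; apply: eq_bigr => k _.
by rewrite mulrA.
Qed.

Lemma epoly_fil (phi : {poly F}) d D u : (size phi <= d.+1)%N -> u \in fil a z D ->
  epoly phi u \in fil a z (D + d).
Proof.
move=> lephi uD; apply: rpred_sum => k _; rewrite rpredZ//.
apply: fil_le (eval_op_fil k (tr_emx (F := F)) uD).
by rewrite leq_add2l -ltnS; apply: leq_trans (ltn_ord k) lephi.
Qed.

(** Only the leading term counts in the graded module, which leaves the lower terms of phi free to
    choose. *)
Lemma gr_epoly (phi : {poly F}) d D u : phi \is monic -> size phi = d.+1 -> u \in fil a z D ->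
  gr z (D + d) (epoly phi u) = e_ d (gr z D u).
Proof.
move=> mon sz uD; rewrite (fusion_e_gr _ uD) /epoly sz big_ord_recr linearD /=.
move/monicP: mon; rewrite lead_coefE sz /= => ->; rewrite scale1r.
rewrite linear_sum big1 ?add0r// => k _; rewrite linearZ /=.
rewrite (gr_eq0_lt (m' := (D + k)%N)) ?scaler0//; first by rewrite ltn_add2l.
exact: eval_op_fil (tr_emx (F := F)) uD.
Qed.

Definition head_poly : {poly F} := \prod_(p < n | (p < nt)%N) ('X - (z p)%:P).
Definition tail_poly : {poly F} := \prod_(p < n | (nt <= p)%N) ('X - (z p)%:P).
Definition cofactor_poly (i : 'I_n) : {poly F} :=
  \prod_(p < n | (p < nt)%N && (p != i)) ('X - (z p)%:P).

Lemma size_prod_XsubC_pred (I : finType) (P : pred I) (f : I -> F) :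
  size (\prod_(i | P i) ('X - (f i)%:P)) = (#|P|).+1.
Proof. by rewrite -big_filter size_prod_XsubC -sum1_card -big_filter sum1_size. Qed.

Lemma card_head : #|[pred p : 'I_n | (p < nt)%N]| = nt.
Proof. by rewrite -sum1_card (big_ord_narrow le_nt) /= sum1_card card_ord. Qed.

Lemma card_tail : #|[pred p : 'I_n | (nt <= p)%N]| = off.
Proof.
rewrite (eq_card (B := [predC [pred p : 'I_n | (p < nt)%N]])); last first.
  by move=> p; rewrite !inE -leqNgt.
apply/eqP; rewrite -(eqn_add2l nt) subnKC//.
by rewrite -[X in (X + _)%N == _]card_head cardC card_ord.
Qed.

Lemma head_polyE i : (i < nt)%N -> head_poly = ('X - (z i)%:P) * cofactor_poly i.
Proof. by move=> lti; rewrite /head_poly (bigD1 i). Qed.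

Lemma size_cofactor i : (i < nt)%N -> size (cofactor_poly i) = nt.
Proof.
move=> lti; have := size_prod_XsubC_pred [pred p : 'I_n | (p < nt)%N] z.
rewrite -/head_poly (head_polyE lti) card_head size_monicM ?monicXsubC//.
  by rewrite size_XsubC => -[].
by rewrite monic_neq0// monic_prod_XsubC.
Qed.

(* cofactor_coef q evaluated at z i is the coefficient of degree nt-1-q of the
   cofactor of 'X - z i in head_poly. *)
Fixpoint cofactor_coef q : {poly F} :=
  if q is q'.+1 then 'X * cofactor_coef q' + (head_poly`_(nt - q))%:P else 1.

Lemma cofactor_coef_monic q :
  (cofactor_coef q \is monic) /\ (size (cofactor_coef q) = q.+1).
Proof.
elim: q => [|q [mon sz]]; first by rewrite monic1 size_poly1.
have szX : size ('X * cofactor_coef q) = q.+2.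
  by rewrite size_monicM ?monicX ?monic_neq0// size_polyX sz.
have ltsz : (size (head_poly`_(nt - q.+1))%:P < size ('X * cofactor_coef q)%R)%N.
  by rewrite szX; apply: leq_ltn_trans (size_polyC_leq1 _) _.
split; last by rewrite /= size_polyDl.
by rewrite monicE /= lead_coefDl// -monicE monicMl ?monicX.
Qed.

(** Horner's scheme for the division of [head_poly] by X - z_i. *)
Lemma cofactor_coefE i q : (i < nt)%N -> (q < nt)%N ->
  (cofactor_coef q).[z i] = (cofactor_poly i)`_(nt - q.+1).
Proof.
move=> lti; elim: q => [|q IH] ltq /=.
  rewrite hornerC subn1; have : cofactor_poly i \is monic.
    exact: monic_prod_XsubC.
  by rewrite monicE lead_coefE size_cofactor// => /eqP.
rewrite hornerD hornerM hornerX hornerC IH 1?ltnW// (head_polyE lti) mulrBl coefB.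
rewrite coefXM coefCM; case: eqP => [|_]; first by lia.
have -> : (nt - q.+1).-1 = (nt - q.+2)%N by lia.
by rewrite addrC subrK.
Qed.

(** A monic substitute for t^(off + q) that vanishes at z p for nt <= p, so that only the first nt
    tensor factors are acted upon. *)
Definition current_poly q : {poly F} := tail_poly * cofactor_coef q.

Lemma current_poly_monic q :
  (current_poly q \is monic) /\ (size (current_poly q) = (off + q).+1).
Proof.
have [mon sz] := cofactor_coef_monic q.
have tmon : tail_poly \is monic by exact: monic_prod_XsubC.
split; first by rewrite monicMl.
rewrite size_monicM ?monic_neq0// sz /tail_poly size_prod_XsubC_pred card_tail.
by rewrite addSn addnS.
Qed.

Lemma tail_poly_root i : (nt <= i)%N -> tail_poly.[z i] = 0.
Proof.
by move=> lei; rewrite horner_prod (bigD1 i)//= hornerXsubC subrr mul0r.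
Qed.

(* The class of power_eval is power_vec, but power_eval is computed from a
   current with simple poles at the points z p, p < nt. *)
Fixpoint power_eval s D : V :=
  if s is s'.+1 then
    \sum_(q < nt | (q <= D)%N) epoly (current_poly q) (power_eval s' (D - q))
  else (D == 0%N)%:R *: lowest a.

Lemma power_eval_fil s D : power_eval s D \in fil a z (off * s + D).
Proof.
elim: s D => [|s IH] D /=.
  rewrite muln0; case: eqP => [->|_]; last by rewrite scale0r rpred0.
  by rewrite scale1r lowest_fil0.
apply: rpred_sum => q leq.
have [_ sz] := current_poly_monic q.
have := epoly_fil (d := (off + q)%N) (eq_leq sz) (IH (D - q)%N).
by congr (_ \in fil _ _ _); rewrite mulnS; lia.
Qed.

Lemma gr_power_eval s D : gr z (off * s + D) (power_eval s D) = power_vec s D.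
Proof.
elim: s D => [|s IH] D; first by rewrite /power_vec power_raw0.
rewrite power_vecS linear_sum; apply: eq_bigr => q leq; rewrite -IH.
have [mon sz] := current_poly_monic q.
rewrite -(gr_epoly mon sz (power_eval_fil _ _)); congr (gr z _ _).
by rewrite mulnS; lia.
Qed.

Lemma power_eval_big s D : (s * nt.-1 < D)%N -> power_eval s D = 0.
Proof.
elim: s D => [|s IH] D /=.
  by rewrite mul0n; case: D => // D _; rewrite scale0r.
move=> ltD; rewrite big1// => q leq; rewrite IH; last first.
  by have := ltn_ord q; rewrite mulSn in ltD; lia.
rewrite /epoly big1// => k _; by rewrite linear0 scaler0.
Qed.

(** The coordinate b of the s-th power of \sum_(q < nt) x^(nt-1-q) e[current_poly q] on v, as a
    polynomial in x. On tensor factor i this current is tail_poly(z_i) times the cofactor of x - z_i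
    times e. *)
Fixpoint coef_poly_of s b : {poly F} :=
  if s is s'.+1 then
    \sum_(i < n | (i < nt)%N)
      (tail_poly.[z i] * ((0 < b i)%N * (a i - b i))%:R) *:
        (cofactor_poly i * coef_poly_of s' (b - U_(i))%MM)
  else (b == 0%MM)%:R%:P.

Lemma coefM_bound (p q : {poly F}) K j : (size p <= K)%N ->
  (p * q)`_j = \sum_(l < K | (l <= j)%N) p`_l * q`_(j - l).
Proof.
move=> leK; rewrite coefM -(big_mkord xpredT (fun l => p`_l * q`_(j - l))).
rewrite -(big_mkord (fun l => (l <= j)%N) (fun l => p`_l * q`_(j - l))).
have [le|lt] := leqP K j.+1.
  rewrite (big_cat_nat (leq0n K) le) [X in _ + X = _]/= [X in _ + X = _]big1_seq ?addr0.
    rewrite big_seq [RHS]big_seq_cond; apply: eq_bigl => l.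
    by rewrite mem_index_iota; lia.
  move=> l /andP[_]; rewrite mem_index_iota => /andP[leKl _].
  by rewrite nth_default ?mul0r//; apply: leq_trans leKl.
rewrite [RHS](big_cat_nat (leq0n j.+1) (ltnW lt)) /=.
rewrite [X in _ = _ + X]big1_seq ?addr0.
  rewrite big_seq [RHS]big_seq_cond; apply: eq_bigl => l.
  by rewrite mem_index_iota; lia.
by move=> l /andP[lelj]; rewrite mem_index_iota; lia.
Qed.

Lemma size_coef_poly_of s b : (size (coef_poly_of s b) <= (s * nt.-1).+1)%N.
Proof.
elim: s b => [|s IH] b /=; first exact: size_polyC_leq1.
apply: (big_ind (fun p : {poly F} => (size p <= _)%N)) => [|p q lp lq|i lti].
- by rewrite size_poly0.
- by apply: leq_trans (size_polyD _ _) _; rewrite geq_max lp.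
apply: leq_trans (size_scale_leq _ _) _.
apply: leq_trans (size_polyMleq _ _) _.
by have := IH (b - U_(i))%MM; rewrite size_cofactor// mulSn; lia.
Qed.

Lemma coef_poly_ofE s D j b : (j + D = s * nt.-1)%N ->
  (coef_poly_of s b)`_j = tcoef (power_eval s D) b.
Proof.
elim: s D j b => [|s IH] D j b.
  rewrite mul0n => /eqP; rewrite addn_eq0 => /andP[/eqP -> /eqP ->] /=.
  by rewrite coefC eqxx scale1r tcoef_lowest.
move=> ejD /=; rewrite coef_sum tcoef_sum.
under [RHS]eq_bigr do rewrite tcoef_epoly.
rewrite [RHS]exchange_big [RHS](bigID (fun i : 'I_n => (i < nt)%N)) /=.
rewrite [X in _ = _ + X]big1 ?addr0 => [|i lei]; last first.
  rewrite big1// => q _; rewrite /current_poly hornerM tail_poly_root ?mul0r//.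
  by rewrite leqNgt.
apply: eq_bigr => i lti; rewrite coefZ.
rewrite (coefM_bound _ _ (eq_leq (size_cofactor lti))) mulr_sumr.
(* The power x^(nt-1-q) of the cofactor goes with the index q. *)
rewrite [LHS](reindex_inj rev_ord_inj) /=.
rewrite big_mkcond [RHS]big_mkcond; apply: eq_bigr => q _ /=.
have ltq := ltn_ord q; rewrite mulSn in ejD.
rewrite /current_poly hornerM cofactor_coefE// /tcoef_e.
case: ifP => lej; case: ifP => leD //.
- rewrite (IH (D - q)%N); last by lia.
  by ring.
- rewrite (nth_default _ (n := j - _)) ?mulr0//.
  by apply: leq_trans (size_coef_poly_of _ _) _; lia.
- rewrite power_eval_big ?tcoef0 ?mulr0//; lia.
Qed.

Definition pole_poly s : {poly F} :=
  \prod_(p < n | (p < nt)%N) ('X - (z p)%:P) ^+ (s - (a p).-1).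

(** Each of the s currents contributes x - z_p unless it acts on tensor factor p, which happens b p
    times on the way to the exponent b. *)
Lemma dvdp_coef_poly_of s b :
  \prod_(p < n | (p < nt)%N) ('X - (z p)%:P) ^+ (s - b p) %| coef_poly_of s b.
Proof.
elim: s b => [|s IH] b /=.
  by rewrite big1 ?dvd1p// => p _; rewrite sub0n expr0.
apply: (big_ind (fun p : {poly F} => _ %| p)) => [|p q dp dq|i lti].
- exact: dvdp0.
- exact: dvdp_add.
have [->|bi0] := posnP (b i).
  by rewrite mul0n mulr0 scale0r dvdp0.
rewrite -mul_polyC; apply: dvdp_mull.
apply: (dvdp_trans _ (dvdp_mul (dvdpp (cofactor_poly i)) (IH (b - U_(i))%MM))).
rewrite (bigD1 i)//= [X in _ %| _ * X](bigD1 i)//= mulrCA.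
rewrite mnmBE mnm1E eqxx (_ : s - (b i - 1) = s.+1 - b i)%N; last by lia.
apply: dvdp_mul => //; rewrite /cofactor_poly -big_split /=.
elim/big_rec2: _ => [|p u v /andP[ltp pi] duv]; first exact: dvdpp.
apply: dvdp_mul duv; rewrite mnmBE mnm1E eq_sym (negPf pi) subn0 -exprS.
by apply: dvdp_exp2l; lia.
Qed.

Lemma pole_poly_dvdp s b : (forall p, (b p < a p)%N) -> pole_poly s %| coef_poly_of s b.
Proof.
move=> ltb; apply: (dvdp_trans _ (dvdp_coef_poly_of s b)); rewrite /pole_poly.
elim/big_rec2: _ => [|p u v ltp duv]; first exact: dvdpp.
apply: dvdp_mul => //; apply: dvdp_exp2l.
by have := ltb p; lia.
Qed.

Definition pole_order s := (\sum_(p < n | (p < nt)%N) (s - (a p).-1))%N.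

Lemma pole_poly_monic s : (pole_poly s \is monic) /\ size (pole_poly s) = (pole_order s).+1.
Proof.
rewrite /pole_poly /pole_order; elim/big_rec2: _ => [|p d u _ [mon sz]].
  by rewrite monic1 size_poly1.
have monp : ('X - (z p)%:P) ^+ (s - (a p).-1) \is monic by rewrite monic_exp// monicXsubC.
split; first by rewrite monicMl.
by rewrite size_monicM ?monic_neq0// size_exp_XsubC sz addSn addnS.
Qed.

(** The coordinates are multiples of [pole_poly s], whose degree exceeds the index j = s (nt - 1) -
    D. Taking remainders expresses the coefficient of x^j through those of x^j' with j' at least
    that degree; they belong to smaller D and vanish in the graded module. *)
Lemma power_vec_eq0 s D : (s * nt.-1 < D + pole_order s)%N -> power_vec s D = 0.
Proof.
move=> ltD; rewrite -gr_power_eval.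
have [ltD'|leD] := ltnP (s * nt.-1) D; first by rewrite power_eval_big// linear0.
pose j := (s * nt.-1 - D)%N; pose K := pole_order s.
have [monP szP] := pole_poly_monic s.
have ltj : (j < K)%N by rewrite /j /K; lia.
pose ga j' : F := ('X^j' %% pole_poly s)`_j.
have ga_lt j' : (j' < K)%N -> ga j' = (j' == j)%:R.
  move=> ltj'; rewrite /ga modp_small ?coefXn 1?eq_sym//.
  by rewrite size_polyXn szP ltnS.
have key : power_eval s D =
    - \sum_(j' < (s * nt.-1).+1 | (K <= j')%N) ga j' *: power_eval s (s * nt.-1 - j').
  apply: tcoefP => b; rewrite -scaleN1r tcoefZ mulN1r tcoef_sum.
  have [/forallP ltb|] := boolP [forall p, (b p < a p)%N]; last first.
    rewrite negb_forall => /existsP[p]; rewrite -leqNgt => lep.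
    rewrite (tcoef_out _ lep) big1 ?oppr0// => j' _.
    by rewrite tcoefZ (tcoef_out _ lep) mulr0.
  have /eqP mod0 := pole_poly_dvdp s ltb.
  have : (coef_poly_of s b %% pole_poly s)`_j = 0 by rewrite mod0 coef0.
  have szc := size_coef_poly_of s b; set B := (s * nt.-1).+1 in szc *.
  have -> : coef_poly_of s b = \sum_(j' < B) (coef_poly_of s b)`_j' *: 'X^j'.
    rewrite -poly_def; apply/polyP => l; rewrite coef_poly; case: ltnP => // leB.
    by rewrite nth_default//; exact: leq_trans leB.
  rewrite (big_morph (fun p : {poly F} => p %% pole_poly s) (@modpD _ _) (mod0p _)) coef_sum.
  under eq_bigr do rewrite modpZl coefZ -/(ga _).
  have ltjB : (j < B)%N by rewrite /j /B; lia.
  rewrite (bigID (fun j' : 'I_B => (j' < K)%N)) /= (bigD1 (Ordinal ltjB))//=.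
  rewrite ga_lt// eqxx mulr1 big1 ?addr0; last first.
    by move=> l /andP[ltl lj]; rewrite ga_lt// -val_eqE /= in lj *;
      rewrite (negPf lj) mulr0.
  rewrite (@coef_poly_ofE s D); last by rewrite /j; lia.
  move/eqP; rewrite addr_eq0 => /eqP ->; congr (- _).
  apply: eq_big => [j'|j' _]; first by rewrite -leqNgt.
  rewrite tcoefZ mulrC; congr (_ * _); apply: coef_poly_ofE.
  by rewrite subnKC// -ltnS.
rewrite key linearN linear_sum big1 ?oppr0// => j' leK; rewrite linearZ /=.
rewrite (gr_eq0_lt (m' := (off * s + (s * nt.-1 - j'))%N)) ?scaler0//.
  have := ltn_ord j'; rewrite ltn_add2l; move: leK ltD; rewrite -/K.
  by move: (nat_of_ord j') => l; lia.
exact: power_eval_fil.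
Qed.

End CurrentPowers.

(** * Curves through the singular point *)

Section SingularPoint.
Context {F : fieldType} (char0 : forall k, (k.+1%:R : F) != 0).
Context {n : nat} (a : 'I_n -> nat) (z : 'I_n -> F).
Context (a_gt0 : forall i, (0 < a i)%N).
Context (m b : nat) (b_gt1 : (1 < b)%N) (le_nt : (m + b <= n)%N).
Context (aE : forall p : 'I_n, (p < m + b)%N -> (a p).-1 = (minn p m).+1).
Local Notation nt := (m + b)%N.
Local Notation off := (n - nt)%N.
Local Notation M := (fusion a z).
Local Notation N := (\dim {:M}).
Local Notation coords := (@coords F M).
Local Notation e_ := (@fusion_op F n a z (emx (F := F))).
Local Notation comb_e := (@comb_op F n a z (emx (F := F))).
Local Notation vA := (fusion_vec a z).
Local Notation cell := (@cell F n a z).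
Local Notation G := (@power_vec F n a z nt).
Implicit Types (s D k mu : nat) (ka t : F).

(* An upper bound for s + D when power_vec s D != 0. *)
Definition sigma s := (\sum_(l < minn s m.+1) (nt - l))%N.

Lemma sigmaS s : (s <= m)%N -> sigma s.+1 = (sigma s + (nt - s))%N.
Proof.
move=> lem; rewrite /sigma (minn_idPl _) ?ltnS// (minn_idPl _) ?leqW//.
by rewrite big_ord_recr.
Qed.

Lemma sigma_ge s : (m < s)%N -> sigma s = sigma m.+1.
Proof. by move=> lt; rewrite /sigma (minn_idPr lt) (minn_idPr (leqnn _)). Qed.

(** Each step from s <= m adds nt - s >= nt - m = b. *)
Lemma sigma_gap d s : (s + d = m.+1)%N -> (sigma s + d * b <= sigma m.+1)%N.
Proof.
elim: d s => [|d IH] s e; first by rewrite addn0 in e; rewrite e; lia.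
by have := IH s.+1; rewrite sigmaS ?mulSn; lia.
Qed.

Lemma sigma_m : (sigma m.+1 = sigma m + b)%N.
Proof. by rewrite sigmaS// addKn. Qed.

Lemma sigma_sub s : (s <= m.+1)%N -> sigma s = (s + \sum_(l < s) (nt - l).-1)%N.
Proof.
move=> les; rewrite /sigma (minn_idPl les).
transitivity (\sum_(l < s) 1 + \sum_(l < s) (nt - l).-1)%N; last first.
  by rewrite sum1_card card_ord.
rewrite -big_split /=; apply: eq_bigr => l _; have := ltn_ord l; lia.
Qed.

(** [sigma s] is the sum of min(s, a_p - 1) over p < nt, counted by columns: nt - l of the numbers
    a_p - 1 exceed l when l <= m, and none when l > m. *)
Lemma sigma_pole s : (pole_order a nt s + sigma s = s * nt)%N.
Proof.
rewrite /pole_order (big_ord_narrow le_nt) /=.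
transitivity (\sum_(p < nt) (s - (minn p m).+1) + sigma s)%N.
  by congr addn; apply: eq_bigr => p _; rewrite (@aE (widen_ord le_nt p) (ltn_ord p)).
elim: s => [|s IH].
  rewrite /sigma min0n big_ord0 big1// => p _; lia.
have -> : (\sum_(p < nt) (s.+1 - (minn p m).+1) =
    \sum_(p < nt) (s - (minn p m).+1) + \sum_(p < nt) ((minn p m) < s))%N.
  by rewrite -big_split /=; apply: eq_bigr => p _; case: ltnP; lia.
have [les|lts] := leqP s m; last first.
  rewrite sigma_ge 1?ltnW// -(sigma_ge lts).
  have -> : (\sum_(p < nt) (minn p m < s) = nt)%N.
    transitivity (\sum_(p < nt) 1)%N; last by rewrite sum1_card card_ord.
    by apply: eq_bigr => p _; lia.
  by rewrite mulSn; lia.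
rewrite sigmaS//; have -> : (\sum_(p < nt) (minn p m < s) = s)%N.
  have lent : (s <= nt)%N by lia.
  transitivity (\sum_(p < s) 1)%N; last by rewrite sum1_card card_ord.
  rewrite -(big_ord_narrow (F := fun=> 1%N) lent) [RHS]big_mkcond /=.
  by apply: eq_bigr => p _; case: ifP; lia.
by rewrite mulSn; lia.
Qed.

Lemma power_vec_sigma s D : (sigma s < s + D)%N -> G s D = 0.
Proof.
move=> lt; apply: power_vec_eq0 => //; have := sigma_pole s.
have -> : (s * nt = s * nt.-1 + s)%N.
  by rewrite -mulnSr prednK//; lia.
by lia.
Qed.

Definition curve_exponents mu ka t (k : 'I_n) : F :=
  if (off <= k)%N then ka * t ^+ mu / t ^+ (k - off).+1 else 0.

(** The operator is ka t^(mu - nt) times the truncated current at x = t, whose powers are expanded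
    by [G]; B only has to exceed the largest D that occurs. *)
Lemma iter_curve mu ka t s B : (s * nt < B)%N ->
  iter s (comb_e (curve_exponents mu ka t)) vA =
  \sum_(D < B) ((ka * t ^+ mu) ^+ s / t ^+ (s + D)) *: G s D.
Proof.
elim: s B => [|s IH] B ltB.
  rewrite (bigD1 (Ordinal ltB))//= power_vec0 expr0 addn0 expr0 divr1 !scale1r.
  rewrite big1 ?addr0// => D D0; rewrite power_vec0.
  by rewrite -val_eqE /= in D0; rewrite (negPf D0) scale0r scaler0.
set th := ka * t ^+ mu in IH *.
have -> : iter s.+1 (comb_e (curve_exponents mu ka t)) vA =
    \sum_(q < nt) (th / t ^+ q.+1) *: e_ (off + q)
      (iter s (comb_e (curve_exponents mu ka t)) vA).
  rewrite iterS {1}/comb_op /curve_exponents -/th.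
  set w := iter s _ vA.
  rewrite -(big_mkord xpredT (fun k => (if (off <= k)%N then th / t ^+ (k - off).+1
    else 0) *: e_ k w)).
  rewrite (big_cat_nat (leq0n off) (leq_subr _ _)) /= big1_seq ?add0r; last first.
    move=> k /andP[_]; rewrite mem_index_iota => /andP[_ ltk].
    by rewrite leqNgt ltk scale0r.
  rewrite -{1}[off]add0n big_addn subKn// big_mkord; apply: eq_bigr => q _.
  by rewrite leq_addl addnK (addnC (nat_of_ord q)).
transitivity (\sum_(0 <= D < B) \sum_(q < nt | (q <= D)%N)
    (th ^+ s.+1 / t ^+ (s.+1 + D)) *: e_ (off + q) (G s (D - q))); last first.
  rewrite big_mkord; apply: eq_bigr => D _.
  by rewrite power_vecS// scaler_sumr.
rewrite (exchange_big_dep xpredT) //=; apply: eq_bigr => q _.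
have ltq := ltn_ord q; have ltBq : (s * nt < B - q)%N by rewrite mulSn in ltB; lia.
rewrite (IH _ ltBq) linear_sum scaler_sumr.
have leqB : (q <= B)%N by rewrite mulSn in ltB; lia.
rewrite [RHS]big_mkcond [RHS](big_cat_nat (leq0n q) leqB) /=.
rewrite [X in _ = X + _]big1_seq ?add0r => [|D /andP[_]]; last first.
  by rewrite mem_index_iota => /andP[_ ltD]; rewrite leqNgt ltD.
rewrite [RHS](big_addn 0 B q) big_mkord; apply: eq_bigr => D _.
rewrite leq_addl addnK linearZ /= scalerA; congr (_ *: _).
rewrite mulrACA -exprS -invfM -exprD.
by have -> : (q.+1 + (s + D) = s.+1 + (D + q))%N by lia.
Qed.

(* The term of indices s, D has degree k in t once exp(curve_exponents) vA is
   rescaled by t^(sigma m.+1 - mu * m.+1). *)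
Definition curve_cond s D k mu : bool :=
  (s + D <= sigma s)%N && (mu * s + sigma m.+1 == k + (s + D) + mu * m.+1)%N.

(** The exponent of t is not negative, because sigma s - mu s is maximal at s = m + 1. *)
Lemma curve_exp_le s D mu : (mu < b)%N -> (s + D <= sigma s)%N ->
  (s + D + mu * m.+1 <= mu * s + sigma m.+1)%N.
Proof.
move=> ltmu le; have [lts|les] := ltnP m s; first by rewrite sigma_ge// in le; nia.
have [d e] : exists d, (s + d = m.+1)%N by exists (m.+1 - s)%N; lia.
by have := sigma_gap e; rewrite -e; nia.
Qed.

Lemma curve_cond0 s D mu : (0 < mu)%N -> (mu < b)%N ->
  curve_cond s D 0 mu = (s == m.+1) && (D == sigma m.+1 - m.+1)%N.
Proof.
move=> mu0 ltmu; have gapm := sigma_gap (addn0 m.+1).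
have les : (m.+1 <= sigma m.+1)%N by have := sigma_sub (leqnn m.+1); lia.
apply/andP/andP => [[le /eqP e]|[/eqP -> /eqP ->]]; last first.
  by rewrite subnKC// leqnn; split => //; apply/eqP; lia.
have [lts|les'] := ltnP m s.
  rewrite sigma_ge// in le; have [d ed] : exists d, (s = m.+1 + d)%N.
    by exists (s - m.+1)%N; lia.
  have d0 : d = 0%N by nia.
  by split; apply/eqP; lia.
have [d ed] : exists d, (s + d.+1 = m.+1)%N by exists (m - s)%N; lia.
by have := sigma_gap ed; rewrite -ed in e *; nia.
Qed.

(** The exponent is the slack sigma s - (s + D), plus mu for each step of s above m + 1, or at least
    b - mu for each step below. Disjoint cases are written as a sum in order to be cast to
    scalars. *)
Lemma curve_cond1 s D mu : (0 < mu)%N -> (mu < b)%N ->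
  curve_cond s D 1 mu =
  (((s == m.+1) && (D == sigma m.+1 - m.+2)) +
   (mu == 1) * ((s == m.+2) && (D == sigma m.+1 - m.+2)) +
   (mu.+1 == b) * ((s == m) && (D == sigma m - m)))%N :> nat.
Proof.
move=> mu0 ltmu; have gm := sigma_m.
have les : (m.+1 <= sigma m.+1)%N by have := sigma_sub (leqnn m.+1); lia.
have lesm : (m <= sigma m)%N by have := sigma_sub (leqnSn m); lia.
have les2 : (m.+2 <= sigma m.+1)%N by lia.
have [lts|les'] := ltnP m s.
  have [d ed] : exists d, (s = m.+1 + d)%N by exists (s - m.+1)%N; lia.
  have -> : (s == m) = false by lia.
  rewrite andFb muln0 addn0 /curve_cond sigma_ge//.
  case: d ed => [|[|d]] ed.
  - rewrite ed addn0 eqxx; have -> : (m.+1 == m.+2) = false by lia.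
    by rewrite /= muln0 addn0; move: (mu * m.+1)%N => X; lia.
  - rewrite ed addn1 eqxx /=; have -> : (m.+2 == m.+1) = false by lia.
    have -> : (mu * m.+2 = mu + mu * m.+1)%N by rewrite mulnS.
    rewrite add0n; move: (mu * m.+1)%N => X.
    by have [->|ne] := eqVneq mu 1%N; lia.
  have -> : (s == m.+1) = false by lia.
  have -> : (s == m.+2) = false by lia.
  rewrite muln0 /=; case: leqP => //= le.
  have e : (mu * s = mu * m.+1 + mu * d.+2)%N by rewrite ed mulnDr.
  have : (d.+2 <= mu * d.+2)%N by rewrite leq_pmull.
  by rewrite e; move: (mu * m.+1)%N (mu * d.+2)%N => X Y; lia.
have -> : (s == m.+1) = false by lia.
have -> : (s == m.+2) = false by lia.
rewrite /= muln0 /= add0n /curve_cond.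
have [d ed] : exists d, (s + d.+1 = m.+1)%N by exists (m - s)%N; lia.
have gap := sigma_gap ed; case: d ed gap => [|d] ed gap.
  have -> : s = m by lia.
  rewrite eqxx (mulnS mu m) gm; move: (mu * m)%N => X.
  by have [eb|ne] := eqVneq mu.+1 b; lia.
have -> : (s == m) = false by lia.
rewrite muln0; case: leqP => //= le.
have e : (mu * m.+1 = mu * s + mu * d.+2)%N by rewrite -ed mulnDr.
have : (mu.+1 * d.+2 <= b * d.+2)%N by rewrite leq_mul2r ltmu orbT.
move: gap; rewrite [(d.+2 * b)%N]mulnC e (mulSn mu).
by move: (mu * s)%N (mu * d.+2)%N (b * d.+2)%N => X Y Z; lia.
Qed.

(** Truncation orders: R is at least N, as [cexpE] asks, and exceeds m + 2; B exceeds every D that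
    occurs for s < R. *)
Local Notation R := (N + m.+3)%N.
Local Notation B := (R * nt).+1.
Local Notation sg := (sigma m.+1).

Definition curve_coef mu ka k : M :=
  \sum_(s < R) \sum_(D < B)
    ((curve_cond s D k mu)%:R * (ka ^+ s / (s`!%:R * ka ^+ m.+1))) *: G s D.

(** Division by ka^(m+1) makes the limit independent of ka. The number of terms exceeds all
    exponents and is at least 2, as [curve_tangent] asks. *)
Lemma curve_coefE mu ka t : (mu < b)%N -> ka != 0 -> t != 0 ->
  \sum_(k < (mu * R + sg).+2) t ^+ k *: curve_coef mu ka k =
  (t ^+ sg / (ka ^+ m.+1 * t ^+ (mu * m.+1))) *:
    cexp a z (curve_exponents mu ka t).
Proof.
move=> ltmu ka0 t0; rewrite (@cexpE F n a z _ R); last by lia.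
rewrite scaler_sumr; under eq_bigr do rewrite scaler_sumr.
rewrite exchange_big; apply: eq_bigr => s _ /=.
have ltsB : (s * nt < B)%N by rewrite ltnS leq_mul2r ltnW ?orbT.
rewrite (iter_curve _ _ _ ltsB) scaler_sumr [RHS]scaler_sumr.
under eq_bigr do rewrite scaler_sumr.
rewrite exchange_big; apply: eq_bigr => D _ /=; rewrite !scalerA.
under eq_bigr do rewrite scalerA.
rewrite -scaler_suml; have [lt|le] := ltnP (sigma s) (s + D).
  by rewrite power_vec_sigma// !scaler0.
have leE := curve_exp_le ltmu le.
pose k0 := (mu * s + sg - (s + D + mu * m.+1))%N.
have ltk0 : (k0 < (mu * R + sg).+2)%N.
  have : (mu * s <= mu * R)%N by rewrite leq_mul2l ltnW ?orbT.
  by rewrite /k0; lia.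
congr (_ *: _); rewrite (bigD1 (Ordinal ltk0))//= big1 ?addr0; last first.
  move=> k kk0; rewrite /curve_cond le /=; case: eqP => [e|_].
    by case/eqP: kk0; apply: val_inj; rewrite /= /k0; lia.
  by rewrite mul0r mulr0.
rewrite /curve_cond le (_ : (_ == _) = true) ?mul1r; last by apply/eqP; rewrite /k0; lia.
have sf : s`!%:R != 0 :> F by case: (s`!) (fact_gt0 s) => // l _; exact: char0.
have -> : t ^+ sg = t ^+ k0 * t ^+ (s + D) * t ^+ (mu * m.+1) / t ^+ (mu * s).
  rewrite -!exprD; have -> : (k0 + (s + D) + mu * m.+1 = sg + mu * s)%N.
    by rewrite /k0; lia.
  by rewrite exprD mulfK// expf_neq0.
rewrite exprMn -exprM; field.
by rewrite sf !expf_neq0.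
Qed.

Lemma curve_coef_indicator s0 D0 (c : nat -> F) : (s0 < R)%N -> (s0 + D0 <= sigma s0)%N ->
  \sum_(s < R) \sum_(D < B) (((s == s0 :> nat) && (D == D0 :> nat))%:R * c s) *: G s D
    = c s0 *: G s0 D0.
Proof.
move=> lts0 leD0; have ltD0 : (D0 < B)%N.
  have : (sigma s0 <= s0 * nt)%N by have := sigma_pole s0; lia.
  have : (s0 * nt <= R * nt)%N by rewrite leq_mul2r ltnW ?orbT.
  by lia.
rewrite (bigD1 (Ordinal lts0))//= [X in _ + X]big1 ?addr0; last first.
  move=> s ss0; rewrite big1// => D _.
  by rewrite -val_eqE /= in ss0; rewrite (negPf ss0) mul0r scale0r.
rewrite eqxx (bigD1 (Ordinal ltD0))//= eqxx mul1r [X in _ + X]big1 ?addr0// => D DD0.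
by rewrite -val_eqE /= in DD0; rewrite (negPf DD0) mul0r scale0r.
Qed.

(** The extreme vector at s = m + 1, its neighbour one degree lower, and the extreme vectors at s =
    m + 2 and s = m: the candidates for terms of order 0 and 1. *)
Definition base_vec : M := G m.+1 (sg - m.+1).
Definition axis_vec : M := G m.+1 (sg - m.+2).
Definition up_vec : M := G m.+2 (sg - m.+2).
Definition down_vec : M := G m (sigma m - m).

Lemma sigma_bounds : (m.+2 <= sg)%N /\ (m <= sigma m)%N.
Proof.
have := sigma_sub (leqnSn m); have := sigma_m.
by split; lia.
Qed.

Lemma curve_coef0 mu ka : (0 < mu)%N -> (mu < b)%N -> ka != 0 ->
  curve_coef mu ka 0 = (m.+1`!%:R)^-1 *: base_vec.
Proof.
move=> mu0 ltmu ka0; have [sg2 _] := sigma_bounds; rewrite /curve_coef.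
under eq_bigr do under eq_bigr do rewrite curve_cond0//.
rewrite (curve_coef_indicator (fun s => ka ^+ s / (s`!%:R * ka ^+ m.+1))); last 2 first.
- by lia.
- by rewrite subnKC// ltnW.
congr (_ *: _); rewrite invfM mulrCA mulfV ?mulr1// expf_neq0//.
Qed.

Lemma curve_coef1 mu ka : (0 < mu)%N -> (mu < b)%N -> ka != 0 ->
  curve_coef mu ka 1 = (m.+1`!%:R)^-1 *: axis_vec
    + ((mu == 1)%:R * (ka / m.+2`!%:R)) *: up_vec
    + ((mu.+1 == b)%:R * (ka^-1 / m`!%:R)) *: down_vec.
Proof.
move=> mu0 ltmu ka0; have [sg2 sgm] := sigma_bounds; rewrite /curve_coef.
pose c s := ka ^+ s / (s`!%:R * ka ^+ m.+1).
under eq_bigr do under eq_bigr do rewrite curve_cond1// !natrD !natrM !mulrDl !scalerDl -/(c _).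
under eq_bigr do rewrite !big_split.
rewrite !big_split /=; congr (_ + _ + _).
- rewrite (curve_coef_indicator c); [|by lia|by lia].
  by congr (_ *: _); rewrite /c invfM mulrCA mulfV ?mulr1// expf_neq0.
- under eq_bigr do under eq_bigr do rewrite -mulrA -scalerA.
  under eq_bigr do rewrite -scaler_sumr.
  rewrite -scaler_sumr (curve_coef_indicator c); last 2 first.
  - by lia.
  - by rewrite (@sigma_ge m.+2)//; lia.
  rewrite scalerA; congr (_ * _ *: _); rewrite /c [ka ^+ m.+2]exprS invfM.
  by rewrite mulrACA mulfV ?mulr1// expf_neq0.
- under eq_bigr do under eq_bigr do rewrite -mulrA -scalerA.
  under eq_bigr do rewrite -scaler_sumr.
  rewrite -scaler_sumr (curve_coef_indicator c); last 2 first.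
  - by lia.
  - by lia.
  rewrite scalerA; congr (_ * _ *: _); rewrite /c exprS.
  by rewrite !invfM mulrCA [X in _ * X]mulrCA mulfV ?mulr1 ?expf_neq0// mulrC.
Qed.

Lemma curve_tangent_vec mu ka P : (0 < mu)%N -> (mu < b)%N -> ka != 0 ->
  vanishing_on cell P ->
  P.@[coords (curve_coef mu ka 0)] = 0 /\
  dmp P (coords (curve_coef mu ka 0)) (coords (curve_coef mu ka 1)) = 0.
Proof.
move=> mu0 ltmu ka0 IP.
apply: (curve_tangent char0 (w := curve_coef mu ka) (K := (mu * R + sg).+2)) => // t t0.
apply: IP; rewrite curve_coefE//.
by exists (t ^+ sg / (ka ^+ m.+1 * t ^+ (mu * m.+1))), (curve_exponents mu ka t).
Qed.

Let base : M := (m.+1`!%:R)^-1 *: base_vec.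

Lemma base_closed_hull : closed_hull cell base.
Proof.
move=> P IP; have [] := @curve_tangent_vec 1 1 P isT b_gt1 (oner_neq0 F) IP.
by rewrite curve_coef0 ?oner_neq0.
Qed.

(** Up to factorials the velocities are axis + [mu = 1] ka up + [mu = b - 1] ka^-1 down. If b = 2,
    both brackets hold for mu = 1 and the values ka = 1, -1, 2 separate the vectors; otherwise ka =
    1, -1 for mu = 1 and ka = 1 for mu = b - 1 do. The base and its images under e_k are tangent by
    stability of the ideal. *)
Lemma base_tangent P w : vanishing_on cell P ->
  [\/ w = base_vec, w = axis_vec, w = up_vec | w = down_vec]
    \/ (exists k, w = e_ k base_vec) ->
  dmp P (coords base) (coords w) = 0.
Proof.
move=> IP wE; have nf k : (k`!%:R)^-1 != 0 :> F.
  by rewrite invr_eq0; case: (k`!) (fact_gt0 k) => // l _; exact: char0.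
have two0 : (2%:R : F) != 0 by exact: (char0 1).
have tan mu ka : (0 < mu)%N -> (mu < b)%N -> ka != 0 ->
    (m.+1`!%:R)^-1 * dmp P (coords base) (coords axis_vec)
    + (mu == 1)%:R * (ka / m.+2`!%:R) * dmp P (coords base) (coords up_vec)
    + (mu.+1 == b)%:R * (ka^-1 / m`!%:R) * dmp P (coords base) (coords down_vec) = 0.
  move=> mu0 ltmu ka0; have [_] := curve_tangent_vec mu0 ltmu ka0 IP.
  by rewrite curve_coef0// curve_coef1// !dmpD !dmpZ.
have unit_eq0 (c x : F) : c != 0 -> c * x = 0 -> x = 0.
  by move=> c0 /eqP; rewrite mulf_eq0 (negPf c0) => /eqP.
have [eA eU eD] : [/\ dmp P (coords base) (coords axis_vec) = 0,
    dmp P (coords base) (coords up_vec) = 0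
    & dmp P (coords base) (coords down_vec) = 0].
  move: (dmp P _ (coords axis_vec)) (dmp P _ (coords up_vec))
    (dmp P _ (coords down_vec)) tan => A U D tan.
  have N1 : (-1 : F) != 0 by rewrite oppr_eq0 oner_neq0.
  have lt1 : (b.-1 < b)%N by lia.
  have b10 : (0 < b.-1)%N by lia.
  have eb : (b.-1.+1 == b) = true by apply/eqP; lia.
  have [b2|bN2] := eqVneq b 2.
    move: (tan 1 1 isT b_gt1 (oner_neq0 F)) (tan 1 _ isT b_gt1 N1)
      (tan 1 _ isT b_gt1 two0).
    rewrite b2 !eqxx !mul1r invrN !invr1 !mul1r !mulNr !mul1r => t1 t2 t3.
    have eA : A = 0.
      apply: (unit_eq0 _ _ (nf m.+1)); apply: (unit_eq0 2%:R) => //.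
      by rewrite -[RHS](addr0 0) -{1}t1 -t2; ring.
    rewrite eA mulr0 !add0r in t1 t3.
    have eU : U = 0.
      apply: (unit_eq0 _ _ (nf m.+2)); apply: (unit_eq0 3%:R); first exact: (char0 2).
      have -> : 3%:R * (m.+2`!%:R^-1 * U) = 2%:R * (2%:R / m.+2`!%:R * U + 2%:R^-1 / m`!%:R * D)
          - (m.+2`!%:R^-1 * U + m`!%:R^-1 * D).
        by move: (m.+2`!%:R^-1 : F) (m`!%:R^-1 : F) => x y; field.
      by rewrite t3 t1 mulr0 subr0.
    split=> //; apply: (unit_eq0 _ _ (nf m)).
    by move: t1; rewrite eU mulr0 add0r.
  have bm1 : (b.-1 == 1) = false by lia.
  have b2f : (2 == b) = false by lia.
  move: (tan 1 1 isT b_gt1 (oner_neq0 F)) (tan 1 _ isT b_gt1 N1)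
    (tan b.-1 1 b10 lt1 (oner_neq0 F)).
  rewrite eqxx eb bm1 b2f !mul0r !addr0 invr1 !mul1r !mulNr !mul1r => t1 t2 t3.
  have eA : A = 0.
    apply: (unit_eq0 _ _ (nf m.+1)); apply: (unit_eq0 2%:R) => //.
    by rewrite -[RHS](addr0 0) -{1}t1 -t2; ring.
  rewrite eA mulr0 !add0r in t1 t3.
  by split; [|exact: unit_eq0 t1|exact: unit_eq0 t3].
case: wE => [[]->|[k ->]] //.
  have -> : base_vec = m.+1`!%:R *: base.
    by rewrite scalerA mulfV ?scale1r// -invr_eq0.
  rewrite dmpZ; have := base_closed_hull (cell_lie_self char0 IP).
  by rewrite meval_lie_deriv => ->; rewrite mulr0.
have -> : base_vec = m.+1`!%:R *: base.
  by rewrite scalerA mulfV ?scale1r// -invr_eq0.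
rewrite linearZ dmpZ.
have := base_closed_hull (cell_lie_e char0 k IP).
by rewrite meval_lie_deriv => ->; rewrite mulr0.
Qed.

End SingularPoint.

(** * Linear functionals detecting nonzero classes *)

Section Functionals.
Context {F : fieldType} (char0 : forall k, (k.+1%:R : F) != 0).
Context {n : nat} (a : 'I_n -> nat) (z : 'I_n -> F) (z_inj : injective z).
Context (a_gt0 : forall i, (0 < a i)%N).
Local Notation V := (tensor (F := F) a).
Local Notation E := (eval_op (a := a) z (emx (F := F))).
Local Notation M := (fusion a z).
Local Notation eword := (@eword F n a z).
Local Notation top := (top_degree a z).
Implicit Types (u w : V) (b : 'X_{1..n}) (k D r : nat) (ks : seq nat).

(* In the coordinates ev, e_k acts as the derivation \sum_i z_i^k d/dx_i. *)
Definition kappa b : F :=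
  \prod_(i < n) ((b i)`!%:R / (((a i).-1) ^_ (b i))%:R).

Definition ev b w : F := kappa b * tcoef w b.

Lemma natr_neq0 k : (0 < k)%N -> (k%:R : F) != 0.
Proof. by case: k => // k _; exact: char0. Qed.

Lemma ev_e b k w : (forall i, (b i < a i)%N) ->
  ev b (E k w) = \sum_i (b i)%:R * (z i ^+ k * ev (b - U_(i))%MM w).
Proof.
move=> ltb; rewrite /ev tcoef_eval_e mulr_sumr; apply: eq_bigr => i _.
rewrite /tcoef_e; case bi: (b i) => [|m]; first by rewrite mul0n; ring.
rewrite mul1n.
suff e : kappa (b - U_(i))%MM * m.+1%:R = kappa b * (a i - m.+1)%:R.
  transitivity (kappa b * (a i - m.+1)%:R * (z i ^+ k * tcoef w (b - U_(i))%MM)).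
    by ring.
  by rewrite -e; ring.
rewrite /kappa (bigD1 i)//= [in RHS](bigD1 i)//= mnmBE mnm1E eqxx bi subn1 /=.
rewrite [X in _ / _ * X * _ = _](eq_bigr (fun p => ((b p)`!%:R / (((a p).-1) ^_ (b p))%:R))).
  rewrite ffactnSr natrM factS natrM.
  have lt := ltb i; rewrite bi in lt.
  have -> : ((a i).-1 - m = a i - m.+1)%N by lia.
  have n1 : ((a i).-1 ^_ m)%:R != 0 :> F by apply: natr_neq0; rewrite ffact_gt0; lia.
  have n2 : (a i - m.+1)%:R != 0 :> F by apply: natr_neq0; lia.
  by field; rewrite n1 n2.
by move=> p /negPf pi; rewrite mnmBE mnm1E eq_sym pi subn0.
Qed.

(** The exponent of the monomial \prod_l x_(al l). *)
Definition expo r (al : 'I_r -> 'I_n) : 'X_{1..n} :=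
  [multinom (\sum_(l < r) (al l == i))%N | i < n].

Lemma sum_expo r (al : 'I_r -> 'I_n) (h : 'I_n -> F) :
  \sum_i (expo al i)%:R * h i = \sum_(l < r) h (al l).
Proof.
under eq_bigr do rewrite mnmE natr_sum mulr_suml.
rewrite exchange_big; apply: eq_bigr => l _ /=.
rewrite (bigD1 (al l))//= eqxx mul1r big1 ?addr0// => i.
by rewrite eq_sym => /negPf ->; rewrite mul0r.
Qed.

Lemma expo_lift r (al : 'I_r.+1 -> 'I_n) l :
  (expo al - U_(al l))%MM = expo (fun l' => al (lift l l')).
Proof.
apply/mnmP => i; rewrite mnmBE !mnmE (bigD1_ord l)//=.
by rewrite addKn.
Qed.

Definition valid r (al : 'I_r -> 'I_n) := forall i, (expo al i < a i)%N.

Lemma valid_lift r (al : 'I_r.+1 -> 'I_n) l :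
  valid al -> valid (fun l' => al (lift l l')).
Proof.
move=> va i; rewrite -expo_lift; apply: leq_ltn_trans (va i).
by rewrite mnmBE leq_subr.
Qed.

(* The permanent of the powers z (al l) ^+ k, k \in ks, or 0 if size ks != r. *)
Fixpoint perm_eval ks : forall r, ('I_r -> 'I_n) -> F :=
  match ks with
  | [::] => fun r _ => (r == 0%N)%:R
  | k :: ks' => fun r =>
    match r return ('I_r -> 'I_n) -> F with
    | 0 => fun _ => 0
    | r'.+1 => fun al => \sum_(l < r'.+1)
        z (al l) ^+ k * perm_eval ks' (fun l' => al (lift l l'))
    end
  end.

(** Derivations \sum_i z_i^k d/dx_i applied to \prod_l x_(al l), one for each letter, leave a
    permanent. *)
Lemma ev_eword ks r (al : 'I_r -> 'I_n) : valid al ->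
  ev (expo al) (eword ks) = perm_eval ks al.
Proof.
elim: ks r al => [|k ks IH] [|r] al va /=.
- rewrite /ev tcoef_lowest// (_ : expo al = 0%MM).
    rewrite eqxx mulr1 /kappa big1// => i _.
    by rewrite mnm0E ffactn0 divr1.
  by apply/mnmP => i; rewrite mnmE big_ord0 mnm0E.
- rewrite /ev tcoef_lowest// (_ : (_ == _) = false) ?mulr0//.
  apply/eqP => /mnmP/(_ (al ord0)); rewrite mnmE mnm0E big_ord_recl eqxx; lia.
- rewrite ev_e// big1// => i _; by rewrite mnmE big_ord0 mul0r.
rewrite ev_e// (sum_expo al (fun i => z i ^+ k * ev (expo al - U_(i))%MM (eword ks))).
by apply: eq_bigr => l _; rewrite expo_lift IH//; exact: valid_lift.
Qed.

Definition moment (f : 'I_n -> F) k : F := \sum_i f i * z i ^+ k.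

Fixpoint perm_mom ks : forall r, ('I_r -> 'I_n -> F) -> F :=
  match ks with
  | [::] => fun r _ => (r == 0%N)%:R
  | k :: ks' => fun r =>
    match r return ('I_r -> 'I_n -> F) -> F with
    | 0 => fun _ => 0
    | r'.+1 => fun om => \sum_(l < r'.+1)
        moment (om l) k * perm_mom ks' (fun l' => om (lift l l'))
    end
  end.

(** Multilinearity of the permanent; [glue] and [cut] single out the index paired with the first
    letter. *)
Lemma sum_perm_eval ks r (om : 'I_r -> 'I_n -> F) :
  \sum_(al : {ffun 'I_r -> 'I_n}) (\prod_l om l (al l)) * perm_eval ks al
    = perm_mom ks om.
Proof.
elim: ks r om => [|k ks IH] [|r] om /=.
- under eq_bigr do rewrite big_ord0 mulr1.
  by rewrite sumr_const card_ffun !card_ord expn0.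
- by rewrite big1// => al _; rewrite mulr0.
- by rewrite big1// => al _; rewrite mulr0.
under eq_bigr do rewrite mulr_sumr.
rewrite exchange_big; apply: eq_bigr => l _ /=.
pose glue (p : 'I_n * {ffun 'I_r -> 'I_n}) : {ffun 'I_r.+1 -> 'I_n} :=
  [ffun l' => if unlift l l' is Some l'' then p.2 l'' else p.1].
pose cut (al : {ffun 'I_r.+1 -> 'I_n}) : 'I_n * {ffun 'I_r -> 'I_n} :=
  (al l, [ffun l' => al (lift l l')]).
have glueK : cancel glue cut.
  move=> [i al]; rewrite /cut /glue /= ffunE unlift_none; congr (_, _).
  by apply/ffunP => l'; rewrite !ffunE liftK.
have cutK : cancel cut glue.
  move=> al; apply/ffunP => l'; rewrite /glue /cut ffunE /=.
  by case: unliftP => [l'' ->|->//]; rewrite ffunE.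
rewrite (reindex glue) /=; last by exists cut => p _; [exact: glueK|exact: cutK].
rewrite -(pair_bigA _ (fun i al => \prod_l' om l' (glue (i, al) l') *
  (z (glue (i, al) l) ^+ k * perm_eval ks (fun l' => glue (i, al) (lift l l'))))) /=.
rewrite -IH /moment mulr_suml; apply: eq_bigr => i _.
rewrite mulr_sumr; apply: eq_bigr => al _.
rewrite (bigD1_ord l)//= ffunE unlift_none /=.
have -> : \prod_(i0 < r) om (lift l i0) (glue (i, al) (lift l i0)) =
    \prod_(i0 < r) om (lift l i0) (al i0).
  by apply: eq_bigr => l' _; rewrite ffunE liftK.
have -> : (fun l' => glue (i, al) (lift l l')) = al.
  by apply/funext => l'; rewrite ffunE liftK.
by rewrite -!mulrA; congr (_ * _); rewrite mulrCA.
Qed.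

(** The behaviour of a divided difference of order k on powers of the variable. *)
Definition has_order (f : 'I_n -> F) k :=
  (forall k', (k' < k)%N -> moment f k' = 0) /\ moment f k = 1.

(** The permanent of Kronecker deltas between letters and orders. *)
Fixpoint matchings ks : forall r, ('I_r -> nat) -> nat :=
  match ks with
  | [::] => fun r _ => (r == 0%N)
  | k :: ks' => fun r =>
    match r return ('I_r -> nat) -> nat with
    | 0 => fun _ => 0%N
    | r'.+1 => fun ka => (\sum_(l < r'.+1)
        (k == ka l) * matchings ks' (fun l' => ka (lift l l')))%N
    end
  end.

Lemma perm_mom_lt ks r (om : 'I_r -> 'I_n -> F) (ka : 'I_r -> nat) :
    (forall l, has_order (om l) (ka l)) -> (sumn ks < \sum_(l < r) ka l)%N ->
  perm_mom ks om = 0.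
Proof.
elim: ks r om ka => [|k ks IH] [|r] om ka ord_om; rewrite ?big_ord0//= => lt.
rewrite big1// => l _; have [o1 o2] := ord_om l.
have [ltk|lek] := ltnP k (ka l); first by rewrite o1// mul0r.
rewrite (IH _ _ (fun l' => ka (lift l l'))) ?mulr0//.
by move: lt; rewrite (bigD1_ord l)//=; lia.
Qed.

(** A term of the permanent vanishes if some letter is below its order; as the letters add up to no
    more than the orders, only terms with equality throughout remain. *)
Lemma perm_momE ks r (om : 'I_r -> 'I_n -> F) (ka : 'I_r -> nat) :
    (forall l, has_order (om l) (ka l)) -> (sumn ks <= \sum_(l < r) ka l)%N ->
  perm_mom ks om = (matchings ks ka)%:R.
Proof.
elim: ks r om ka => [|k ks IH] [|r] om ka ord_om //= le.
rewrite natr_sum; apply: eq_bigr => l _; have [o1 o2] := ord_om l.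
rewrite natrM; case: ltngtP => [ltk|gtk|ek] /=.
- by rewrite o1// !mul0r.
- rewrite mul0r (@perm_mom_lt _ _ _ (fun l' => ka (lift l l'))) ?mulr0//.
  by move: le; rewrite (bigD1_ord l)//=; lia.
- rewrite ek o2 !mul1r; apply: IH => //.
  by move: le; rewrite (bigD1_ord l)//=; lia.
Qed.

(* The weights of the divided difference at the last ka + 1 points. *)
Definition dd_weight (ka : nat) (p : 'I_n) : F :=
  if (n.-1 - ka <= p)%N then
    \prod_(p' < n | (n.-1 - ka <= p')%N && (p' != p)) (z p - z p')^-1
  else 0.

(** Lagrange interpolation at ka + 1 points reproduces x^k for k <= ka; compare the coefficients of
    x^ka. *)
Lemma dd_weight_order ka : (ka < n)%N -> has_order (dd_weight ka) ka.
Proof.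
move=> ltka; pose Q := [pred p : 'I_n | (n.-1 - ka <= p)%N].
have cardQ : #|Q| = ka.+1.
  have := cardC [pred p : 'I_n | (p < n.-1 - ka)%N]; rewrite card_ord.
  have -> : #|[pred p : 'I_n | (p < n.-1 - ka)%N]| = (n.-1 - ka)%N.
    have le : (n.-1 - ka <= n)%N by lia.
    by rewrite -sum1_card (big_ord_narrow le) /= sum1_card card_ord.
  rewrite (@eq_card _ _ Q) => [|p]; last by rewrite !inE -leqNgt.
  by move: #|Q| => c; lia.
pose L p : {poly F} := \prod_(p' | Q p' && (p' != p)) ('X - (z p')%:P).
have sizeL p : Q p -> size (L p) = ka.+1.
  move=> Qp; rewrite /L (size_prod_XsubC_pred [pred p' | Q p' && (p' != p)]).
  have := cardD1 p Q; rewrite cardQ (_ : p \in Q) // add1n => -[->]; congr (_.+1).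
  by apply: eq_card => p'; rewrite !inE andbC.
have key k : (k <= ka)%N -> moment (dd_weight ka) k = (k == ka)%:R.
  move=> lek; pose g : {poly F} := \sum_(p | Q p) (dd_weight ka p * z p ^+ k) *: L p.
  have gE : g = 'X^k.
    apply/eqP; rewrite -subr_eq0; apply/negPn/negP => ne0.
    pose rs := [seq z p | p in Q].
    have := max_poly_roots (rs := rs) ne0.
    have -> : uniq rs by rewrite map_inj_uniq ?enum_uniq.
    have -> : all (root (g - 'X^k)) rs.
      apply/allP => x /mapP[p]; rewrite mem_enum => Qp ->; apply/eqP.
      have {}Qp : (n.-1 - ka <= p)%N by [].
      rewrite hornerD hornerN hornerXn horner_sum (bigD1 p)//=.
      rewrite [X in _ + X - _]big1 ?addr0; last first.
        move=> p' /andP[Qp' p'p].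
        rewrite hornerZ horner_prod (bigD1 p)/=; last by rewrite /= Qp eq_sym.
        by rewrite hornerXsubC subrr mul0r mulr0.
      rewrite hornerZ horner_prod /dd_weight Qp mulrAC.
      rewrite -big_split /= big1 ?mul1r ?subrr// => p' /andP[_ p'p].
      by rewrite hornerXsubC mulVf// subr_eq0 (inj_eq z_inj) eq_sym.
    move=> /(_ isT isT); rewrite size_image cardQ ltnNge => /negP; apply.
    apply: leq_trans (size_polyD _ _) _; rewrite geq_max size_polyN size_polyXn ltnS lek andbT.
    apply: (big_ind (fun p : {poly F} => (size p <= _)%N)) => [|p q lp lq|p Qp].
    - by rewrite size_poly0.
    - by apply: leq_trans (size_polyD _ _) _; rewrite geq_max lp.
    by apply: leq_trans (size_scale_leq _ _) _; rewrite sizeL.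
  transitivity (g`_ka); last by rewrite gE coefXn eq_sym.
  rewrite coef_sum /moment (bigID Q)/= [X in _ + X]big1 ?addr0; last first.
    by move=> p /negPf nQ; rewrite /dd_weight nQ mul0r.
  apply: eq_bigr => p Qp; rewrite coefZ.
  have : L p \is monic by exact: monic_prod_XsubC.
  by rewrite monicE lead_coefE sizeL// => /eqP ->; rewrite mulr1.
split=> [k' lt|]; last by rewrite key// eqxx.
by rewrite key ?(ltnW lt)// (ltn_eqF lt).
Qed.

Lemma shift_order f k c : has_order f k.+1 -> has_order (fun i => (z i - c) * f i) k.
Proof.
move=> [o1 o2]; have momE k' : moment (fun i => (z i - c) * f i) k' =
    moment f k'.+1 - c * moment f k'.
  rewrite /moment mulr_sumr -sumrB; apply: eq_bigr => i _.
  by rewrite exprS; ring.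
split=> [k' lt|]; rewrite momE.
  by rewrite !o1// ?mulr0 ?subr0// ltnW.
by rewrite o2 o1// mulr0 subr0.
Qed.

(** Evaluates [lam] on the degree D part of the chosen representative, which depends only on the
    class when [lam] kills [fil_pred D]. *)
Definition gr_fun (lam : {linear V -> F^o}) D (x : M) : F^o :=
  \sum_(l < top.+1 | l == D :> nat) lam ((vsval x : Defs.family a z) l).

Lemma gr_fun_linear lam D : linear (gr_fun lam D).
Proof.
move=> c x y; rewrite /gr_fun scaler_sumr -big_split; apply: eq_bigr => l _ /=.
transitivity (lam ((c *: (vsval x : Defs.family a z) + (vsval y : Defs.family a z)) l)).
  by congr (lam (fun_of_fin _ l)); exact: (linearP (vsval : M -> Defs.family a z)).
by rewrite !ffunE linearP.
Qed.

Lemma gr_funE (lam : {linear V -> F^o}) D m w :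
    (forall u, u \in fil_pred a z D -> lam u = 0) -> w \in fil a z m ->
  gr_fun lam D (gr z m w) = if m == D then lam w else 0.
Proof.
move=> lam0 wm; rewrite /gr_fun; set x := vsval _.
have [xR xE] := cls_vsval (gr z m w); rewrite -/x in xR xE.
have dR : x - at_degree z m w \in rees a z by rewrite rpredB// at_degree_rees.
have dS : x - at_degree z m w \in rees_pred a z.
  rewrite -(cls_eq0 _ dR) linearB subr_eq0; apply/eqP; exact: xE.
have [ltD|geD] := ltnP D top.+1; last first.
  rewrite big1 => [|l /eqP lD]; last by have := ltn_ord l; rewrite lD ltnNge geD.
  case: eqP => // mD; rewrite lam0//.
  apply: fil_pred_lt (subvP (top_degreeP a z m) _ wm) => //.
rewrite (big_pred1 (Ordinal ltD)); last by [].
move/mem_familyP: dS => /(_ (Ordinal ltD)); rewrite !ffunE /= => dD.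
have := lam0 _ dD; rewrite linearB /= => /eqP; rewrite subr_eq0 => /eqP ->.
by rewrite eq_sym; case: eqP => // _; rewrite linear0.
Qed.

Definition weight_fun r (W : {ffun 'I_r -> 'I_n} -> F) (w : V) : F^o :=
  \sum_(al : {ffun 'I_r -> 'I_n}) W al * ev (expo al) w.

Lemma weight_fun_linear r W : linear (@weight_fun r W).
Proof.
move=> c u w; rewrite /weight_fun scaler_sumr -big_split; apply: eq_bigr => al _ /=.
by rewrite /ev tcoefD tcoefZ /GRing.scale /=; ring.
Qed.

Lemma weight_fun_eword r (W : {ffun 'I_r -> 'I_n} -> F) ks :
  (forall al : {ffun 'I_r -> 'I_n}, W al != 0 -> valid al) ->
  weight_fun W (eword ks) = \sum_(al : {ffun 'I_r -> 'I_n}) W al * perm_eval ks al.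
Proof.
move=> vW; apply: eq_bigr => al _; have [->|W0] := eqVneq (W al) 0.
  by rewrite !mul0r.
by rewrite ev_eword//; exact: vW.
Qed.

(** Since e-words span the filtration, vanishing on words of weight below D lets the functional
    descend to the graded piece of degree D. *)
Lemma word_functional r (W : {ffun 'I_r -> 'I_n} -> F) (T : seq nat -> F) D :
    (forall al : {ffun 'I_r -> 'I_n}, W al != 0 -> valid al) ->
    (forall ks, \sum_(al : {ffun 'I_r -> 'I_n}) W al * perm_eval ks al = T ks) ->
    (forall ks, (sumn ks < D)%N -> T ks = 0) ->
  exists f : {linear M -> F^o}, forall D' (L : seq (seq nat)),
    (forall ks, ks \in L -> sumn ks = D') ->
    f (gr z D' (\sum_(ks <- L) eword ks)) =
      if D' == D then \sum_(ks <- L) T ks else 0.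
Proof.
move=> vW WT T0.
pose lam : {linear V -> F^o} := HB.pack (weight_fun W)
  (GRing.isLinear.Build F V F^o _ (weight_fun W) (@weight_fun_linear r W)).
have lamE ks : lam (eword ks) = T ks by rewrite -WT; exact: weight_fun_eword.
pose f : {linear M -> F^o} := HB.pack (gr_fun lam D)
  (GRing.isLinear.Build F M F^o _ (gr_fun lam D) (gr_fun_linear lam D)).
exists f => D' L sumL; rewrite /= gr_funE.
- case: eqP => // _; rewrite linear_sum; apply: eq_bigr => ks _; exact: lamE.
- case: D T0 {f} => [|D] T0 u /=; first by rewrite memv0 => /eqP ->; exact: (linear0 lam).
  move=> uD; apply: (fil_lin0 a_gt0 (f := lam) _ uD) => ks lek.
  by rewrite lamE; exact: T0.
rewrite big_seq; apply: rpred_sum => ks /sumL <-; exact: eword_fil.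
Qed.

End Functionals.

(** * Tangent vectors at the singular point *)

Section MatchingCount.
Context (n nt : nat) (le_nt : (nt <= n)%N).
Local Notation off := (n - nt)%N.
Local Notation words := (@power_words n nt).
Implicit Types (s D k r : nat).

Definition in_window r (ka : 'I_r -> nat) : bool :=
  [forall l, (off <= ka l < n)%N].

Lemma in_window_lift r (ka : 'I_r.+1 -> nat) l :
  in_window ka = (off <= ka l < n)%N && in_window (fun l' => ka (lift l l')).
Proof.
apply/forallP/andP => [wa|[wl /forallP wa] l'].
  by split=> //; apply/forallP.
by case: (unliftP l l') => [l'' ->|->] //; exact: wa.
Qed.

Lemma size_power_words s D ks : ks \in words s D -> size ks = s.
Proof.
elim: s D ks => [|s IH] D ks.
  by rewrite power_words0; case: eqP => [_|//]; rewrite inE => /eqP ->.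
by move=> /flatten_mapP[q _ /mapP[ks' /IH <- ->]].
Qed.

Lemma sumn_power_words s D ks : ks \in words s D -> sumn ks = (off * s + D)%N.
Proof.
elim: s D ks => [|s IH] D ks.
  by rewrite power_words0; case: eqP => [->|//]; rewrite inE => /eqP ->; rewrite muln0.
move=> /flatten_mapP[q]; rewrite mem_filter => /andP[leq _] /mapP[ks' /IH e ->] /=.
by rewrite e mulnS; lia.
Qed.

Lemma matchings_size ks r (ka : 'I_r -> nat) : size ks != r -> matchings ks ka = 0%N.
Proof.
elim: ks r ka => [|k ks IH] [|r] ka //= ne.
by rewrite big1// => l _; rewrite IH ?muln0.
Qed.

(** The words run once through all tuples in the window with the given sum, so each of the s!
    bijections is realised by exactly one word. *)
Lemma sum_matchings_words s D (ka : 'I_s -> nat) :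
  (\sum_(ks <- words s D) matchings ks ka =
   s`! * (in_window ka && (\sum_(l < s) ka l == off * s + D)))%N.
Proof.
elim: s D ka => [|s IH] D ka.
  rewrite power_words0 big_ord0 muln0 add0n eq_sym /in_window.
  have -> : [forall l, (off <= ka l < n)%N] by apply/forallP => -[].
  by case: eqP => _; rewrite ?big_seq1 ?big_nil.
rewrite /= big_flatten /= big_map big_filter.
have -> : (\sum_(q <- iota 0 nt | (q <= D)%N)
    \sum_(ks <- [seq (off + q)%N :: ks | ks <- words s (D - q)]) matchings ks ka =
    \sum_(q < nt | (q <= D)%N) \sum_(l < s.+1) (off + q == ka l) *
      \sum_(ks <- words s (D - q)) matchings ks (fun l' => ka (lift l l')))%N.
  rewrite -(big_mkord (fun q => (q <= D)%N) (fun q => \sum_(l < s.+1) (off + q == ka l) *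
      \sum_(ks <- words s (D - q)) matchings ks (fun l' => ka (lift l l')))%N).
  rewrite /index_iota subn0; apply: eq_bigr => q _; rewrite big_map exchange_big.
  by apply: eq_bigr => l _; rewrite big_distrr.
rewrite exchange_big (eq_bigr (fun=> s`! *
  (in_window ka && (\sum_(l < s.+1) ka l == off * s.+1 + D)))%N) => [|l _].
  by rewrite sum_nat_const card_ord factS mulnA.
under eq_bigr do rewrite IH.
rewrite (bigD1_ord l)//= (in_window_lift ka l).
set S := (\sum_(i < s) ka (lift l i))%N.
set w := in_window _.
have [wl|] := boolP (off <= ka l < n)%N; last first.
  move=> nwl; rewrite muln0 big1// => q _.
  by case: eqP => [e|_]; [have := ltn_ord q; lia|rewrite mul0n].
have ltq : (ka l - off < nt)%N by lia.
rewrite big_mkcond (bigD1 (Ordinal ltq))//= subnKC ?eqxx; last by lia.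
rewrite big1 ?addn0; last first.
  move=> q; rewrite -val_eqE /= => ne; case: ifP => // _.
  by case: eqP => [e|_]; [lia|rewrite mul0n].
rewrite mul1n; have wS : w -> (off * s <= S)%N.
  move=> /forallP ww; rewrite /S.
  apply: (@leq_trans (\sum_(i < s) off)%N); first by rewrite sum_nat_const card_ord mulnC.
  by apply: leq_sum => i _; have /andP[] := ww i.
case: ifP => leD.
  congr (_ * nat_of_bool _)%N; case: (w) wS => //= /(_ isT) leS.
  by apply/eqP/eqP; rewrite mulnS; lia.
case: (w) wS => /=; last by rewrite muln0.
move=> /(_ isT) leS; case: eqP => [|_]; last by rewrite muln0.
by rewrite mulnS; lia.
Qed.

Lemma sum_matchings_cons k s D (ka : 'I_s.+1 -> nat) :
  (\sum_(ks <- words s D) matchings (k :: ks) ka =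
   \sum_(l < s.+1) (k == ka l) * (s`! *
     (in_window (fun l' => ka (lift l l')) &&
      (\sum_(l' < s) ka (lift l l') == off * s + D))))%N.
Proof.
rewrite exchange_big; apply: eq_bigr => l _ /=.
by rewrite -big_distrr sum_matchings_words.
Qed.

End MatchingCount.

Definition scons (T : Type) r (x : T) (f : 'I_r -> T) : 'I_r.+1 -> T :=
  fun l => if unlift ord0 l is Some l' then f l' else x.

Lemma scons0 (T : Type) r (x : T) (f : 'I_r -> T) : scons x f ord0 = x.
Proof. by rewrite /scons unlift_none. Qed.

Lemma sconsS (T : Type) r (x : T) (f : 'I_r -> T) l : scons x f (lift ord0 l) = f l.
Proof. by rewrite /scons liftK. Qed.

Definition sconsE := (scons0, sconsS).

(** * Functionals supported on monomials within the bounds *)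

Section TangentSpace.
Context {F : fieldType} (char0 : forall k, (k.+1%:R : F) != 0).
Context {n : nat} (a : 'I_n -> nat) (z : 'I_n -> F) (z_inj : injective z).
Context (a_gt0 : forall i, (0 < a i)%N).
Context (m b : nat) (b_gt1 : (1 < b)%N) (le_nt : (m + b <= n)%N).
Local Notation nt := (m + b)%N.
Local Notation off := (n - nt)%N.
Context (aE : forall p : 'I_n, (p < nt)%N -> (a p).-1 = (minn p m).+1).
Context (a_large : forall p : 'I_n, (nt <= p)%N -> (m.+2 < a p)%N).
Local Notation M := (fusion a z).
Local Notation eword := (@eword F n a z).
Implicit Types (s D k r : nat).

Lemma sum_ltn_le r c : (\sum_(l < r) (l < c) <= c)%N.
Proof.
elim: r c => [|r IH] [|c]; rewrite ?big_ord0//.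
  by rewrite big1.
by rewrite big_ord_recl /= add1n ltnS; exact: IH.
Qed.

(** An index i < nt is hit only from positions l <= min(i, m), thus at most a_i - 1 times; the
    indices from nt on have room for all m + 2 positions. *)
Lemma valid_ladder r (al : 'I_r -> 'I_n) : (r <= m.+2)%N ->
    (forall l : 'I_r, (l <= m)%N -> (l <= al l)%N) ->
    (forall l : 'I_r, (m < l)%N -> (nt <= al l)%N) ->
  valid a al.
Proof.
move=> ler le1 le2 i; rewrite mnmE; have [lti|gei] := ltnP i nt.
  apply: (@leq_ltn_trans (minn i m).+1); last by rewrite -aE// prednK.
  apply: leq_trans (sum_ltn_le r _); apply: leq_sum => l _.
  case: eqP => //= eal; have := le1 l; have := le2 l.
  by rewrite eal lt0b ltnS leq_min; case: (leqP l m); lia.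
apply: leq_ltn_trans (a_large gei); apply: leq_trans ler.
rewrite -[X in (_ <= X)%N]card_ord -sum1_card.
by apply: leq_sum => l _; case: eqP.
Qed.

(** An index i < nt is hit at most once from the first two positions and at most min(i, m) times
    from the others. *)
Lemma valid_split (al : 'I_m.+2 -> 'I_n) : al ord0 != al (lift ord0 ord0) ->
    (forall l : 'I_m, (l < al (lift ord0 (lift ord0 l)))%N) ->
  valid a al.
Proof.
move=> ne01 le i; rewrite mnmE !big_ord_recl.
have : ((al ord0 == i) + (al (lift ord0 ord0) == i) <= 1)%N.
  case: (al ord0 =P i) => [e0|_]; case: (al (lift ord0 ord0) =P i) => [e1|_] //.
  by move: ne01; rewrite e0 e1 eqxx.
have [lti|gei] := ltnP i nt.
  have : (\sum_(l < m) (al (lift ord0 (lift ord0 l)) == i) <= minn i m)%N.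
    apply: leq_trans (sum_ltn_le m _); apply: leq_sum => l _.
    case: eqP => //= eal; have := le l.
    by rewrite eal lt0b leq_min => ->; rewrite ltn_ord.
  by have := aE lti; have := a_gt0 i; lia.
have : (\sum_(l < m) (al (lift ord0 (lift ord0 l)) == i) <= m)%N.
  rewrite -[X in (_ <= X)%N]card_ord -sum1_card.
  by apply: leq_sum => l _; case: eqP.
by have := a_large gei; lia.
Qed.

Lemma dd_weight_support k (p : 'I_n) : dd_weight z k p != 0 -> (n.-1 - k <= p)%N.
Proof. by rewrite /dd_weight; case: ifP => //; rewrite eqxx. Qed.

(** The divided difference of order ka l lives on the points from n - 1 - ka l on, so the bounds on
    ka place its support as [valid_ladder] requires. *)
Lemma ladder_functional r (ka : 'I_r -> nat) : (r <= m.+2)%N ->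
    (forall l : 'I_r, (l <= m)%N -> (ka l + l < n)%N) ->
    (forall l : 'I_r, (m < l)%N -> (ka l < off)%N) ->
  exists f : {linear M -> F^o}, forall D (L : seq (seq nat)),
    (forall ks, ks \in L -> sumn ks = D) ->
    f (gr z D (\sum_(ks <- L) eword ks)) =
      ((D == \sum_(l < r) ka l) * \sum_(ks <- L) matchings ks ka)%N%:R.
Proof.
move=> ler le1 le2.
have ltka l : (ka l < n)%N by have := le1 l; have := le2 l; case: (leqP l m); lia.
have ord_om l : has_order z (dd_weight z (ka l)) (ka l) by exact: dd_weight_order.
pose W (al : {ffun 'I_r -> 'I_n}) := \prod_l dd_weight z (ka l) (al l).
have vW (al : {ffun 'I_r -> 'I_n}) : W al != 0 -> valid a al.
  move=> /prodf_neq0 W0; apply: valid_ladder => // l lel.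
    by have := dd_weight_support (W0 l isT); have := le1 l lel; lia.
  by have := dd_weight_support (W0 l isT); have := le2 l lel; lia.
have [f fE] := word_functional char0 a_gt0 vW
  (fun ks => sum_perm_eval z ks _) (fun ks => @perm_mom_lt _ _ _ ks _ _ _ ord_om).
exists f => D L sumL; rewrite fE//; case: eqP => [eD|_]; last by rewrite mul0n.
rewrite mul1n natr_sum !big_seq; apply: eq_bigr => ks ksL.
by rewrite (perm_momE ord_om)// sumL// eD.
Qed.


(* The factor z (al 0) - z (al 1) of the weight makes the first two indices
   distinct, so that both may be unrestricted although a 0 = 2. *)
Lemma split_functional k1 (ta : 'I_m -> nat) : (k1 < n)%N ->
    (forall l, (ta l + l.+1 < n)%N) ->
  exists f : {linear M -> F^o}, forall D (L : seq (seq nat)),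
    (forall ks, ks \in L -> sumn ks = D) ->
    f (gr z D (\sum_(ks <- L) eword ks)) =
      if D == (n.-2 + k1 + \sum_(l < m) ta l)%N then
        (\sum_(ks <- L) matchings ks (scons n.-2 (scons k1 ta)))%N%:R -
        ((0 < k1) * \sum_(ks <- L) matchings ks (scons n.-1 (scons k1.-1 ta)))%N%:R
      else 0.
Proof.
move=> ltk1 ltta; have n_gt1 : (1 < n)%N by lia.
have lt_last : (n.-1 < n)%N by lia.
(* Writing z_0 - z_1 as (z_0 - c) - (z_1 - c) splits the weight into two products, each with one
   order lowered by 1. The last point is taken for c because the weight of order 0 lives there, so
   the second product vanishes for k1 = 0. *)
pose c := z (Ordinal lt_last).
pose om0 := dd_weight z n.-1; pose om1 := dd_weight z k1.
pose om0' p := (z p - c) * om0 p; pose om1' p := (z p - c) * om1 p.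
pose omt (l : 'I_m) := dd_weight z (ta l).
pose omA := scons om0' (scons om1 omt); pose omB := scons om0 (scons om1' omt).
have ord0' : has_order z om0' n.-2.
  by apply: shift_order; rewrite (_ : n.-2.+1 = n.-1); [exact: dd_weight_order|lia].
have ordt l : has_order z (omt l) (ta l) by apply: dd_weight_order => //; have := ltta l; lia.
have ordA l : has_order z (omA l) (scons n.-2 (scons k1 ta) l).
  case: (unliftP ord0 l) => [l' ->|->]; rewrite /omA !sconsE//.
  by case: (unliftP ord0 l') => [l'' ->|->]; rewrite !sconsE//; exact: dd_weight_order.
have ordB l : (0 < k1)%N -> has_order z (omB l) (scons n.-1 (scons k1.-1 ta) l).
  move=> k1_gt0; case: (unliftP ord0 l) => [l' ->|->]; rewrite /omB !sconsE//.
    case: (unliftP ord0 l') => [l'' ->|->]; rewrite !sconsE//.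
    by apply: shift_order; rewrite prednK//; exact: dd_weight_order.
  exact: dd_weight_order.
have momB0 ks : k1 = 0%N -> perm_mom z ks omB = 0.
  move=> k10; rewrite -sum_perm_eval big1// => al _.
  rewrite (bigD1 (lift ord0 ord0))//= /omB !sconsE /om1' /om1 k10.
  have [->|/dd_weight_support le] := eqVneq (dd_weight z 0 (al (lift ord0 ord0))) 0.
    by rewrite mulr0 !mul0r.
  have -> : al (lift ord0 ord0) = Ordinal lt_last.
    by move: (al _) le => p le; apply: val_inj => /=; have := ltn_ord p; lia.
  by rewrite subrr !mul0r.
pose W (al : {ffun 'I_m.+2 -> 'I_n}) := (z (al ord0) - z (al (lift ord0 ord0))) *
  (om0 (al ord0) * (om1 (al (lift ord0 ord0)) *
    \prod_l omt l (al (lift ord0 (lift ord0 l))))).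
pose T ks := perm_mom z ks omA - perm_mom z ks omB.
have WT ks : \sum_(al : {ffun 'I_m.+2 -> 'I_n}) W al * perm_eval z ks al = T ks.
  rewrite /T -!sum_perm_eval -sumrB; apply: eq_bigr => al _.
  rewrite -mulrBl; congr (_ * _); rewrite !big_ord_recl /omA /omB !sconsE.
  under [in RHS]eq_bigr do rewrite !sconsE.
  under [in X in _ = _ - X]eq_bigr do rewrite !sconsE.
  by rewrite /W /om0' /om1'; ring.
have vW (al : {ffun 'I_m.+2 -> 'I_n}) : W al != 0 -> valid a al.
  rewrite /W !mulf_eq0 !negb_or subr_eq0 (inj_eq z_inj) => /and4P[ne01 _ _ /prodf_neq0 W0].
  apply: valid_split => // l; have := dd_weight_support (W0 l isT).
  by have := ltta l; lia.
have sumA : (\sum_(l < m.+2) scons n.-2 (scons k1 ta) l =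
    n.-2 + k1 + \sum_(l < m) ta l)%N.
  rewrite !big_ord_recl !sconsE addnA; congr (_ + _)%N.
  by apply: eq_bigr => l _; rewrite !sconsE.
have sumB : (0 < k1)%N -> (\sum_(l < m.+2) scons n.-1 (scons k1.-1 ta) l =
    n.-2 + k1 + \sum_(l < m) ta l)%N.
  move=> k1_gt0; rewrite !big_ord_recl !sconsE addnA; congr (_ + _)%N; first by lia.
  by apply: eq_bigr => l _; rewrite !sconsE.
have T0 ks : (sumn ks < n.-2 + k1 + \sum_(l < m) ta l)%N -> T ks = 0.
  move=> lt; rewrite /T (perm_mom_lt ordA) ?sumA// sub0r.
  have [/momB0 ->|k1_gt0] := posnP k1; first by rewrite oppr0.
  by rewrite (perm_mom_lt (ordB^~ k1_gt0)) ?oppr0 ?sumB.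
have [f fE] := word_functional char0 a_gt0 vW WT T0.
exists f => D L sumL; rewrite fE//; case: eqP => // eD.
rewrite /T sumrB; congr (_ - _).
  rewrite natr_sum !big_seq; apply: eq_bigr => ks ksL.
  by rewrite (perm_momE ordA)// sumL// sumA eD.
have [k10|k1_gt0] := posnP k1; first by rewrite big1// => ks _; rewrite momB0.
rewrite mul1n natr_sum !big_seq; apply: eq_bigr => ks ksL.
by rewrite (perm_momE (ordB^~ k1_gt0))// sumL// sumB// eD.
Qed.

End TangentSpace.

(** * Independence of the tangent vectors *)

Section FreeTangentVectors.
Context {F : fieldType} (char0 : forall k, (k.+1%:R : F) != 0).
Context {n : nat} (a : 'I_n -> nat) (z : 'I_n -> F) (z_inj : injective z).
Context (a_gt0 : forall i, (0 < a i)%N).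
Context (m b : nat) (b_gt1 : (1 < b)%N) (le_nt : (m + b <= n)%N).
Local Notation nt := (m + b)%N.
Local Notation off := (n - nt)%N.
Context (aE : forall p : 'I_n, (p < nt)%N -> (a p).-1 = (minn p m).+1).
Context (a_large : forall p : 'I_n, (nt <= p)%N -> (m.+2 < a p)%N).
Local Notation M := (fusion a z).
Local Notation e_ := (@fusion_op F n a z (emx (F := F))).
Local Notation eword := (@eword F n a z).
Local Notation G := (@power_vec F n a z nt).
Local Notation words := (@power_words n nt).
Local Notation sg := (sigma m b m.+1).
Local Notation vbase := (base_vec a z m b).
Local Notation vaxis := (axis_vec a z m b).
Local Notation vup := (up_vec a z m b).
Local Notation vdown := (down_vec a z m b).
Local Notation base_deg := (off * m.+1 + (sg - m.+1))%N.
Local Notation shift k := [seq k :: ks | ks <- words m.+1 (sg - m.+1)].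
Implicit Types (s D k r : nat) (L : seq (seq nat)).

Lemma e_base_vec k :
  e_ k vbase = gr z (base_deg + k) (\sum_(ks <- shift k) eword ks).
Proof.
rewrite /base_vec /power_vec (fusion_e_gr _ (power_raw_fil a z le_nt _ _)).
by congr (gr z _ _); rewrite /power_raw linear_sum big_map.
Qed.

Lemma sumn_shift k ks : ks \in shift k -> sumn ks = (base_deg + k)%N.
Proof. case/mapP => ks' /(sumn_power_words le_nt) e ->; by rewrite /= e; exact: addnC. Qed.

Lemma size_shift k ks : ks \in shift k -> size ks = m.+2.
Proof. by case/mapP => ks' /size_power_words e ->; rewrite /= e. Qed.

(** The largest orders that the ladder permits add up to the degree of the extreme vector
    [G s (sigma s - s)]. *)
Lemma sum_top_exponents s : (s <= m.+1)%N ->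
  (\sum_(l < s) (n.-1 - l) = off * s + (sigma m b s - s))%N.
Proof.
move=> les; rewrite (sigma_sub b_gt1 le_nt les) addKn.
transitivity (\sum_(l < s) (off + (nt - l).-1))%N.
  by apply: eq_bigr => l _; have := ltn_ord l; lia.
by rewrite big_split sum_nat_const card_ord mulnC.
Qed.

Lemma sum_matchings_size L s r (ka : 'I_r -> nat) :
  (forall ks, ks \in L -> size ks = s) -> s != r ->
  (\sum_(ks <- L) matchings ks ka = 0)%N.
Proof.
move=> sizeL ne; rewrite big_seq big1// => ks /sizeL sz.
by rewrite matchings_size// sz.
Qed.

Lemma fact_neq0 k : (k`!%:R : F) != 0.
Proof. by apply: natr_neq0 => //; exact: fact_gt0. Qed.

(** Classes with r letters are separated by degree, and all others have no matching with ka; in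
    particular [e_ k vbase] has m + 2 letters. *)
Lemma detect_power_vec r D (ka : 'I_r -> nat) : (r <= m.+1)%N ->
    (forall l, (ka l + l < n)%N) -> in_window n nt ka ->
    (\sum_(l < r) ka l = off * r + D)%N ->
  exists f : {linear M -> F^o}, [/\ f (G r D) != 0,
    forall s D', (s, D') != (r, D) -> f (G s D') = 0
    & forall k, f (e_ k vbase) = 0].
Proof.
move=> ler ltka wka sumka.
have [|l|l|f fE] := ladder_functional char0 z_inj a_gt0 b_gt1 le_nt aE a_large (ka := ka).
- by lia.
- by move=> _; exact: ltka.
- by have := ltn_ord l; lia.
have words_sum := sumn_power_words le_nt.
exists f; split=> [|s D' ne|k].
- rewrite /power_vec (fE _ _ (words_sum _ _)) sumka eqxx mul1n.
  by rewrite sum_matchings_words// wka sumka eqxx muln1 fact_neq0.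
- rewrite /power_vec (fE _ _ (words_sum _ _)) sumka.
  have [es|nes] := eqVneq s r; last first.
    by rewrite (sum_matchings_size _ (@size_power_words _ _ _ _)) ?muln0.
  rewrite es eqn_add2l (_ : (D' == D) = false) ?mul0n//.
  by apply: contraNF ne => /eqP ->; rewrite es.
rewrite e_base_vec (fE _ _ (@sumn_shift k)).
by rewrite (sum_matchings_size _ (@size_shift k)) ?muln0//; lia.
Qed.

Lemma sum_matchings_shift k D (ka : 'I_m.+2 -> nat) : D = (sg - m.+1)%N ->
    (forall l, k == ka l -> in_window n nt (fun l' => ka (lift l l'))) ->
    (\sum_(l < m.+2) ka l = base_deg + k)%N ->
  (\sum_(ks <- [seq k :: ks | ks <- words m.+1 D]) matchings ks ka =
   (\sum_(l < m.+2) (k == ka l)) * m.+1`!)%N.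
Proof.
move=> -> wka sumka; rewrite big_map sum_matchings_cons// big_distrl.
apply: eq_bigr => l _ /=; case: eqP => [ek|]; last by rewrite !mul0n.
rewrite wka ?ek// (_ : (_ == _)) ?muln1//.
by apply/eqP; move: sumka; rewrite (bigD1_ord l)//= -ek; lia.
Qed.

(** A ladder n-1, ..., n-1-m followed by k, which is admissible as k < off. The letters of [vup] are
    at least off and cannot match k; other k' differ in degree. *)
Lemma detect_shift_low k : (k < off)%N ->
  exists f : {linear M -> F^o}, [/\ f (e_ k vbase) != 0, f vup = 0
    & forall k', k' != k -> f (e_ k' vbase) = 0].
Proof.
move=> ltk; pose ka (l : 'I_m.+2) := if (l <= m)%N then (n.-1 - l)%N else k.
have [|l|l|f fE] := ladder_functional char0 z_inj a_gt0 b_gt1 le_nt aE a_large (ka := ka).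
- by [].
- by rewrite /ka => ->; have := ltn_ord l; lia.
- by rewrite /ka ltnNge => /negPf ->.
have sumka : (\sum_(l < m.+2) ka l = base_deg + k)%N.
  rewrite big_ord_recr /= /ka /= ltnn -sum_top_exponents//; congr (_ + _)%N.
  by apply: eq_bigr => l _ /=; rewrite -ltnS ltn_ord.
exists f; split=> [||k' nek].
- rewrite e_base_vec (fE _ _ (@sumn_shift k)) sumka eqxx mul1n.
  rewrite sum_matchings_shift//.
    rewrite natrM mulf_neq0 ?fact_neq0//; apply: natr_neq0 => //.
    by rewrite (bigD1 ord_max)//= /ka /= ltnn eqxx.
  move=> l; rewrite /ka; case: leqP => [lel|gtl _]; first by have := ltn_ord l; lia.
  have -> : l = ord_max by apply: val_inj; have := ltn_ord l; rewrite /=; lia.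
  apply/forallP => l'; have := ltn_ord l'; rewrite lift_max ltnS => lel'.
  by rewrite lel'; move: lel'; move: (nat_of_ord l') => q; lia.
- rewrite /up_vec /power_vec (fE _ _ (sumn_power_words le_nt (s := m.+2) (D := _))).
  rewrite sum_matchings_words// (_ : in_window _ _ _ = false) ?muln0//.
  by apply/negP => /forallP/(_ ord_max); rewrite /ka /= ltnn; lia.
rewrite e_base_vec (fE _ _ (@sumn_shift k')) sumka eqn_add2l.
by rewrite (negPf nek) mul0n.
Qed.

Lemma sum_split_exponents k1 :
  (n.-2 + k1 + \sum_(l < m) (n.-2 - l) = (base_deg + k1).-1)%N.
Proof.
rewrite -sum_top_exponents// big_ord_recl /=.
have -> : (\sum_(l < m) (n.-1 - bump 0 l) = \sum_(l < m) (n.-2 - l))%N.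
  by apply: eq_bigr => l _; rewrite /bump; lia.
by move: (\sum_(l < m) _)%N => c; rewrite subn0; lia.
Qed.

Lemma up_deg : (off * m.+2 + (sg - m.+2) = (base_deg + off).-1)%N.
Proof.
have [] := sigma_bounds b_gt1 le_nt; move: sg => s les _.
by rewrite (mulnS _ m.+1); move: off (off * m.+1)%N => c d; lia.
Qed.

Lemma in_window_split k0 k1 : (off <= k0 < n)%N -> (off <= k1 < n)%N ->
  in_window n nt (scons k0 (scons k1 (fun l : 'I_m => n.-2 - l)%N)).
Proof.
move=> w0 w1; apply/forallP => l; case: (unliftP ord0 l) => [l' ->|->].
  case: (unliftP ord0 l') => [l'' ->|->]; rewrite !sconsE//.
  by move: (ltn_ord l'') => /=; move: (nat_of_ord l'') => q; lia.
by rewrite !sconsE.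
Qed.

(** Now k is too large for the last place of a ladder. The two configurations of the split
    functional differ by one occurrence of k, which gives -(m+1)!; k < n - 2 avoids coincidences
    with n - 2 and n - 1. The degree of [vup] is too small. *)
Lemma detect_shift_high k : (off <= k)%N -> (k < n - 2)%N ->
  exists f : {linear M -> F^o}, [/\ f (e_ k vbase) != 0, f vup = 0
    & forall k', k' != k -> f (e_ k' vbase) = 0].
Proof.
move=> lek ltk.
have [|l|f fE] := split_functional char0 z_inj a_gt0 b_gt1 le_nt aE a_large
  (k1 := k.+1) (ta := fun l : 'I_m => n.-2 - l)%N.
- by lia.
- by have := ltn_ord l; lia.
have degE k' : (base_deg + k' == n.-2 + k.+1 + \sum_(l < m) (n.-2 - l))%N = (k' == k).
  by rewrite sum_split_exponents addnS /= eqn_add2l.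
exists f; split=> [||k' nek].
- rewrite e_base_vec (fE _ _ (@sumn_shift k)) degE eqxx /= mul1n.
  have win0 l : in_window n nt (fun l' =>
      scons n.-2 (scons k.+1 (fun l : 'I_m => n.-2 - l)%N) (lift l l')).
    have := @in_window_split n.-2 k.+1; rewrite (in_window_lift _ _ _ l).
    by move=> /(_ _ _)/andP[]//; lia.
  have win1 l : in_window n nt (fun l' =>
      scons n.-1 (scons k (fun l : 'I_m => n.-2 - l)%N) (lift l l')).
    have := @in_window_split n.-1 k; rewrite (in_window_lift _ _ _ l).
    by move=> /(_ _ _)/andP[]//; lia.
  have sums k0 k1 : (k0 + k1 = n.-2 + k.+1)%N ->
      (\sum_(l < m.+2) scons k0 (scons k1 (fun l : 'I_m => n.-2 - l)%N) l = base_deg + k)%N.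
    move=> e; have := sum_split_exponents k.+1; rewrite -e addnS /= => <-.
    rewrite !big_ord_recl !sconsE addnA; congr (_ + _)%N.
    by apply: eq_bigr => l _; rewrite !sconsE.
  rewrite !sum_matchings_shift//; last 2 first.
  + by apply: sums; lia.
  + by apply: sums.
  rewrite !big_ord_recl !sconsE eqxx.
  under eq_bigr do rewrite !sconsE.
  under [in X in _ - X]eq_bigr do rewrite !sconsE.
  set c := (\sum_(l < m) _)%N.
  have -> : (k == n.-2) = false by lia.
  have -> : (k == n.-1) = false by lia.
  have -> : (k == k.+1) = false by lia.
  rewrite !add0n mulnDl mul1n natrD opprD addrCA subrr addr0 oppr_eq0.
  exact: fact_neq0.
- rewrite /up_vec /power_vec (fE _ _ (sumn_power_words le_nt (s := m.+2) (D := _))).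
  have : (0 < base_deg)%N by rewrite -sum_top_exponents// big_ord_recl subn0; lia.
  rewrite up_deg sum_split_exponents addnS /=.
  by move: base_deg => d d_gt0; case: eqP => // e; exfalso; lia.
by rewrite e_base_vec (fE _ _ (@sumn_shift k')) degE (negPf nek).
Qed.

(** The first configuration lies in the window; the second contains off - 1, outside of it, or is
    absent when off = 0. *)
Lemma detect_up : exists f : {linear M -> F^o}, f vup != 0.
Proof.
have [|l|f fE] := split_functional char0 z_inj a_gt0 b_gt1 le_nt aE a_large
  (k1 := off) (ta := fun l : 'I_m => n.-2 - l)%N.
- by lia.
- by have := ltn_ord l; lia.
exists f; rewrite /up_vec /power_vec (fE _ _ (sumn_power_words le_nt (s := m.+2) (D := _))).
rewrite up_deg sum_split_exponents eqxx !sum_matchings_words//.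
rewrite in_window_split; [|by lia|by lia].
have sums k0 k1 : (k0 + k1 = n.-2 + off)%N ->
    (\sum_(l < m.+2) scons k0 (scons k1 (fun l : 'I_m => n.-2 - l)%N) l
      = off * m.+2 + (sg - m.+2))%N.
  move=> e; rewrite up_deg -sum_split_exponents -e.
  rewrite !big_ord_recl !sconsE addnA; congr (_ + _)%N.
  by apply: eq_bigr => l _; rewrite !sconsE.
rewrite sums// eqxx muln1.
case: posnP => [_|off_gt0]; first by rewrite mul0n subr0 fact_neq0.
rewrite (_ : in_window _ _ (scons n.-1 _) = false) ?muln0 ?subr0 ?fact_neq0//.
apply/negP => /forallP/(_ (lift ord0 ord0)); rewrite !sconsE; lia.
Qed.


Lemma free_cons_functional (f : {linear M -> F^o}) (x : M) (W : seq M) :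
  f x != 0 -> {in W, forall w, f w = 0} -> free W -> free (x :: W).
Proof.
move=> fx fW freeW; rewrite free_cons freeW andbT.
have sub : (<<W>> <= lker (linfun f))%VS.
  by apply/span_subvP => w wW; rewrite memv_ker lfunE /= fW.
by apply: contra fx => /(subvP sub); rewrite memv_ker lfunE.
Qed.

(** Ordered so that each vector is detected by a functional killing all the later ones. *)
Definition tangent_frame : seq M :=
  [:: vdown, vbase, vaxis & [seq e_ k vbase | k <- iota 0 (n - 2)] ++ [:: vup]].

Lemma free_tangent_frame : free tangent_frame.
Proof.
have [ge2 gem] := sigma_bounds b_gt1 le_nt.
have freeS d i : (i + d = n - 2)%N ->
    free ([seq e_ k vbase | k <- iota i d] ++ [:: vup]).
  elim: d i => [|d IH] i e.
    have [f fup] := detect_up; rewrite /= seq1_free.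
    by apply: contraNneq fup => ->; rewrite linear0.
  have [f [f1 f2 f3]] : exists f : {linear M -> F^o},
      [/\ f (e_ i vbase) != 0, f vup = 0
        & forall k', k' != i -> f (e_ k' vbase) = 0].
    have [lti|gei] := ltnP i off; first exact: detect_shift_low.
    by apply: detect_shift_high => //; lia.
  apply: (free_cons_functional f1); last by apply: IH; lia.
  move=> w; rewrite mem_cat inE => /orP[/mapP[k]|/eqP -> //].
  by rewrite mem_iota => lek ->; apply: f3; lia.
have tail_eq0 (f : {linear M -> F^o}) : f vup = 0 ->
    (forall k, f (e_ k vbase) = 0) ->
    {in [seq e_ k vbase | k <- iota 0 (n - 2)] ++ [:: vup], forall w, f w = 0}.
  by move=> f1 f2 w; rewrite mem_cat inE => /orP[/mapP[k _ ->]|/eqP -> //].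
have [|l|||f [f1 f2 f3]] := @detect_power_vec m (sigma m b m - m) (fun l => n.-1 - l)%N.
- by [].
- by have := ltn_ord l; lia.
- by apply/forallP => l; have := ltn_ord l; lia.
- by rewrite sum_top_exponents.
apply: (free_cons_functional f1) => [w|].
  rewrite !inE => /or3P[/eqP ->|/eqP ->|].
  + by apply: f2; apply/eqP => -[]; lia.
  + by apply: f2; apply/eqP => -[]; lia.
  + by apply: (tail_eq0 f) => //; apply: f2; apply/eqP => -[]; lia.
have [|l|||{f1 f2 f3} f [f1 f2 f3]] :=
    @detect_power_vec m.+1 (sg - m.+1) (fun l => n.-1 - l)%N.
- by [].
- by have := ltn_ord l; lia.
- by apply/forallP => l; have := ltn_ord l; lia.
- by rewrite sum_top_exponents.
apply: (free_cons_functional f1) => [w|].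
  rewrite inE => /orP[/eqP ->|].
  + by apply: f2; apply/eqP => -[]; lia.
  + by apply: (tail_eq0 f) => //; apply: f2; apply/eqP => -[]; lia.
(* Lowering only the last of the extreme orders by 1 yields the degree of [vaxis]. *)
have [|l|||{f1 f2 f3} f [f1 f2 f3]] :=
    @detect_power_vec m.+1 (sg - m.+2) (fun l => if (l < m)%N then n.-1 - l else n.-2 - l)%N.
- by [].
- by have := ltn_ord l; case: ifP; lia.
- by apply/forallP => l; have := ltn_ord l; case: ifP; lia.
- have := sum_top_exponents (leqnn m.+1); rewrite !big_ord_recr /= ltnn.
  under [in X in _ -> X]eq_bigr do rewrite ltn_ord.
  by move: (\sum_(l < m) _)%N off sg ge2 => c d s; lia.
apply: (free_cons_functional f1) => [w|]; last exact: freeS.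
by apply: (tail_eq0 f) => //; apply: f2; apply/eqP => -[]; lia.
Qed.

Lemma sh_singular_of_block : singular (sh a z).
Proof.
have n_gt0 : (0 < n)%N by lia.
have base0 : (m.+1`!%:R : F)^-1 *: vbase != 0.
  rewrite scaler_eq0 invr_eq0 negb_or fact_neq0 /=.
  have := free_tangent_frame; rewrite /tangent_frame !free_cons => /and3P[_ + _].
  by apply: contraNneq => ->; rewrite mem0v.
have Cbase := @base_closed_hull F char0 n a z a_gt0 m b b_gt1 le_nt aE.
apply: (sh_singular char0 n_gt0 a_gt0 Cbase base0 free_tangent_frame).
  by rewrite /= size_cat size_map size_iota /=; lia.
move=> w P wW IP; apply: (base_tangent char0 a_gt0 b_gt1 le_nt aE IP).
move: wW; rewrite !inE mem_cat inE => /or4P[/eqP ->|/eqP ->|/eqP ->|].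
- by left; constructor 4.
- by left; constructor 1.
- by left; constructor 2.
case/orP => [/mapP[k _ ->]|/eqP ->]; first by right; exists k.
by left; constructor 3.
Qed.

End FreeTangentVectors.

(** * The theorem *)

Section TypeSequence.
Context (t : seq nat) (m b : nat).
Hypothesis (lt_m : (m < size t)%N) (tm : nth 0%N t m = b).
Hypothesis (t1 : forall l, (l < m)%N -> nth 0%N t l = 1%N).

Lemma size_type_seq (u : seq nat) : size (type_seq u) = sumn u.
Proof.
rewrite size_flatten /shape -map_comp (eq_map (g := nth 0%N u)).
  by rewrite -/(mkseq (nth 0%N u) (size u)) mkseq_nth.
by move=> j; rewrite /= size_nseq.
Qed.

Lemma type_seq_cat : exists2 u, type_seq t = [seq j.+2 | j <- iota 0 m] ++ nseq b m.+2 ++ u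
  & all (fun d => m.+2 < d)%N u.
Proof.
exists (flatten [seq nseq (nth 0%N t j) j.+2 | j <- iota m.+1 (size t - m.+1)]); last first.
  apply/allP => d /flatten_mapP[j]; rewrite mem_iota => /andP[ltj _].
  by rewrite mem_nseq => /andP[_ /eqP ->].
rewrite /type_seq; have -> : iota 0 (size t) = iota 0 m ++ m :: iota m.+1 (size t - m.+1).
  by rewrite -[m :: _]/(iota m (size t - m.+1).+1) -{3}(add0n m) -iotaD; congr iota; lia.
rewrite map_cat flatten_cat /= tm; congr (_ ++ _).
rewrite -[RHS]flatten_seq1 -map_comp; congr flatten.
by apply/eq_in_map => j; rewrite mem_iota => /andP[_ ltj]; rewrite /= t1.
Qed.

Lemma leq_sumn_block : (m + b <= sumn t)%N.
Proof.
have [u] := type_seq_cat; rewrite -size_type_seq => -> _.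
by rewrite !size_cat size_map size_iota size_nseq addnA leq_addr.
Qed.

Lemma nth_type_seq_lt p : (p < m + b)%N -> nth 0%N (type_seq t) p = (minn p m).+2.
Proof.
move=> ltp; have [u -> _] := type_seq_cat.
rewrite nth_cat size_map size_iota; case: ltnP => [lt|ge].
  by rewrite (nth_map 0%N) ?size_iota// nth_iota.
have lt : (p - m < b)%N by lia.
by rewrite nth_cat size_nseq lt nth_nseq lt.
Qed.

Lemma nth_type_seq_ge p : (m + b <= p < sumn t)%N ->
  (m.+2 < nth 0%N (type_seq t) p)%N.
Proof.
rewrite -size_type_seq; have [u -> /all_nthP u_gt] := type_seq_cat.
rewrite !size_cat size_map size_iota size_nseq => /andP[gep ltp].
rewrite nth_cat size_map size_iota nth_cat size_nseq.
rewrite (_ : (p < m)%N = false); last by lia.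
rewrite (_ : (p - m < b)%N = false); last by lia.
by apply: u_gt; lia.
Qed.

End TypeSequence.

Theorem lemma7p1 (R : realType) (n s : nat) (t : s.-tuple nat)
  (t_gt0 : forall j : 'I_s, (0 < tnth t j)%N)
  (sum_t : (\sum_(j < s) tnth t j)%N = n)
  (s_neq_n : s <> n)
  (z : 'I_n -> complex R) (z_inj : injective z) :
  singular (sh (fun i : 'I_n => nth 0%N (type_seq t) i) z).
Proof.
have sumn_t : sumn t = n.
  by rewrite sumnE big_tuple.
have nth_gt0 l : (l < s)%N -> (0 < nth 0%N t l)%N.
  by move=> lt; have := t_gt0 (Ordinal lt); rewrite (tnth_nth 0%N).
(* The first block of length at least 2; without one, all the lengths would be 1 and s = n. *)
have [|m /andP[lt_m b_gt1] min_m] := @ex_minnP (fun l => (l < s)%N && (1 < nth 0%N t l)%N).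
  apply/not_existsP => none; apply: s_neq_n; rewrite -sum_t.
  rewrite (eq_bigr (fun=> 1%N)) ?sum1_card ?card_ord// => j _.
  have := none j; rewrite ltn_ord /= (tnth_nth 0%N) => /negP.
  by have := nth_gt0 j (ltn_ord j); lia.
have t1 l : (l < m)%N -> nth 0%N t l = 1%N.
  move=> lt; have := nth_gt0 l (ltn_trans lt lt_m); have := min_m l.
  rewrite (ltn_trans lt lt_m) /=; case: (ltnP 1) => [_ /(_ isT)|]; last by lia.
  by rewrite leqNgt lt.
have lt_size : (m < size t)%N by rewrite size_tuple.
have aE := nth_type_seq_lt lt_size erefl t1.
have a_large := nth_type_seq_ge lt_size erefl t1.
have le_nt : (m + nth 0%N t m <= n)%N.
  by rewrite -sumn_t; exact: leq_sumn_block.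
apply: (sh_singular_of_block _ z_inj _ b_gt1 le_nt) => [k|i|p ltp|p gep].
- by rewrite Num.Theory.pnatr_eq0.
- have [lt|ge] := ltnP i (m + nth 0%N t m); first by rewrite aE.
  by apply: leq_trans (a_large i _); rewrite // ge sumn_t ltn_ord.
- by rewrite aE.
by apply: a_large; rewrite gep sumn_t ltn_ord.
Qed.
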